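(* Assume the Generalized Riemann Hypothesis. Let $q>2$ and let $\chi$ be a primitive Dirichlet character mod $q$. Let $\rho'=\beta'+i\gamma'$ run over the critical points of the Riemann zeta function (points with $\zeta'(\rho')=0$) satisfying $\beta'\geq 1$. Then $$\liminf_{\gamma'\to\infty}|L(\rho',\chi)|\log\log\gamma'\geq\frac{\pi^2e^{-C_0}}{12}\prod_{p\mid q}\frac{p+1}{p},$$ where the product is over the primes $p$ dividing $q$.
   Context: $\zeta$ is the Riemann zeta function, $L(s,\chi)$ is the Dirichlet $L$-function of $\chi$, and $C_0$ is Euler's constant. The Generalized Riemann Hypothesis (GRH) states that all non-trivial zeros of Dirichlet $L$-functions (including $\zeta$) attached to primitive characters lie on the line $\Re s=1/2$. The liminf is taken over the critical points $\rho'=\beta'+i\gamma'$ of $\zeta$ with $\beta'\ge 1$ as $\gamma'\to+\infty$, with $q$ and $\chi$ fixed. *)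

(* Defs.v *)
From Stdlib Require Import Reals ZArith Znumtheory List ClassicalEpsilon.
From Coquelicot Require Import Coquelicot.

Open Scope R_scope.

Definition Cexp (z : C) : C := (exp (Re z) * cos (Im z), exp (Re z) * sin (Im z)).

(* [npow_neg n s] is n^{-s}, meaningful for n >= 1. *)
Definition npow_neg (n : nat) (s : C) : C := Cexp (- s * RtoC (ln (INR n)))%C.

(* Complex (not real) differentiability: the base ring is C. *)
Definition is_complex_derive (f : C -> C) (s l : C) : Prop :=
  is_derive (K := C_AbsRing) (V := C_NormedModule) f s l.

Definition holomorphic_on (D : C -> Prop) (f : C -> C) : Prop :=
  forall s, D s -> exists l, is_complex_derive f s l.

Definition critical_point (f : C -> C) (s : C) : Prop :=
  is_complex_derive f s (RtoC 0).

Record dirichlet_character (q : nat) (chi : Z -> C) : Prop := {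
  modulus_pos : (0 < q)%nat;
  character_mult : forall m n : Z, chi (m * n)%Z = (chi m * chi n)%C;
  character_periodic : forall n : Z, chi (n + Z.of_nat q)%Z = chi n;
  character_support : forall n : Z, chi n <> RtoC 0 <-> Z.gcd n (Z.of_nat q) = 1%Z
}.

Definition induced_by (q : nat) (chi psi : Z -> C) : Prop :=
  forall n : Z, Z.gcd n (Z.of_nat q) = 1%Z -> chi n = psi n.

(* For q = 1 the constant character 1 is primitive. *)
Definition primitive_character (q : nat) (chi : Z -> C) : Prop :=
  dirichlet_character q chi /\
  forall (d : nat) (psi : Z -> C),
    Nat.divide d q -> (d < q)%nat -> dirichlet_character d psi ->
    ~ induced_by q chi psi.

Definition principal (chi : Z -> C) : Prop :=
  forall n : Z, chi n <> RtoC 0 -> chi n = RtoC 1.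

Definition is_dirichlet_series (chi : Z -> C) (s l : C) : Prop :=
  is_series (K := C_AbsRing) (V := C_NormedModule)
    (fun k : nat => (chi (Z.of_nat (S k)) * npow_neg (S k) s)%C) l.

(* The half-plane Re s > 0, without the pole s = 1 when chi is principal. *)
Definition L_domain (chi : Z -> C) (s : C) : Prop :=
  0 < Re s /\ (principal chi -> s <> RtoC 1).

Definition is_L_function (chi : Z -> C) (F : C -> C) : Prop :=
  (forall s, 1 < Re s -> is_dirichlet_series chi s (F s)) /\
  holomorphic_on (L_domain chi) F.

(* The analytic continuation of the Dirichlet series of chi to [L_domain chi];
   it exists for every Dirichlet character and is unique there by the identity
   theorem.  Outside [L_domain chi] the value is arbitrary. *)
Definition L_function (chi : Z -> C) : C -> C :=
  epsilon (inhabits (fun _ : C => RtoC 0)) (is_L_function chi).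

Definition riemann_zeta : C -> C := L_function (fun _ => RtoC 1).

(* The non-trivial zeros are those in the open critical strip.  The modulus
   q = 1 gives the zeta function. *)
Definition GRH : Prop :=
  forall (q : nat) (chi : Z -> C), primitive_character q chi ->
  forall s : C, 0 < Re s < 1 -> L_function chi s = RtoC 0 -> Re s = 1 / 2.

Definition euler_constant : R :=
  real (Lim_seq (fun n : nat => sum_n (fun k : nat => / INR (S k)) n - ln (INR (S n)))).

Definition prime_divisors (q : nat) : list nat :=
  filter (fun p : nat =>
            if prime_dec (Z.of_nat p) then
              if Zdivide_dec (Z.of_nat p) (Z.of_nat q) then true else false
            else false)
         (seq 1 q).

Definition prod_prime_divisors (q : nat) (f : nat -> R) : R :=
  fold_right Rmult 1 (map f (prime_divisors q)).

(* Preimage under Im of the filter of neighbourhoods of +oo. *)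
Definition Im_p_infty (P : C -> Prop) : Prop :=
  exists M : R, forall s : C, M < Im s -> P s.

(* Limit inferior of f along the filter F, as an extended real. *)
Definition LimInf_filter {T : Type} (F : (T -> Prop) -> Prop) (f : T -> R) : Rbar :=
  Lub_Rbar (fun x : R => F (fun t => x <= f t)).

(* Main.v *)
(* Let Re s >= 1 and Im s = t large.  Remove from L the Euler factors of the primes p < x = 2^M, with x
   a little larger than (log t)^2, and let f be the logarithm of what remains.  Put a slightly below
   1/2 and consider the vertical strip of half-width a around s.  On its right side f is
   O(x^-a / log x), a tail of the Euler product; in the strip Re f is O(x^a / log x), by the linear
   growth of L and the Chebyshev-type bound sum_{p<x} p^(a-1) = O(x^a / log x).  The
   Borel-Caratheodory function f / (2A - f) has modulus at most 1, and interpolating it between the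
   two sides gives f(s) = O(sqrt(x^a x^-a) / log x) = o(1).  Hence |L(s)| is at least (1 + o(1)) times
   the product of (1 + 1/p)^-1 over the p < x prime to q, which the third theorem of Mertens and
   zeta(2) = pi^2/6 evaluate.

   L is continued to Re s > 0 by summing its series in blocks of length q.  That L_function, which is
   only known to be complex differentiable at each point, agrees with this continuation follows from
   Goursat's theorem: the difference has a twice differentiable primitive, to which an elementary
   maximum principle applies. *)

Require Import Defs.
From Stdlib Require Import Reals ZArith Znumtheory Lra Lia Classical ClassicalEpsilon List Permutation.
From Coquelicot Require Import Coquelicot.
From mathcomp Require ssreflect ssrfun ssrbool eqtype ssrnat seq div bigop prime binomial fintype.
Open Scope R_scope.

(** * Complex differentiation *)

(** The constant comes from the cut [x = (log t)^lam] with [lam] just above 2: the product of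
    [1 + 1/p] over [p < x] grows like [(6 / pi^2) e^C_0 log x], and [log x] is about [2 log log t];
    hence [12 = 2 * 6]. The exponent 2 is forced by the width of the strip: zeros are excluded only
    to the right of [1/2], so [a < 1/2], while the growth of L fits under [x^a / log x] only if
    [a lam > 1]. The powers [x^a] and [x^-a] cancel exactly in the geometric mean. What tends to 0
    is therefore only the factor [1 / log x] carried by both sides, and the sums over primes must be
    estimated with this saving. Cutting at powers of 2 turns partial summation into dyadic blocks,
    on which [log p] varies by at most [log 2]. The logarithm exists because L has no zero with
    [1/2 < Re s] and [0 < Im s]: GRH covers the open strip, the Euler product the half-plane
    [1 < Re s], and a 3-4-1 argument the line between them. *)

Lemma Cmod_le_abs (z : C) : Cmod z <= Rabs (Re z) + Rabs (Im z).
Proof.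
  replace z with (RtoC (Re z) + Ci * RtoC (Im z))%C at 1
    by (destruct z; apply injective_projections; simpl; ring).
  eapply Rle_trans; [apply Cmod_triangle|].
  rewrite Cmod_mult, Cmod_Ci, !Cmod_R; lra.
Qed.

Lemma Cmod_sqr (z : C) : (Cmod z) ^ 2 = (Re z) ^ 2 + (Im z) ^ 2.
Proof.
  unfold Cmod, Re, Im. apply pow2_sqrt. nra.
Qed.

Lemma Re_le_Cmod (z : C) : Rabs (Re z) <= Cmod z.
Proof. apply re_le_Cmod. Qed.

Lemma Im_le_Cmod (z : C) : Rabs (Im z) <= Cmod z.
Proof.
  eapply Rle_trans; [|apply Rmax_Cmod]. apply Rmax_r.
Qed.

Lemma Cmod_minus_sym (z w : C) : Cmod (z - w) = Cmod (w - z).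
Proof. rewrite <- Cmod_opp. f_equal. ring. Qed.

Lemma Cmod_triangle' (z w : C) : Cmod z - Cmod w <= Cmod (z - w).
Proof.
  assert (H := Cmod_triangle (z - w) w).
  replace (z - w + w)%C with z in H by ring. lra.
Qed.

Lemma Cmod_minus_le (z w : C) : Cmod (z - w) <= Cmod z + Cmod w.
Proof.
  eapply Rle_trans; [apply Cmod_triangle|]. rewrite Cmod_opp. lra.
Qed.

Lemma C_ext (z w : C) : Re z = Re w -> Im z = Im w -> z = w.
Proof. destruct z, w; simpl; intros; subst; reflexivity. Qed.

(** Replaces filters by an estimate in [Cmod], the form in which the rules of differentiation below
    are proved. *)
Lemma is_complex_derive_eps (f : C -> C) (s l : C) :
  is_complex_derive f s l <->
  forall eps, 0 < eps -> exists d, 0 < d /\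
    forall z, Cmod (z - s) < d -> Cmod (f z - f s - l * (z - s)) <= eps * Cmod (z - s).
Proof.
  split.
  - intros [_ H] eps Heps.
    destruct (H s (fun P HP => HP) (mkposreal eps Heps)) as [d Hd].
    exists d. split; [apply cond_pos|].
    intros z Hz. specialize (Hd z Hz). simpl in Hd.
    replace (l * (z - s))%C with ((z - s) * l)%C by ring. exact Hd.
  - intros H. split.
    + apply (is_linear_scal_l (K := C_AbsRing) (V := C_NormedModule) l).
    + intros x Hx.
      (* [s] is the only limit of its own neighbourhood filter. *)
      assert (E : s = x) by exact (is_filter_lim_locally_unique (K:=C_AbsRing) (V:=AbsRing_NormedModule C_AbsRing) s x Hx).
      subst x. intros eps. destruct (H eps (cond_pos eps)) as [d [Hd H']].
      exists (mkposreal d Hd). intros z Hz. specialize (H' z Hz).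
      replace (l * (z - s))%C with ((z - s) * l)%C in H' by ring. exact H'.
Qed.

Lemma cd_bound (f : C -> C) (s l : C) : is_complex_derive f s l ->
  exists d, 0 < d /\ forall z, Cmod (z - s) < d ->
    Cmod (f z - f s) <= (Cmod l + 1) * Cmod (z - s).
Proof.
  intros H. rewrite is_complex_derive_eps in H.
  destruct (H 1 Rlt_0_1) as [d [Hd H']]. exists d. split; auto.
  intros z Hz. specialize (H' z Hz).
  replace (f z - f s)%C with ((f z - f s - l * (z - s)) + l * (z - s))%C by ring.
  eapply Rle_trans; [apply Cmod_triangle|]. rewrite Cmod_mult. lra.
Qed.

Definition ccont (f : C -> C) (s : C) : Prop :=
  forall eps, 0 < eps -> exists d, 0 < d /\
    forall z, Cmod (z - s) < d -> Cmod (f z - f s) < eps.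

Lemma cd_cont (f : C -> C) (s l : C) : is_complex_derive f s l -> ccont f s.
Proof.
  intros H eps Heps. destruct (cd_bound f s l H) as [d [Hd H']].
  assert (Hl := Cmod_ge_0 l).
  exists (Rmin d (eps / (Cmod l + 2))). split.
  - apply Rmin_pos; auto. apply Rdiv_lt_0_compat; lra.
  - intros z Hz. eapply Rle_lt_trans; [apply H'|].
    + eapply Rlt_le_trans; [exact Hz|apply Rmin_l].
    + assert (Hz2 : Cmod (z - s) < eps / (Cmod l + 2))
        by (eapply Rlt_le_trans; [exact Hz|apply Rmin_r]).
      apply Rlt_div_r in Hz2; [|lra]. assert (H0 := Cmod_ge_0 (z - s)). nra.
Qed.

Lemma cd_const (c s : C) : is_complex_derive (fun _ => c) s (RtoC 0).
Proof.
  apply is_complex_derive_eps. intros eps Heps. exists 1. split; [lra|].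
  intros z _. replace (c - c - 0 * (z - s))%C with (RtoC 0) by ring.
  rewrite Cmod_0. apply Rmult_le_pos; [lra|apply Cmod_ge_0].
Qed.

Lemma cd_id (s : C) : is_complex_derive (fun z => z) s (RtoC 1).
Proof.
  apply is_complex_derive_eps. intros eps Heps. exists 1. split; [lra|].
  intros z _. replace (z - s - 1 * (z - s))%C with (RtoC 0) by ring.
  rewrite Cmod_0. apply Rmult_le_pos; [lra|apply Cmod_ge_0].
Qed.

Lemma cd_ext_loc (f g : C -> C) (s l : C) :
  (exists d, 0 < d /\ forall z, Cmod (z - s) < d -> f z = g z) ->
  is_complex_derive f s l -> is_complex_derive g s l.
Proof.
  intros [d [Hd E]] H. apply is_complex_derive_eps. intros eps Heps.
  rewrite is_complex_derive_eps in H.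
  destruct (H eps Heps) as [d' [Hd' H']].
  exists (Rmin d d'). split; [apply Rmin_pos; auto|]. intros z Hz.
  rewrite <- !E.
  - apply H'. eapply Rlt_le_trans; [exact Hz|apply Rmin_r].
  - replace (s - s)%C with (RtoC 0) by ring. now rewrite Cmod_0.
  - eapply Rlt_le_trans; [exact Hz|apply Rmin_l].
Qed.

Lemma cd_ext (f g : C -> C) (s l : C) : (forall z, f z = g z) ->
  is_complex_derive f s l -> is_complex_derive g s l.
Proof. intros E. apply cd_ext_loc. exists 1. split; [lra|auto]. Qed.

Lemma cd_eq (f : C -> C) (s l l' : C) : is_complex_derive f s l -> l = l' ->
  is_complex_derive f s l'.
Proof. now intros H <-. Qed.

Lemma cd_plus (f g : C -> C) (s l m : C) :
  is_complex_derive f s l -> is_complex_derive g s m ->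
  is_complex_derive (fun z => f z + g z)%C s (l + m)%C.
Proof.
  intros Hf Hg. apply is_complex_derive_eps. intros eps Heps.
  rewrite is_complex_derive_eps in Hf. rewrite is_complex_derive_eps in Hg.
  destruct (Hf (eps / 2)) as [d1 [Hd1 H1]]; [lra|].
  destruct (Hg (eps / 2)) as [d2 [Hd2 H2]]; [lra|].
  exists (Rmin d1 d2). split; [apply Rmin_pos; auto|]. intros z Hz.
  assert (K1 := H1 z (Rlt_le_trans _ _ _ Hz (Rmin_l _ _))).
  assert (K2 := H2 z (Rlt_le_trans _ _ _ Hz (Rmin_r _ _))).
  replace (f z + g z - (f s + g s) - (l + m) * (z - s))%C with
    ((f z - f s - l * (z - s)) + (g z - g s - m * (z - s)))%C by ring.
  eapply Rle_trans; [apply Cmod_triangle|]. lra.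
Qed.

Lemma cd_mult (f g : C -> C) (s l m : C) :
  is_complex_derive f s l -> is_complex_derive g s m ->
  is_complex_derive (fun z => f z * g z)%C s (l * g s + f s * m)%C.
Proof.
  intros Hf Hg. apply is_complex_derive_eps. intros eps Heps.
  destruct (cd_bound g s m Hg) as [d0 [Hd0 H0]].
  rewrite is_complex_derive_eps in Hf. rewrite is_complex_derive_eps in Hg.
  (* [K] dominates the coefficients of all three error terms in the decomposition of the increment
     below; hence [3 * K] in [e]. *)
  set (K := Cmod (g s) + Cmod m + 1 + Cmod (f s) + Cmod l * (Cmod m + 1) + 1).
  assert (P1 := Cmod_ge_0 (g s)). assert (P2 := Cmod_ge_0 (f s)).
  assert (P3 := Cmod_ge_0 l). assert (P4 := Cmod_ge_0 m).
  assert (HK : 1 <= K) by (unfold K; nra).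
  set (e := eps / (3 * K)).
  assert (He : 0 < e) by (apply Rdiv_lt_0_compat; lra).
  destruct (Hf e He) as [d1 [Hd1 H1]].
  destruct (Hg e He) as [d2 [Hd2 H2]].
  exists (Rmin (Rmin d0 d1) (Rmin d2 (Rmin 1 e))).
  split; [repeat apply Rmin_pos; auto; lra|]. intros z Hz.
  assert (Z0 : Cmod (z - s) < d0) by (eapply Rlt_le_trans; [exact Hz|];
    eapply Rle_trans; [apply Rmin_l|apply Rmin_l]).
  assert (Z1 : Cmod (z - s) < d1) by (eapply Rlt_le_trans; [exact Hz|];
    eapply Rle_trans; [apply Rmin_l|apply Rmin_r]).
  assert (Z2 : Cmod (z - s) < d2) by (eapply Rlt_le_trans; [exact Hz|];
    eapply Rle_trans; [apply Rmin_r|apply Rmin_l]).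
  assert (Z3 : Cmod (z - s) < Rmin 1 e) by (eapply Rlt_le_trans; [exact Hz|];
    eapply Rle_trans; [apply Rmin_r|apply Rmin_r]).
  assert (Z4 := Rlt_le_trans _ _ _ Z3 (Rmin_l _ _)).
  assert (Z5 := Rlt_le_trans _ _ _ Z3 (Rmin_r _ _)).
  specialize (H0 z Z0). specialize (H1 z Z1). specialize (H2 z Z2).
  assert (Zp := Cmod_ge_0 (z - s)).
  replace (f z * g z - f s * g s - (l * g s + f s * m) * (z - s))%C with
    ((f z - f s - l * (z - s)) * (g s + (g z - g s)) +
     (f s * (g z - g s - m * (z - s)) + l * (z - s) * (g z - g s)))%C by ring.
  eapply Rle_trans; [apply Cmod_triangle|].
  eapply Rle_trans; [apply Rplus_le_compat_l, Cmod_triangle|].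
  rewrite !Cmod_mult.
  assert (G : Cmod (g s + (g z - g s)) <= K).
  { eapply Rle_trans; [apply Cmod_triangle|]. unfold K. nra. }
  assert (A1 : Cmod (f z - f s - l * (z - s)) * Cmod (g s + (g z - g s))
     <= (e * Cmod (z - s)) * K).
  { apply Rmult_le_compat; auto using Cmod_ge_0. }
  assert (A2 : Cmod (f s) * Cmod (g z - g s - m * (z - s)) <= K * (e * Cmod (z - s))).
  { apply Rmult_le_compat; auto using Cmod_ge_0. unfold K; nra. }
  assert (A3 : Cmod l * Cmod (z - s) * Cmod (g z - g s) <= K * (e * Cmod (z - s))).
  { apply Rle_trans with (Cmod l * Cmod (z - s) * ((Cmod m + 1) * Cmod (z - s))).
    - apply Rmult_le_compat_l; auto. apply Rmult_le_pos; auto.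
    - replace (Cmod l * Cmod (z - s) * ((Cmod m + 1) * Cmod (z - s))) with
        ((Cmod l * (Cmod m + 1)) * (Cmod (z - s) * Cmod (z - s))) by ring.
      apply Rmult_le_compat; [nra|nra|unfold K; nra|].
      apply Rmult_le_compat_r; lra. }
  assert (E : 3 * K * e = eps) by (unfold e; field; lra).
  rewrite <- E. lra.
Qed.

Lemma cd_comp (f g : C -> C) (s l m : C) :
  is_complex_derive g s m -> is_complex_derive f (g s) l ->
  is_complex_derive (fun z => f (g z)) s (l * m)%C.
Proof.
  intros Hg Hf. apply is_complex_derive_eps. intros eps Heps.
  destruct (cd_bound g s m Hg) as [d0 [Hd0 H0]].
  rewrite is_complex_derive_eps in Hf. rewrite is_complex_derive_eps in Hg.
  assert (P3 := Cmod_ge_0 l). assert (P4 := Cmod_ge_0 m).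
  destruct (Hf (eps / (2 * (Cmod m + 1)))) as [d1 [Hd1 H1]].
  { apply Rdiv_lt_0_compat; lra. }
  destruct (Hg (eps / (2 * (Cmod l + 1)))) as [d2 [Hd2 H2]].
  { apply Rdiv_lt_0_compat; lra. }
  exists (Rmin d0 (Rmin (d1 / (Cmod m + 1)) d2)).
  split; [repeat apply Rmin_pos; auto; apply Rdiv_lt_0_compat; lra|]. intros z Hz.
  assert (Z0 := Rlt_le_trans _ _ _ Hz (Rmin_l _ _)).
  assert (Z3 := Rlt_le_trans _ _ _ Hz (Rmin_r _ _)).
  assert (Z1 := Rlt_le_trans _ _ _ Z3 (Rmin_l _ _)).
  assert (Z2 := Rlt_le_trans _ _ _ Z3 (Rmin_r _ _)).
  assert (Zp := Cmod_ge_0 (z - s)).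
  specialize (H0 z Z0). specialize (H2 z Z2).
  apply Rlt_div_r in Z1; [|lra].
  assert (K : Cmod (g z - g s) < d1) by lra.
  specialize (H1 _ K).
  replace (f (g z) - f (g s) - l * m * (z - s))%C with
   ((f (g z) - f (g s) - l * (g z - g s)) + l * (g z - g s - m * (z - s)))%C by ring.
  eapply Rle_trans; [apply Cmod_triangle|]. rewrite Cmod_mult.
  assert (B1 : eps / (2 * (Cmod m + 1)) * Cmod (g z - g s) <= eps / 2 * Cmod (z - s)).
  { replace (eps / 2 * Cmod (z - s)) with
      (eps / (2 * (Cmod m + 1)) * ((Cmod m + 1) * Cmod (z - s))) by (field; lra).
    apply Rmult_le_compat_l; auto. apply Rlt_le, Rdiv_lt_0_compat; lra. }
  assert (B2 : Cmod l * Cmod (g z - g s - m * (z - s)) <= eps / 2 * Cmod (z - s)).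
  { replace (eps / 2 * Cmod (z - s)) with
      ((Cmod l + 1) * (eps / (2 * (Cmod l + 1)) * Cmod (z - s))) by (field; lra).
    apply Rmult_le_compat; auto using Cmod_ge_0; lra. }
  lra.
Qed.

Lemma cd_Cinv (s : C) : s <> RtoC 0 ->
  is_complex_derive Cinv s (- (/ s * / s))%C.
Proof.
  intros Hs. apply is_complex_derive_eps. intros eps Heps.
  assert (P := proj1 (Cmod_gt_0 s) Hs).
  exists (Rmin (Cmod s / 2) (eps * (Cmod s) ^ 3 / 2)). split.
  { apply Rmin_pos; [lra|]. assert (0 < (Cmod s) ^ 3) by (apply pow_lt; auto). nra. }
  intros z Hz.
  assert (Z1 := Rlt_le_trans _ _ _ Hz (Rmin_l _ _)).
  assert (Z2 := Rlt_le_trans _ _ _ Hz (Rmin_r _ _)).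
  assert (K : Cmod s / 2 < Cmod z).
  { assert (Q := Cmod_triangle' s z). rewrite Cmod_minus_sym in Q. lra. }
  assert (Hz0 : z <> RtoC 0).
  { intros ->. rewrite Cmod_0 in K. lra. }
  replace (/ z - / s - - (/ s * / s) * (z - s))%C with
   ((z - s) * ((z - s) * (/ z * (/ s * / s))))%C.
  2:{ field; auto. }
  rewrite !Cmod_mult, !Cmod_inv by auto.
  rewrite (Rmult_comm eps). apply Rmult_le_compat_l; [apply Cmod_ge_0|].
  assert (I : / Cmod z <= 2 / Cmod s).
  { replace (2 / Cmod s) with (/ (Cmod s / 2)) by (field; lra).
    apply Rinv_le_contravar; lra. }
  assert (J : 0 < / Cmod s) by (apply Rinv_0_lt_compat; auto).
  apply Rle_trans with ((eps * Cmod s ^ 3 / 2) * (2 / Cmod s * (/ Cmod s * / Cmod s))).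
  - apply Rmult_le_compat; try lra. apply Cmod_ge_0.
    + apply Rmult_le_pos; [|nra]. apply Rlt_le, Rinv_0_lt_compat. lra.
    + apply Rmult_le_compat_r; nra.
  - right. field. lra.
Qed.

Lemma cd_inv (f : C -> C) (s l : C) : is_complex_derive f s l -> f s <> RtoC 0 ->
  is_complex_derive (fun z => / f z)%C s (- (/ f s * / f s) * l)%C.
Proof.
  intros Hf H0. apply (cd_comp Cinv f s); auto. now apply cd_Cinv.
Qed.

(** * The complex exponential *)

Lemma Cexp_plus (z w : C) : Cexp (z + w) = (Cexp z * Cexp w)%C.
Proof.
  unfold Cexp. destruct z as [x y], w as [x' y']; simpl.
  rewrite exp_plus, cos_plus, sin_plus. apply C_ext; simpl; ring.
Qed.

Lemma Cexp_0 : Cexp 0 = RtoC 1.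
Proof. unfold Cexp; simpl. rewrite exp_0, cos_0, sin_0. apply C_ext; simpl; ring. Qed.

Lemma Cmod_Cexp (z : C) : Cmod (Cexp z) = exp (Re z).
Proof.
  unfold Cexp, Cmod; simpl.
  replace (_ + _) with (exp (Re z) ^ 2 * ((sin (Im z))² + (cos (Im z))²)) by (unfold Rsqr; ring).
  rewrite sin2_cos2, Rmult_1_r. apply sqrt_pow2. apply Rlt_le, exp_pos.
Qed.

Lemma Cexp_neq_0 (z : C) : Cexp z <> RtoC 0.
Proof. apply Cmod_gt_0. rewrite Cmod_Cexp. apply exp_pos. Qed.

Lemma Cexp_opp (z : C) : Cexp (- z) = (/ Cexp z)%C.
Proof.
  assert (H := Cexp_plus z (- z)). replace (z + - z)%C with (RtoC 0) in H by ring.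
  rewrite Cexp_0 in H.
  replace (Cexp (- z)) with (/ Cexp z * (Cexp z * Cexp (- z)))%C.
  - rewrite <- H. ring.
  - field. apply Cexp_neq_0.
Qed.

Lemma Cexp_R (x : R) : Cexp (RtoC x) = RtoC (exp x).
Proof. unfold Cexp; simpl. rewrite cos_0, sin_0. apply C_ext; simpl; ring. Qed.

(** From [1 - x <= exp (- x)] follows [(1 - x) * exp x <= 1], so
    [(1 - x) * (exp x - 1 - x) <= x ^ 2], and [1 - x >= 1 / 2]. *)
Lemma exp_bound2 (x : R) : Rabs x <= 1 / 2 -> Rabs (exp x - 1 - x) <= 2 * x ^ 2.
Proof.
  intros Hx. apply Rabs_le_between in Hx.
  assert (L := exp_ineq1_le x). rewrite Rabs_pos_eq by lra.
  assert (M := exp_ineq1_le (- x)). rewrite exp_Ropp in M.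
  assert (E := exp_pos x).
  assert (N : (1 - x) * exp x <= 1).
  { apply Rmult_le_reg_r with (/ exp x); [now apply Rinv_0_lt_compat|].
    rewrite Rmult_assoc, Rinv_r, Rmult_1_r, Rmult_1_l by lra. lra. }
  apply Rmult_le_reg_l with (1 - x); [lra|]. nra.
Qed.

Lemma sin_abs_le (y : R) : Rabs (sin y) <= Rabs y.
Proof.
  destruct (MVT_gen sin 0 y cos) as [c [_ Hc]].
  - intros. auto_derive; auto; ring.
  - intros. apply continuity_pt_filterlim, (ex_derive_continuous sin).
    auto_derive; auto.
  - rewrite sin_0, !Rminus_0_r in Hc. rewrite Hc, Rabs_mult.
    assert (Rabs (cos c) <= 1) by (apply Rabs_le; apply COS_bound).
    assert (H0 := Rabs_pos y). nra.
Qed.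

(** [cos y - 1 = - 2 sin^2 (y / 2)]. *)
Lemma cos_bound2 (y : R) : Rabs (cos y - 1) <= y ^ 2 / 2.
Proof.
  replace y with (2 * (y / 2)) at 1 by field. rewrite cos_2a_sin.
  assert (H := sin_abs_le (y / 2)).
  assert (K : sin (y / 2) * sin (y / 2) <= (y / 2) * (y / 2)).
  { apply Rsqr_le_abs_1 in H. exact H. }
  rewrite Rabs_left1; nra.
Qed.

Lemma sin_bound2 (y : R) : Rabs y <= 1 -> Rabs (sin y - y) <= y ^ 2.
Proof.
  intros Hy.
  destruct (MVT_gen (fun y => sin y - y) 0 y (fun y => cos y - 1)) as [c [Hc1 Hc]].
  - intros. auto_derive; auto; ring.
  - intros. apply continuity_pt_filterlim, (ex_derive_continuous (fun y => sin y - y)).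
    auto_derive; auto.
  - rewrite sin_0, !Rminus_0_r in Hc. rewrite Hc, Rabs_mult.
    assert (B := cos_bound2 c).
    assert (D : Rabs c <= Rabs y).
    { unfold Rmin, Rmax in Hc1. destruct (Rle_dec 0 y).
      - rewrite !Rabs_pos_eq; lra. - rewrite !Rabs_left1; lra. }
    assert (H0 := Rabs_pos y). assert (H1 := Rabs_pos c).
    rewrite <- (pow2_abs c) in B. rewrite <- (pow2_abs y).
    assert (Rabs (cos c - 1) <= Rabs y) by nra. nra.
Qed.

(** The derivative at 0 with a quadratic remainder. The addition law carries it to every point in
    [cd_Cexp]; it also controls logarithms near 1. *)
Lemma Cexp_bound2 (h : C) : Cmod h <= 1 / 2 -> Cmod (Cexp h - 1 - h) <= 6 * (Cmod h) ^ 2.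
Proof.
  intros Hh. rewrite Cmod_sqr.
  assert (Hx := Rle_trans _ _ _ (Re_le_Cmod h) Hh).
  assert (Hy := Rle_trans _ _ _ (Im_le_Cmod h) Hh).
  destruct h as [x y]. simpl in Hx, Hy.
  eapply Rle_trans; [apply Cmod_le_abs|]. unfold Cexp; simpl Re; simpl Im.
  assert (B1 := exp_bound2 x Hx). assert (B2 := cos_bound2 y).
  assert (B3 := sin_bound2 y ltac:(lra)). assert (B4 := sin_abs_le y).
  assert (P := Rabs_pos x). assert (Q := Rabs_pos y).
  rewrite <- (pow2_abs x) in *. rewrite <- (pow2_abs y) in *.
  assert (E1 : Rabs (exp x - 1) <= 2 * Rabs x).
  { replace (exp x - 1) with ((exp x - 1 - x) + x) by ring.
    eapply Rle_trans; [apply Rabs_triang|]. nra. }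
  assert (E2 : exp x <= 2).
  { assert (H := Rle_abs (exp x - 1)). lra. }
  assert (E0 := exp_pos x).
  replace (exp x * cos y + - (1) + - x) with ((exp x - 1 - x) + exp x * (cos y - 1)) by ring.
  replace (exp x * sin y + - 0 + - y) with ((exp x - 1) * sin y + (sin y - y)) by ring.
  assert (T1 := Rabs_triang (exp x - 1 - x) (exp x * (cos y - 1))).
  assert (T2 := Rabs_triang ((exp x - 1) * sin y) (sin y - y)).
  rewrite Rabs_mult, (Rabs_pos_eq (exp x)) in T1 by lra.
  rewrite Rabs_mult in T2.
  assert (S1 : exp x * Rabs (cos y - 1) <= 2 * (Rabs y ^ 2 / 2)).
  { apply Rmult_le_compat; auto using Rabs_pos; lra. }
  assert (S2 : Rabs (exp x - 1) * Rabs (sin y) <= 2 * Rabs x * Rabs y).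
  { apply Rmult_le_compat; auto using Rabs_pos. }
  assert (S3 : 2 * Rabs x * Rabs y <= Rabs x ^ 2 + Rabs y ^ 2).
  { assert (0 <= (Rabs x - Rabs y) ^ 2) by apply pow2_ge_0. nra. }
  assert (0 <= Rabs x ^ 2) by apply pow2_ge_0.
  assert (0 <= Rabs y ^ 2) by apply pow2_ge_0.
  lra.
Qed.

Lemma cd_Cexp (s : C) : is_complex_derive Cexp s (Cexp s).
Proof.
  apply is_complex_derive_eps. intros eps Heps.
  assert (P := exp_pos (Re s)).
  exists (Rmin (1 / 2) (eps / (6 * exp (Re s)))). split.
  { apply Rmin_pos; [lra|]. apply Rdiv_lt_0_compat; lra. }
  intros z Hz.
  assert (Z1 := Rlt_le_trans _ _ _ Hz (Rmin_l _ _)).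
  assert (Z2 := Rlt_le_trans _ _ _ Hz (Rmin_r _ _)).
  replace (Cexp z) with (Cexp s * Cexp (z - s))%C
    by (rewrite <- Cexp_plus; f_equal; ring).
  replace (Cexp s * Cexp (z - s) - Cexp s - Cexp s * (z - s))%C
    with (Cexp s * (Cexp (z - s) - 1 - (z - s)))%C by ring.
  rewrite Cmod_mult, Cmod_Cexp.
  assert (B := Cexp_bound2 (z - s) ltac:(lra)).
  apply Rlt_div_r in Z2; [|lra].
  assert (H0 := Cmod_ge_0 (z - s)).
  apply Rle_trans with (exp (Re s) * (6 * Cmod (z - s) ^ 2)).
  - apply Rmult_le_compat_l; lra.
  - nra.
Qed.

(** Two derivatives are what the maximum principle below uses. They are complex derivatives in a
    full neighbourhood of each point of [D], so [D] may be a closed rectangle. *)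
Definition holo2 (D : C -> Prop) (f : C -> C) : Prop :=
  exists f1, forall z, D z -> is_complex_derive f z (f1 z) /\
    exists l, is_complex_derive f1 z l.

Lemma holo2_const D c : holo2 D (fun _ => c).
Proof.
  exists (fun _ => RtoC 0). intros z _. split; [apply cd_const|].
  exists (RtoC 0). apply cd_const.
Qed.

Lemma holo2_id D : holo2 D (fun z => z).
Proof.
  exists (fun _ => RtoC 1). intros z _. split; [apply cd_id|].
  exists (RtoC 0). apply cd_const.
Qed.

Lemma holo2_plus D f g : holo2 D f -> holo2 D g -> holo2 D (fun z => f z + g z)%C.
Proof.
  intros [f1 Hf] [g1 Hg]. exists (fun z => f1 z + g1 z)%C. intros z Hz.
  destruct (Hf z Hz) as [F1 [l Hl]], (Hg z Hz) as [G1 [m Hm]].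
  split; [now apply cd_plus|]. exists (l + m)%C. now apply cd_plus.
Qed.

Lemma holo2_mult D f g : holo2 D f -> holo2 D g -> holo2 D (fun z => f z * g z)%C.
Proof.
  intros [f1 Hf] [g1 Hg]. exists (fun z => f1 z * g z + f z * g1 z)%C. intros z Hz.
  destruct (Hf z Hz) as [F1 [l Hl]], (Hg z Hz) as [G1 [m Hm]].
  split; [now apply cd_mult|]. eexists. apply cd_plus; apply cd_mult; eauto.
Qed.

Lemma holo2_comp D f g : holo2 D g -> holo2 (fun w => exists z, D z /\ w = g z) f ->
  holo2 D (fun z => f (g z)).
Proof.
  intros [g1 Hg] [f1 Hf]. exists (fun z => f1 (g z) * g1 z)%C. intros z Hz.
  destruct (Hg z Hz) as [G1 [m Hm]].
  destruct (Hf (g z) (ex_intro _ z (conj Hz eq_refl))) as [F1 [l Hl]].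
  split; [now apply cd_comp|]. eexists. apply cd_mult; [|eauto].
  apply (cd_comp f1 g); eauto.
Qed.

Lemma holo2_exp D g : holo2 D g -> holo2 D (fun z => Cexp (g z)).
Proof.
  intros Hg. apply holo2_comp; auto. exists Cexp. intros z _.
  split; [|exists (Cexp z)]; apply cd_Cexp.
Qed.

Lemma holo2_inv D g : holo2 D g -> (forall z, D z -> g z <> RtoC 0) ->
  holo2 D (fun z => / g z)%C.
Proof.
  intros Hg H0. apply holo2_comp; auto. exists (fun z => - (/ z * / z))%C.
  intros w [z [Hz ->]]. specialize (H0 z Hz).
  split; [now apply cd_Cinv|].
  eexists. eapply cd_ext with (f := fun z => ((- (1)) * (/ z * / z))%C).
  { intros; ring. }
  apply cd_mult; [apply cd_const|]. apply cd_mult; now apply cd_Cinv.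
Qed.

Lemma holo2_ext D f g : (forall z, f z = g z) -> holo2 D f -> holo2 D g.
Proof.
  intros E [f1 H]. exists f1. intros z Hz. destruct (H z Hz) as [H1 H2].
  split; auto. now apply (cd_ext f).
Qed.

Lemma holo2_sub (D D' : C -> Prop) f : (forall z, D' z -> D z) -> holo2 D f -> holo2 D' f.
Proof. intros S [f1 H]. exists f1. auto. Qed.

Lemma holo2_minus D f g : holo2 D f -> holo2 D g -> holo2 D (fun z => f z - g z)%C.
Proof.
  intros Hf Hg. apply holo2_ext with (fun z => f z + (- (1)) * g z)%C.
  - intros; ring.
  - apply holo2_plus; auto. apply holo2_mult; auto. apply holo2_const.
Qed.

Lemma exp_le (x y : R) : x <= y -> exp x <= exp y.
Proof. intros [H|H]; [left; now apply exp_increasing|right; now rewrite H]. Qed.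

(** * Maximum modulus principle on rectangles *)

Lemma nested_halving (u v : nat -> R) (L : R) :
  (forall n, u n <= u (S n)) -> (forall n, v (S n) <= v n) ->
  (forall n, v n - u n = L / 2 ^ n) -> 0 <= L ->
  exists x, forall n, u n <= x <= v n.
Proof.
  intros Hu Hv HL L0.
  assert (Mu : forall n m, (n <= m)%nat -> u n <= u m).
  { intros n m H. induction H; [lra|]. specialize (Hu m). lra. }
  assert (Mv : forall n m, (n <= m)%nat -> v m <= v n).
  { intros n m H. induction H; [lra|]. specialize (Hv m). lra. }
  assert (W : forall n, u n <= v n).
  { intros n. assert (0 <= L / 2 ^ n) by (apply Rdiv_le_0_compat; [auto|apply pow_lt; lra]).
    specialize (HL n). lra. }
  assert (UV : forall n m, u n <= v m).
  { intros n m. destruct (Nat.le_ge_cases n m).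
    - apply Rle_trans with (u m); auto.
    - apply Rle_trans with (v n); auto. }
  destruct (completeness (fun r => exists n, r = u n)) as [x [X1 X2]].
  - exists (v 0%nat). intros r [n ->]. auto.
  - exists (u 0%nat). now exists 0%nat.
  - exists x. intros n. split.
    + apply X1. now exists n.
    + apply X2. intros r [m ->]. auto.
Qed.

(** Compactness of a rectangle as an induction principle: if [P] fails, it fails on nested quarters
    that shrink to a point, where the local hypothesis contradicts it. The small rectangles have
    sides exactly [2 ^ n] times shorter, hence keep the shape of the original, which Goursat's
    theorem needs. *)
Lemma rect_bisection (P : R -> R -> R -> R -> Prop) (a b c d : R) :
  a <= b -> c <= d ->
  (forall a b c d, P a ((a + b) / 2) c ((c + d) / 2) -> P ((a + b) / 2) b c ((c + d) / 2) ->
    P a ((a + b) / 2) ((c + d) / 2) d -> P ((a + b) / 2) b ((c + d) / 2) d -> P a b c d) ->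
  (forall x y, a <= x <= b -> c <= y <= d -> exists N, forall n, (N <= n)%nat ->
    forall a' b' c' d', a <= a' <= x -> x <= b' <= b -> c <= c' <= y -> y <= d' <= d ->
      b' - a' = (b - a) / 2 ^ n -> d' - c' = (d - c) / 2 ^ n -> P a' b' c' d') ->
  P a b c d.
Proof.
  intros Hab Hcd Hsplit Hloc. apply NNPP. intros HP.
  set (Q := fun r : R * R * (R * R) => ~ P (fst (fst r)) (snd (fst r)) (fst (snd r)) (snd (snd r))).
  set (good := fun r r' : R * R * (R * R) => Q r' /\
    ((fst r' = (fst (fst r), (fst (fst r) + snd (fst r)) / 2)) \/
     (fst r' = ((fst (fst r) + snd (fst r)) / 2, snd (fst r)))) /\
    ((snd r' = (fst (snd r), (fst (snd r) + snd (snd r)) / 2)) \/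
     (snd r' = ((fst (snd r) + snd (snd r)) / 2, snd (snd r))))).
  assert (step : forall r, Q r -> exists r', good r r').
  { intros [[a1 b1] [c1 d1]] Hr. unfold Q, good in *; simpl in *. apply NNPP. intros Hn.
    apply Hr. apply Hsplit; apply NNPP; intros Hq; apply Hn; eexists (_, _, (_, _));
      (split; [exact Hq|]); simpl; tauto. }
  (* A bad quarter of a bad rectangle. The default is never met, since every stage stays bad by
     [Qs]. *)
  set (next := fun r => epsilon (inhabits ((0, 0), (0, 0))) (good r)).
  assert (Hnext : forall r, Q r -> good r (next r)).
  { intros r Hr. apply epsilon_spec. auto. }
  set (s := fix s n := match n with O => ((a, b), (c, d)) | S n => next (s n) end).
  assert (Qs : forall n, Q (s n)).
  { induction n; [exact HP|]. apply (Hnext _ IHn). }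
  assert (G : forall n, good (s n) (s (S n))) by (intros n; apply Hnext, Qs).
  assert (LX : forall n, snd (fst (s n)) - fst (fst (s n)) = (b - a) / 2 ^ n /\
     snd (snd (s n)) - fst (snd (s n)) = (d - c) / 2 ^ n).
  { induction n as [|n [I1 I2]]; [simpl; lra|].
    destruct (G n) as [_ [G1 G2]].
    assert (p := pow_lt 2 n ltac:(lra)).
    replace ((b - a) / 2 ^ (S n)) with ((b - a) / 2 ^ n / 2) by (simpl; field; lra).
    replace ((d - c) / 2 ^ (S n)) with ((d - c) / 2 ^ n / 2) by (simpl; field; lra).
    rewrite <- I1, <- I2.
    destruct G1 as [-> | ->]; destruct G2 as [-> | ->]; simpl; split; lra. }
  assert (P2 : forall n, 0 < 2 ^ n) by (intros; apply pow_lt; lra).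
  assert (W : forall n, fst (fst (s n)) <= snd (fst (s n)) /\ fst (snd (s n)) <= snd (snd (s n))).
  { intros n. destruct (LX n) as [I1 I2].
    assert (0 <= (b - a) / 2 ^ n) by (apply Rdiv_le_0_compat; [lra|auto]).
    assert (0 <= (d - c) / 2 ^ n) by (apply Rdiv_le_0_compat; [lra|auto]). lra. }
  assert (Mono : forall n, fst (fst (s n)) <= fst (fst (s (S n))) /\
    snd (fst (s (S n))) <= snd (fst (s n)) /\ fst (snd (s n)) <= fst (snd (s (S n))) /\
    snd (snd (s (S n))) <= snd (snd (s n))).
  { intros n. destruct (G n) as [_ [G1 G2]]. destruct (W n).
    destruct G1 as [-> | ->]; destruct G2 as [-> | ->]; simpl; repeat split; lra. }
  destruct (nested_halving (fun n => fst (fst (s n))) (fun n => snd (fst (s n))) (b - a))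
    as [x Hx]; try (intros; apply Mono); [intros; apply LX|lra|].
  destruct (nested_halving (fun n => fst (snd (s n))) (fun n => snd (snd (s n))) (d - c))
    as [y Hy]; try (intros; apply Mono); [intros; apply LX|lra|].
  assert (Bd : forall n, a <= fst (fst (s n)) /\ snd (fst (s n)) <= b /\
    c <= fst (snd (s n)) /\ snd (snd (s n)) <= d).
  { induction n; [simpl; lra|]. destruct (Mono n) as (?&?&?&?). lra. }
  assert (X0 := Hx O). assert (Y0 := Hy O). simpl in X0, Y0.
  destruct (Hloc x y X0 Y0) as [N HN].
  apply (Qs N). destruct (Bd N) as (?&?&?&?). specialize (Hx N). specialize (Hy N).
  apply (HN N); try apply LX; try lra. lia.
Qed.

Definition in_rect (a b c d : R) (z : C) : Prop := a <= Re z <= b /\ c <= Im z <= d.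

Definition rcont (u : C -> R) (s : C) : Prop :=
  forall eps, 0 < eps -> exists e, 0 < e /\
    forall z, Cmod (z - s) < e -> Rabs (u z - u s) < eps.

Lemma small_halving (L e : R) : 0 <= L -> 0 < e -> exists N, forall n, (N <= n)%nat -> L / 2 ^ n < e.
Proof.
  intros HL He. destruct (Pow_x_infinity 2 ltac:(rewrite Rabs_pos_eq; lra) (L / e + 1)) as [N HN].
  exists N. intros n Hn. specialize (HN n Hn).
  assert (p := pow_lt 2 n ltac:(lra)). rewrite Rabs_pos_eq in HN by lra.
  apply Rlt_div_l; [lra|].
  assert (L / e < 2 ^ n) by lra. apply Rlt_div_l in H; lra.
Qed.

Lemma rect_local (a b c d : R) (x y e : R) : a <= b -> c <= d -> 0 < e ->
  exists N, forall n, (N <= n)%nat -> forall a' b' c' d', a' <= x <= b' -> c' <= y <= d' ->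
   b' - a' = (b - a) / 2 ^ n -> d' - c' = (d - c) / 2 ^ n ->
   forall z, in_rect a' b' c' d' z -> Cmod (z - (x, y)) < e.
Proof.
  intros Hab Hcd He.
  destruct (small_halving (b - a) (e / 2)) as [N1 H1]; try lra.
  destruct (small_halving (d - c) (e / 2)) as [N2 H2]; try lra.
  exists (max N1 N2). intros n Hn a' b' c' d' Hx Hy E1 E2 z [Z1 Z2].
  specialize (H1 n ltac:(lia)). specialize (H2 n ltac:(lia)).
  eapply Rle_lt_trans; [apply Cmod_le_abs|]. destruct z as [zx zy]; simpl in *.
  assert (Rabs (zx + - x) <= b' - a') by (apply Rabs_le; lra).
  assert (Rabs (zy + - y) <= d' - c') by (apply Rabs_le; lra). lra.
Qed.

Lemma rect_bounded (u : C -> R) (a b c d : R) : a <= b -> c <= d ->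
  (forall z, in_rect a b c d z -> rcont u z) ->
  exists B, forall z, in_rect a b c d z -> u z <= B.
Proof.
  intros Hab Hcd Hu.
  apply (rect_bisection (fun a b c d => exists B, forall z, in_rect a b c d z -> u z <= B)); auto.
  - intros a1 b1 c1 d1 [B1 H1] [B2 H2] [B3 H3] [B4 H4].
    exists (Rmax (Rmax B1 B2) (Rmax B3 B4)). intros z [Zx Zy].
    assert (M1 := Rmax_l B1 B2). assert (M2 := Rmax_r B1 B2).
    assert (M3 := Rmax_l B3 B4). assert (M4 := Rmax_r B3 B4).
    assert (M5 := Rmax_l (Rmax B1 B2) (Rmax B3 B4)). assert (M6 := Rmax_r (Rmax B1 B2) (Rmax B3 B4)).
    destruct (Rle_lt_dec (Re z) ((a1 + b1) / 2)); destruct (Rle_lt_dec (Im z) ((c1 + d1) / 2)).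
    + specialize (H1 z ltac:(split; lra)). lra.
    + specialize (H3 z ltac:(split; lra)). lra.
    + specialize (H2 z ltac:(split; lra)). lra.
    + specialize (H4 z ltac:(split; lra)). lra.
  - intros x y Hx Hy. destruct (Hu (x, y) (conj Hx Hy) 1 Rlt_0_1) as [e [He H]].
    destruct (rect_local a b c d x y e Hab Hcd He) as [N HN].
    exists N. intros n Hn a' b' c' d' A' B' C' D' E1 E2. exists (u (x, y) + 1).
    intros z Hz. assert (K := H z (HN n Hn a' b' c' d' ltac:(lra) ltac:(lra) E1 E2 z Hz)).
    apply Rabs_lt_between in K. lra.
Qed.

(** If the supremum [M] were not attained, [/ (M - u z)] would be continuous, hence bounded, which
    keeps [u] at a distance from [M]. *)
Lemma rect_max (u : C -> R) (a b c d : R) : a <= b -> c <= d ->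
  (forall z, in_rect a b c d z -> rcont u z) ->
  exists m, in_rect a b c d m /\ forall z, in_rect a b c d z -> u z <= u m.
Proof.
  intros Hab Hcd Hu. destruct (rect_bounded u a b c d Hab Hcd Hu) as [B HB].
  destruct (completeness (fun r => exists z, in_rect a b c d z /\ r = u z)) as [M [M1 M2]].
  { exists B. intros r [z [Hz ->]]. auto. }
  { exists (u (a, c)). exists (a, c). split; auto. repeat split; simpl; lra. }
  apply NNPP. intros Hn.
  assert (Hlt : forall z, in_rect a b c d z -> u z < M).
  { intros z Hz. destruct (Rle_lt_or_eq_dec (u z) M) as [K|K]; auto.
    - apply M1. exists z. auto.
    - exfalso. apply Hn. exists z. split; auto. intros w Hw. rewrite K.
      apply M1. exists w. auto. }
  destruct (rect_bounded (fun z => / (M - u z)) a b c d Hab Hcd) as [K HK].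
  - intros z Hz eps Heps. assert (L := Hlt z Hz). set (g := M - u z).
    assert (Hg : 0 < g) by (unfold g; lra).
    destruct (Hu z Hz (Rmin (g / 2) (eps * g * g / 2))) as [e [He H]].
    { apply Rmin_pos; [lra|]. assert (0 < eps * g * g) by (repeat apply Rmult_lt_0_compat; auto). lra. }
    exists e. split; auto. intros w Hw. specialize (H w Hw).
    assert (H1 := Rlt_le_trans _ _ _ H (Rmin_l _ _)).
    assert (H2 := Rlt_le_trans _ _ _ H (Rmin_r _ _)).
    assert (W : g / 2 < M - u w). { apply Rabs_lt_between in H1. unfold g in *. lra. }
    cbv beta. fold g. replace (/ (M - u w) - / g) with ((u w - u z) * (/ (M - u w) * / g))
      by (unfold g in *; field; lra).
    rewrite Rabs_mult. rewrite (Rabs_pos_eq (/ (M - u w) * / g)).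
    2:{ apply Rmult_le_pos; apply Rlt_le, Rinv_0_lt_compat; lra. }
    assert (I : / (M - u w) <= 2 / g).
    { replace (2 / g) with (/ (g / 2)) by (field; lra). apply Rinv_le_contravar; lra. }
    apply Rle_lt_trans with (Rabs (u w - u z) * (2 / g * / g)).
    + apply Rmult_le_compat_l; [apply Rabs_pos|]. apply Rmult_le_compat_r; auto.
      apply Rlt_le, Rinv_0_lt_compat; lra.
    + replace eps with (eps * g * g / 2 * (2 / g * / g)) by (field; lra).
      apply Rmult_lt_compat_r; auto. apply Rmult_lt_0_compat; [apply Rdiv_lt_0_compat|apply Rinv_0_lt_compat]; lra.
  (* [Rmax K 1] makes the inverse positive whatever the sign of [K]. *)
  - assert (HM : M <= M - / (Rmax K 1)).
    { apply M2. intros r [z [Hz ->]]. specialize (HK z Hz). specialize (Hlt z Hz).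
      assert (/ (M - u z) <= Rmax K 1) by (eapply Rle_trans; [exact HK|apply Rmax_l]).
      assert (/ Rmax K 1 <= M - u z).
      { rewrite <- (Rinv_inv (M - u z)). apply Rinv_le_contravar; auto.
        apply Rinv_0_lt_compat; lra. }
      lra. }
    assert (0 < / Rmax K 1) by (apply Rinv_0_lt_compat; eapply Rlt_le_trans; [|apply Rmax_r]; lra).
    lra.
Qed.

(** At a maximum [p1 x = 0]; were [L > 0], then [p1] would be positive just to the right of [x] and
    the mean value theorem would make [p] increase there. *)
Lemma second_derivative_test (p p1 : R -> R) (x L d : R) : 0 < d ->
  (forall y, Rabs (y - x) < d -> is_derive p y (p1 y)) -> is_derive p1 x L ->
  (forall y, Rabs (y - x) < d -> p y <= p x) -> L <= 0.
Proof.
  intros Hd H1 H2 Hm.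
  assert (Z : p1 x = 0).
  { assert (D : derivable_pt p x).
    { exists (p1 x). apply is_derive_Reals, H1. rewrite Rminus_diag, Rabs_R0; auto. }
    assert (E : derive_pt p x D = 0).
    { apply (deriv_maximum p (x - d) (x + d)); try lra.
      intros y Y1 Y2. apply Hm. apply Rabs_lt_between. lra. }
    rewrite <- E. symmetry. apply derive_pt_eq_0, is_derive_Reals, H1.
    rewrite Rminus_diag, Rabs_R0; auto. }
  destruct (Rle_lt_dec L 0) as [|HL]; auto. exfalso.
  apply is_derive_Reals in H2. destruct (H2 (L / 2) ltac:(lra)) as [e He].
  set (h := Rmin (d / 2) (e / 2)). assert (0 < e) by apply cond_pos.
  assert (h0 : 0 < h) by (apply Rmin_pos; lra).
  assert (h1 : h <= d / 2) by apply Rmin_l. assert (h2 : h <= e / 2) by apply Rmin_r.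
  destruct (MVT_cor2 p p1 x (x + h)) as [c [Ec Hc]]; [lra| |].
  - intros y Hy. apply is_derive_Reals, H1. apply Rabs_lt_between; lra.
  - assert (K : p (x + h) <= p x) by (apply Hm; apply Rabs_lt_between; lra).
    specialize (He (c - x) ltac:(lra)). rewrite Rabs_pos_eq in He by lra.
    specialize (He ltac:(lra)). replace (x + (c - x)) with c in He by ring.
    rewrite Z, Rminus_0_r in He. apply Rabs_lt_between in He.
    assert (Q : 0 < p1 c / (c - x)) by lra. apply Rlt_div_r in Q; [|lra].
    rewrite Rmult_0_l in Q. nra.
Qed.

(** Opens real calculus along the line [z + t e]: the mean value theorem, second derivatives and the
    fundamental theorem are applied to the two components. *)
Lemma path_derive (f : C -> C) (z e l : C) (t : R) :
  is_complex_derive f (z + RtoC t * e)%C l ->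
  is_derive (fun s : R => Re (f (z + RtoC s * e)%C)) t (Re (l * e)) /\
  is_derive (fun s : R => Im (f (z + RtoC s * e)%C)) t (Im (l * e)).
Proof.
  intros H. rewrite is_complex_derive_eps in H.
  assert (Ge := Cmod_ge_0 e).
  assert (K : forall eps, 0 < eps -> exists d, 0 < d /\ forall h, Rabs h < d ->
    Cmod (f (z + RtoC (t + h)%R * e)%C - f (z + RtoC t * e)%C - RtoC h * (l * e)) <= eps * Rabs h).
  { intros eps Heps. destruct (H (eps / (Cmod e + 1))) as [d [Hd Hz]].
    { apply Rdiv_lt_0_compat; lra. }
    exists (d / (Cmod e + 1)). split; [apply Rdiv_lt_0_compat; lra|].
    intros h Hh. assert (Ah := Rabs_pos h).
    assert (E : (z + RtoC (t + h)%R * e - (z + RtoC t * e))%C = (RtoC h * e)%C)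
      by (rewrite RtoC_plus; ring).
    specialize (Hz (z + RtoC (t + h)%R * e)%C). rewrite E, Cmod_mult, Cmod_R in Hz.
    apply Rlt_div_r in Hh; [|lra].
    specialize (Hz ltac:(nra)).
    replace (RtoC h * (l * e))%C with (l * (RtoC h * e))%C by ring.
    eapply Rle_trans; [exact Hz|].
    replace (eps / (Cmod e + 1) * (Rabs h * Cmod e)) with
      (eps * Rabs h * (Cmod e / (Cmod e + 1))) by (field; lra).
    rewrite <- (Rmult_1_r (eps * Rabs h)) at 2.
    apply Rmult_le_compat_l; [nra|]. apply Rle_div_l; lra. }
  split; apply is_derive_Reals; intros eps Heps;
    destruct (K (eps / 2) ltac:(lra)) as [d [Hd Hz]]; exists (mkposreal d Hd);
    intros h Hh0 Hh; simpl in Hh; specialize (Hz h Hh);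
    assert (Ah := Rabs_pos_lt h Hh0).
  - assert (Q := Rle_trans _ _ _ (Re_le_Cmod _) Hz).
    replace (Re _) with (h * ((Re (f (z + RtoC (t + h)%R * e)%C) - Re (f (z + RtoC t * e)%C)) / h
      - Re (l * e))) in Q.
    + rewrite Rabs_mult in Q. rewrite (Rmult_comm (eps / 2)) in Q.
      apply Rmult_le_reg_l in Q; lra.
    + unfold Cminus. rewrite !re_plus, !re_opp, re_scal_l. field. auto.
  - assert (Q := Rle_trans _ _ _ (Im_le_Cmod _) Hz).
    replace (Im _) with (h * ((Im (f (z + RtoC (t + h)%R * e)%C) - Im (f (z + RtoC t * e)%C)) / h
      - Im (l * e))) in Q.
    + rewrite Rabs_mult in Q. rewrite (Rmult_comm (eps / 2)) in Q.
      apply Rmult_le_reg_l in Q; lra.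
    + unfold Cminus. rewrite !im_plus, !im_opp, im_scal_l. field. auto.
Qed.

Definition on_border (a b c d : R) (z : C) : Prop :=
  in_rect a b c d z /\ (Re z = a \/ Re z = b \/ Im z = c \/ Im z = d).

Lemma rcont_of_ccont f s (g : R -> R -> R) : ccont f s ->
  (forall x y, continuity_2d_pt g x y) -> rcont (fun z => g (Re (f z)) (Im (f z))) s.
Proof.
  intros H Hg eps Heps.
  destruct (Hg (Re (f s)) (Im (f s)) (mkposreal eps Heps)) as [e He].
  destruct (H e (cond_pos e)) as [d [Hd K]]. exists d. split; auto.
  intros z Hz. apply He; eapply Rle_lt_trans; try apply (K z Hz).
  - replace (_ - _) with (Re (f z - f s)%C) by reflexivity. apply Re_le_Cmod.
  - replace (_ - _) with (Im (f z - f s)%C) by reflexivity. apply Im_le_Cmod.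
Qed.

Lemma rcont_plus u v s : rcont u s -> rcont v s -> rcont (fun z => u z + v z) s.
Proof.
  intros Hu Hv eps Heps.
  destruct (Hu (eps / 2) ltac:(lra)) as [d1 [Hd1 K1]].
  destruct (Hv (eps / 2) ltac:(lra)) as [d2 [Hd2 K2]].
  exists (Rmin d1 d2). split; [now apply Rmin_pos|]. intros z Hz.
  specialize (K1 z (Rlt_le_trans _ _ _ Hz (Rmin_l _ _))).
  specialize (K2 z (Rlt_le_trans _ _ _ Hz (Rmin_r _ _))).
  replace (u z + v z - (u s + v s)) with ((u z - u s) + (v z - v s)) by ring.
  eapply Rle_lt_trans; [apply Rabs_triang|]. lra.
Qed.

Lemma ccont_id s : ccont (fun z => z) s.
Proof. intros eps Heps. exists eps. auto. Qed.

Lemma rcont_Cmod f s : ccont f s -> rcont (fun z => Cmod (f z)) s.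
Proof.
  intros H eps Heps. destruct (H eps Heps) as [d [Hd K]]. exists d; split; auto.
  intros z Hz. specialize (K z Hz). apply Rabs_lt_between.
  assert (A := Cmod_triangle' (f z) (f s)). assert (B := Cmod_triangle' (f s) (f z)).
  rewrite (Cmod_minus_sym (f s)) in B. lra.
Qed.

Lemma is_derive_eq (f : R -> R) (x l l' : R) : is_derive f x l -> l = l' -> is_derive f x l'.
Proof. now intros H <-. Qed.

(** With [p], [q] the components of a function along a line and [a + t * b] the abscissa, this
    differentiates the quantity maximized in [max_modulus]. *)
Lemma derive_sqr_sum (p q : R -> R) (t p1 q1 : R) :
  is_derive p t p1 -> is_derive q t q1 -> forall a b e : R,
  is_derive (fun t => (p t ^ 2 + q t ^ 2) + e * (a + t * b) ^ 2) t
    (2 * (p t * p1 + q t * q1) + 2 * e * ((a + t * b) * b)).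
Proof.
  intros Hp Hq a b e. auto_derive.
  - repeat split; eexists; eassumption.
  - rewrite (is_derive_unique p _ _ Hp : Derive (fun x => p x) t = p1),
      (is_derive_unique q _ _ Hq : Derive (fun x => q x) t = q1). ring.
Qed.

(** The second derivative of that quantity, once [r] and [s] are the derivatives of [p] and [q]. *)
Lemma derive_half_sqr (p q r s : R -> R) (t p1 q1 r1 s1 : R) :
  is_derive p t p1 -> is_derive q t q1 -> is_derive r t r1 -> is_derive s t s1 ->
  forall a b e : R,
  is_derive (fun t => 2 * (p t * r t + q t * s t) + 2 * e * ((a + t * b) * b)) t
    (2 * (p1 * r t + p t * r1 + (q1 * s t + q t * s1)) + 2 * e * (b * b)).
Proof.
  intros Hp Hq Hr Hs a b e. auto_derive.
  - repeat split; eexists; eassumption.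
  - rewrite (is_derive_unique p _ _ Hp : Derive (fun x => p x) t = p1),
      (is_derive_unique q _ _ Hq : Derive (fun x => q x) t = q1),
      (is_derive_unique r _ _ Hr : Derive (fun x => r x) t = r1),
      (is_derive_unique s _ _ Hs : Derive (fun x => s x) t = s1). ring.
Qed.

(* At an interior maximum of [|f|^2 + e x^2] both second derivatives are <= 0,
   but their sum is [4 |f'|^2 + 2 e > 0]. *)
Lemma max_modulus (f : C -> C) (a b c d B : R) : a <= b -> c <= d ->
  holo2 (in_rect a b c d) f ->
  (forall z, on_border a b c d z -> Cmod (f z) <= B) ->
  forall z, in_rect a b c d z -> Cmod (f z) <= B.
Proof.
  intros Hab Hcd [f1 Hf] HB z0 Hz0.
  destruct (Rle_lt_dec (Cmod (f z0)) B) as [|Hlt]; auto. exfalso.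
  assert (HB0 : 0 <= B).
  { eapply Rle_trans; [apply Cmod_ge_0|apply (HB (a, c))]. split; [repeat split; simpl; lra|].
    simpl; auto. }
  set (X := Rmax (a ^ 2) (b ^ 2)).
  assert (HX : forall z, in_rect a b c d z -> 0 <= Re z ^ 2 <= X).
  { intros z [Z1 Z2]. split; [apply pow2_ge_0|]. unfold X.
    destruct (Rle_lt_dec 0 (Re z)).
    - eapply Rle_trans; [|apply Rmax_r]. nra.
    - eapply Rle_trans; [|apply Rmax_l]. nra. }
  assert (X0 := proj1 (HX z0 Hz0)). assert (X1 := proj2 (HX z0 Hz0)).
  set (g := Cmod (f z0) ^ 2 - B ^ 2). assert (Hg : 0 < g) by (unfold g; nra).
  (* Small enough that the perturbation cannot lift a border point above [z0]: there
     [u <= B ^ 2 + e * X < B ^ 2 + g <= u z0]. *)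
  set (e := g / (2 * (X + 1))). assert (He : 0 < e) by (apply Rdiv_lt_0_compat; lra).
  assert (HeX : e * X < g).
  { unfold e. replace (g / (2 * (X + 1)) * X) with (g * (X / (2 * (X + 1)))) by (field; lra).
    rewrite <- (Rmult_1_r g) at 2. apply Rmult_lt_compat_l; auto. apply Rlt_div_l; lra. }
  set (u := fun z => (Re (f z) ^ 2 + Im (f z) ^ 2) + e * Re z ^ 2).
  assert (Hu : forall z, in_rect a b c d z -> rcont u z).
  { intros z Hz. apply rcont_plus.
    - apply (rcont_of_ccont f z (fun x y => x ^ 2 + y ^ 2)).
      + apply cd_cont with (f1 z). now apply Hf.
      + intros x y. apply continuity_2d_pt_plus.
        * apply (continuity_1d_2d_pt_comp (fun x => x ^ 2) (fun x y => x)); [reg|apply continuity_2d_pt_id1].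
        * apply (continuity_1d_2d_pt_comp (fun x => x ^ 2) (fun x y => y)); [reg|apply continuity_2d_pt_id2].
    - apply (rcont_of_ccont (fun z => z) z (fun x y => e * x ^ 2)); [apply ccont_id|].
      intros x y. apply (continuity_1d_2d_pt_comp (fun x => e * x ^ 2) (fun x y => x)); [reg|apply continuity_2d_pt_id1]. }
  destruct (rect_max u a b c d Hab Hcd Hu) as [m [Hm Hmax]].
  assert (Int : a < Re m < b /\ c < Im m < d).
  { apply NNPP. intros Hn.
    assert (Bm : on_border a b c d m).
    { split; auto. destruct Hm as [[? ?] [? ?]].
      destruct (Req_dec (Re m) a); auto. destruct (Req_dec (Re m) b); auto.
      destruct (Req_dec (Im m) c); auto. destruct (Req_dec (Im m) d); auto.
      exfalso; apply Hn; split; split; lra. }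
    specialize (HB m Bm). specialize (Hmax z0 Hz0). unfold u in Hmax.
    rewrite <- !Cmod_sqr in Hmax. assert (Q := HX m Hm). assert (G := Cmod_ge_0 (f m)).
    unfold g in *. nra. }
  set (dl := Rmin (Rmin (Re m - a) (b - Re m)) (Rmin (Im m - c) (d - Im m))).
  assert (Hdl : 0 < dl) by (unfold dl; repeat apply Rmin_pos; lra).
  assert (D1 : dl <= Re m - a) by (unfold dl; eapply Rle_trans; [apply Rmin_l|apply Rmin_l]).
  assert (D2 : dl <= b - Re m) by (unfold dl; eapply Rle_trans; [apply Rmin_l|apply Rmin_r]).
  assert (D3 : dl <= Im m - c) by (unfold dl; eapply Rle_trans; [apply Rmin_r|apply Rmin_l]).
  assert (D4 : dl <= d - Im m) by (unfold dl; eapply Rle_trans; [apply Rmin_r|apply Rmin_r]).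
  destruct (Hf m Hm) as [_ [l Hl]].
  assert (T : forall v : C, Rabs (Re v) <= 1 -> Rabs (Im v) <= 1 ->
    2 * (Re (f1 m * v) ^ 2 + Im (f1 m * v) ^ 2 + Re (f m) * Re (l * v * v) + Im (f m) * Im (l * v * v))
     + 2 * e * Re v ^ 2 <= 0).
  { intros v V1 V2.
    assert (In : forall t, Rabs t < dl -> in_rect a b c d (m + RtoC t * v)).
    { intros t Ht. unfold in_rect. rewrite re_plus, im_plus, re_scal_l, im_scal_l.
      assert (Rabs (t * Re v) <= Rabs t) by (rewrite Rabs_mult; assert (H0 := Rabs_pos t); nra).
      assert (Rabs (t * Im v) <= Rabs t) by (rewrite Rabs_mult; assert (H0 := Rabs_pos t); nra).
      apply Rabs_le_between in H. apply Rabs_le_between in H0. lra. }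
    assert (E0 : (m + RtoC 0 * v)%C = m) by ring.
    apply (second_derivative_test (fun t => u (m + RtoC t * v)%C)
      (fun t => 2 * (Re (f (m + RtoC t * v)%C) * Re (f1 (m + RtoC t * v)%C * v)
        + Im (f (m + RtoC t * v)%C) * Im (f1 (m + RtoC t * v)%C * v))
        + 2 * e * ((Re m + t * Re v) * Re v)) 0 _ dl Hdl).
    - intros y Hy. rewrite Rminus_0_r in Hy.
      destruct (path_derive f m v _ y (proj1 (Hf _ (In y Hy)))) as [A1 A2].
      apply is_derive_ext with (fun t => (Re (f (m + RtoC t * v)%C) ^ 2 + Im (f (m + RtoC t * v)%C) ^ 2)
        + e * (Re m + t * Re v) ^ 2).
      { intros t. unfold u. now rewrite re_plus, re_scal_l. }
      apply (derive_sqr_sum _ _ y _ _ A1 A2).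
    - assert (Hl' : is_complex_derive f1 (m + RtoC 0 * v) l) by (rewrite E0; auto).
      assert (Hf' := proj1 (Hf _ (In 0 ltac:(rewrite Rabs_R0; auto)))).
      destruct (path_derive f m v _ 0 Hf') as [A1 A2].
      assert (A34 : is_derive (fun t => Re (f1 (m + RtoC t * v)%C * v)%C) 0 (Re (l * v * v)) /\
        is_derive (fun t => Im (f1 (m + RtoC t * v)%C * v)%C) 0 (Im (l * v * v))).
      { apply (path_derive (fun z => f1 z * v)%C m v (l * v)%C 0).
        apply cd_eq with (l * v + f1 (m + RtoC 0 * v)%C * RtoC 0)%C; [apply (cd_mult f1 (fun _ => v)); [exact Hl'|apply cd_const]|ring]. }
      destruct A34 as [A3 A4].
      assert (G := derive_half_sqr _ _ _ _ 0 _ _ _ _ A1 A2 A3 A4 (Re m) (Re v) e).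
      eapply is_derive_eq; [exact G|]. cbv beta; rewrite !E0. ring.
    - intros y Hy. rewrite Rminus_0_r in Hy. rewrite E0. apply Hmax, In, Hy. }
  (* The horizontal direction sees [l], the vertical one [- l], so the unknown second derivative
     drops out of the sum. *)
  assert (T1 := T (RtoC 1)). assert (T2 := T Ci).
  replace (Re 1) with 1 in T1 by reflexivity. replace (Im 1) with 0 in T1 by reflexivity.
  replace (Re Ci) with 0 in T2 by reflexivity. replace (Im Ci) with 1 in T2 by reflexivity.
  rewrite Rabs_R1, Rabs_R0 in T1, T2. specialize (T1 ltac:(lra) ltac:(lra)). specialize (T2 ltac:(lra) ltac:(lra)).
  replace (l * Ci * Ci)%C with (- l)%C in T2.
  2:{ replace (l * Ci * Ci)%C with (l * (Ci * Ci))%C by ring.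
      replace (Ci * Ci)%C with (- (1))%C by (apply C_ext; simpl; ring). ring. }
  rewrite !Cmult_1_r in T1. rewrite re_opp, im_opp in T2.
  replace (Re (f1 m * Ci)) with (- Im (f1 m)) in T2 by (unfold Ci, Re, Im; simpl; ring).
  replace (Im (f1 m * Ci)) with (Re (f1 m)) in T2 by (unfold Ci, Re, Im; simpl; ring).
  nra.
Qed.

(** * Goursat's theorem *)

Definition CInt (g : R -> C) (a b : R) : C := RInt (V := C_R_CompleteNormedModule) g a b.

Definition pcont (g : R -> C) (x : R) : Prop :=
  forall eps, 0 < eps -> exists d, 0 < d /\
    forall y, Rabs (y - x) < d -> Cmod (g y - g x) < eps.

Lemma pcont_continuous g x : pcont g x -> continuous (U := C_R_CompleteNormedModule) g x.
Proof.
  intros H P [e He]. destruct (H e (cond_pos e)) as [d [Hd K]].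
  exists (mkposreal d Hd). intros y Hy. apply He.
  specialize (K y Hy). split.
  - eapply Rle_lt_trans; [apply (Re_le_Cmod (g y - g x)%C)|exact K].
  - eapply Rle_lt_trans; [apply (Im_le_Cmod (g y - g x)%C)|exact K].
Qed.

Lemma CInt_ex g a b : (forall x, Rmin a b <= x <= Rmax a b -> pcont g x) ->
  ex_RInt (V := C_R_CompleteNormedModule) g a b.
Proof. intros H. apply ex_RInt_continuous. intros; now apply pcont_continuous, H. Qed.

Lemma CInt_chasles g a b c : 
  (forall x, Rmin a b <= x <= Rmax a b -> pcont g x) ->
  (forall x, Rmin b c <= x <= Rmax b c -> pcont g x) ->
  (CInt g a b + CInt g b c)%C = CInt g a c.
Proof.
  intros H1 H2. apply (RInt_Chasles (V := C_R_CompleteNormedModule)); now apply CInt_ex.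
Qed.

Lemma CInt_point g a : CInt g a a = RtoC 0.
Proof. apply (RInt_point (V := C_R_CompleteNormedModule)). Qed.

Lemma CInt_swap g a b : (forall x, Rmin a b <= x <= Rmax a b -> pcont g x) ->
  CInt g b a = (- CInt g a b)%C.
Proof.
  intros H. assert (E : (CInt g a b + CInt g b a)%C = CInt g a a).
  { apply CInt_chasles; auto. intros x. rewrite Rmin_comm, Rmax_comm. auto. }
  rewrite CInt_point in E.
  replace (CInt g b a) with ((CInt g a b + CInt g b a) - CInt g a b)%C by ring.
  rewrite E. ring.
Qed.

Lemma CInt_bound g a b M : (forall x, Rmin a b <= x <= Rmax a b -> pcont g x) ->
  (forall x, Rmin a b <= x <= Rmax a b -> Cmod (g x) <= M) ->
  Cmod (CInt g a b) <= Rabs (b - a) * M.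
Proof.
  intros H1 H2.
  assert (Nrm : forall x : C, norm (x : C_R_CompleteNormedModule) = Cmod x).
  { intros [x y]. cbn -[pow]. unfold prod_norm, Cmod. cbn -[pow].
    rewrite <- (pow2_abs x), <- (pow2_abs y). reflexivity. }
  rewrite <- Nrm. apply (norm_RInt_le_const_abs (V := C_R_CompleteNormedModule) g a b (CInt g a b) M).
  { intros x Hx. rewrite Nrm. auto. }
  apply (RInt_correct (V := C_R_CompleteNormedModule)). now apply CInt_ex.
Qed.

Lemma CInt_const c a b : CInt (fun _ => c) a b = (RtoC (b - a) * c)%C.
Proof.
  unfold CInt. rewrite RInt_const. apply scal_R_Cmult.
Qed.

Lemma CInt_ext g h a b : (forall x, Rmin a b <= x <= Rmax a b -> g x = h x) ->
  CInt g a b = CInt h a b.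
Proof.
  intros H. apply (RInt_ext (V := C_R_CompleteNormedModule)). intros; apply H; lra.
Qed.

Lemma CInt_plus g h a b :
  (forall x, Rmin a b <= x <= Rmax a b -> pcont g x) ->
  (forall x, Rmin a b <= x <= Rmax a b -> pcont h x) ->
  CInt (fun x => g x + h x)%C a b = (CInt g a b + CInt h a b)%C.
Proof.
  intros H1 H2. apply (RInt_plus (V := C_R_CompleteNormedModule)); now apply CInt_ex.
Qed.

Lemma pcont_line f z e t : ccont f (z + RtoC t * e)%C -> pcont (fun s => f (z + RtoC s * e)%C) t.
Proof.
  intros H eps Heps. destruct (H eps Heps) as [d [Hd K]].
  assert (Ge := Cmod_ge_0 e).
  exists (d / (Cmod e + 1)). split; [apply Rdiv_lt_0_compat; lra|].
  intros y Hy. apply K.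
  replace (z + RtoC y * e - (z + RtoC t * e))%C with (RtoC (y - t) * e)%C
    by (rewrite RtoC_minus; ring).
  rewrite Cmod_mult, Cmod_R. apply Rlt_div_r in Hy; [|lra].
  assert (P := Rabs_pos (y - t)). nra.
Qed.

Lemma ccont_mult_const f s c : ccont f s -> ccont (fun z => c * f z)%C s.
Proof.
  intros H eps Heps. assert (G := Cmod_ge_0 c).
  destruct (H (eps / (Cmod c + 1))) as [d [Hd K]]; [apply Rdiv_lt_0_compat; lra|].
  exists d. split; auto. intros z Hz. specialize (K z Hz).
  replace (c * f z - c * f s)%C with (c * (f z - f s))%C by ring.
  rewrite Cmod_mult. apply Rlt_div_r in K; [|lra].
  assert (P := Cmod_ge_0 (f z - f s)). nra.
Qed.

(** The real theorem for each component, by [path_derive]. *)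
Lemma CInt_FTC F f z e a b :
  (forall t, Rmin a b <= t <= Rmax a b ->
     is_complex_derive F (z + RtoC t * e)%C (f (z + RtoC t * e)%C) /\ ccont f (z + RtoC t * e)%C) ->
  CInt (fun t => e * f (z + RtoC t * e))%C a b = (F (z + RtoC b * e) - F (z + RtoC a * e))%C.
Proof.
  intros H.
  apply (is_RInt_unique (V := C_R_CompleteNormedModule)).
  assert (PC : forall t, Rmin a b <= t <= Rmax a b -> pcont (fun t => e * f (z + RtoC t * e))%C t).
  { intros t Ht. apply (pcont_line (fun w => e * f w)%C). apply ccont_mult_const, H, Ht. }
  assert (R1 : is_RInt (fun t => Re (e * f (z + RtoC t * e)%C)%C) a b
    (Re (F (z + RtoC b * e)%C) - Re (F (z + RtoC a * e)%C))).
  { apply (is_RInt_derive (V := R_CompleteNormedModule) (fun t => Re (F (z + RtoC t * e)%C))).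
    - intros t Ht. destruct (path_derive F z e _ t (proj1 (H t Ht))) as [A _].
      rewrite Cmult_comm. exact A.
    - intros t Ht P [r Hr]. destruct (PC t Ht r (cond_pos r)) as [d [Hd K]].
      exists (mkposreal d Hd). intros y Hy. apply Hr.
      eapply Rle_lt_trans; [|apply (K y Hy)]. apply (Re_le_Cmod (_ - _)%C). }
  assert (R2 : is_RInt (fun t => Im (e * f (z + RtoC t * e)%C)%C) a b
    (Im (F (z + RtoC b * e)%C) - Im (F (z + RtoC a * e)%C))).
  { apply (is_RInt_derive (V := R_CompleteNormedModule) (fun t => Im (F (z + RtoC t * e)%C))).
    - intros t Ht. destruct (path_derive F z e _ t (proj1 (H t Ht))) as [_ A].
      rewrite Cmult_comm. exact A.
    - intros t Ht P [r Hr]. destruct (PC t Ht r (cond_pos r)) as [d [Hd K]].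
      exists (mkposreal d Hd). intros y Hy. apply Hr.
      eapply Rle_lt_trans; [|apply (K y Hy)]. apply (Im_le_Cmod (_ - _)%C). }
  exact (is_RInt_fct_extend_pair (fun t => (e * f (z + RtoC t * e)%C)%C) a b _ _ R1 R2).
Qed.

(* The integrals of [f] along the sides of a rectangle, as parametrized by
   [z + t e] with [e = 1] or [e = Ci]. *)
Definition hint (f : C -> C) (y a b : R) : C := CInt (fun t => 1 * f ((0, y) + RtoC t * 1))%C a b.
Definition vint (f : C -> C) (x c d : R) : C := CInt (fun t => Ci * f (RtoC x + RtoC t * Ci))%C c d.

(** Counterclockwise for [a <= b] and [c <= d]; with reversed corners the orientation changes sign
    accordingly. *)
Definition contour (f : C -> C) (a b c d : R) : C :=
  (hint f c a b + vint f b c d - hint f d a b - vint f a c d)%C.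

Lemma hpt x y : ((0, y) + RtoC x * 1)%C = (x, y).
Proof. apply C_ext; unfold Re, Im; simpl; ring. Qed.

Lemma vpt x y : (RtoC x + RtoC y * Ci)%C = (x, y).
Proof. apply C_ext; unfold Ci, Re, Im; simpl; ring. Qed.

Lemma hint_pcont f x y : ccont f (x, y) -> pcont (fun t => 1 * f ((0, y) + RtoC t * 1))%C x.
Proof.
  intros H. apply (pcont_line (fun w => 1 * f w)%C). apply ccont_mult_const. now rewrite hpt.
Qed.

Lemma vint_pcont f x y : ccont f (x, y) -> pcont (fun t => Ci * f (RtoC x + RtoC t * Ci))%C y.
Proof.
  intros H. apply (pcont_line (fun w => Ci * f w)%C). apply ccont_mult_const. now rewrite vpt.
Qed.

Lemma hint_chasles f y a b c :
  (forall x, Rmin a (Rmin b c) <= x <= Rmax a (Rmax b c) -> ccont f (x, y)) ->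
  (hint f y a b + hint f y b c)%C = hint f y a c.
Proof.
  intros H. apply CInt_chasles; intros x Hx; apply hint_pcont, H; revert Hx;
  unfold Rmin, Rmax; repeat destruct Rle_dec; lra.
Qed.

Lemma vint_chasles f x a b c :
  (forall y, Rmin a (Rmin b c) <= y <= Rmax a (Rmax b c) -> ccont f (x, y)) ->
  (vint f x a b + vint f x b c)%C = vint f x a c.
Proof.
  intros H. apply CInt_chasles; intros y Hx; apply vint_pcont, H; revert Hx;
  unfold Rmin, Rmax; repeat destruct Rle_dec; lra.
Qed.

Lemma hint_bound f y a b M :
  (forall x, Rmin a b <= x <= Rmax a b -> ccont f (x, y) /\ Cmod (f (x, y)) <= M) ->
  Cmod (hint f y a b) <= Rabs (b - a) * M.
Proof.
  intros H. apply CInt_bound; intros x Hx; destruct (H x Hx).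
  - now apply hint_pcont.
  - rewrite hpt, Cmult_1_l. auto.
Qed.

Lemma vint_bound f x a b M :
  (forall y, Rmin a b <= y <= Rmax a b -> ccont f (x, y) /\ Cmod (f (x, y)) <= M) ->
  Cmod (vint f x a b) <= Rabs (b - a) * M.
Proof.
  intros H. apply CInt_bound; intros y Hy; destruct (H y Hy).
  - now apply vint_pcont.
  - rewrite vpt, Cmod_mult, Cmod_Ci, Rmult_1_l. auto.
Qed.

Lemma hint_plus f g y a b :
  (forall x, Rmin a b <= x <= Rmax a b -> ccont f (x, y) /\ ccont g (x, y)) ->
  hint (fun z => f z + g z)%C y a b = (hint f y a b + hint g y a b)%C.
Proof.
  intros H. unfold hint. rewrite <- CInt_plus.
  - apply CInt_ext. intros; ring.
  - intros x Hx. apply hint_pcont, H, Hx.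
  - intros x Hx. apply hint_pcont, H, Hx.
Qed.

Lemma vint_plus f g x a b :
  (forall y, Rmin a b <= y <= Rmax a b -> ccont f (x, y) /\ ccont g (x, y)) ->
  vint (fun z => f z + g z)%C x a b = (vint f x a b + vint g x a b)%C.
Proof.
  intros H. unfold vint. rewrite <- CInt_plus.
  - apply CInt_ext. intros; ring.
  - intros y Hy. apply vint_pcont, H, Hy.
  - intros y Hy. apply vint_pcont, H, Hy.
Qed.

Lemma hint_FTC F f y a b :
  (forall x, is_complex_derive F (x, y) (f (x, y)) /\ ccont f (x, y)) ->
  hint f y a b = (F (b, y) - F (a, y))%C.
Proof.
  intros H. unfold hint. rewrite (CInt_FTC F), !hpt; auto. intros t _. rewrite hpt. auto.
Qed.

Lemma vint_FTC F f x a b :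
  (forall y, is_complex_derive F (x, y) (f (x, y)) /\ ccont f (x, y)) ->
  vint f x a b = (F (x, b) - F (x, a))%C.
Proof.
  intros H. unfold vint. rewrite (CInt_FTC F), !vpt; auto. intros t _. rewrite vpt. auto.
Qed.

Lemma contour_split f a m b c n d : a <= m <= b -> c <= n <= d ->
  (forall z, in_rect a b c d z -> ccont f z) ->
  contour f a b c d = (contour f a m c n + contour f m b c n +
    contour f a m n d + contour f m b n d)%C.
Proof.
  intros Hm Hn H.
  assert (E : forall y, c <= y <= d -> (hint f y a m + hint f y m b)%C = hint f y a b).
  { intros y Hy. apply hint_chasles. intros x. rewrite (Rmin_left m), (Rmin_left a), (Rmax_right m), (Rmax_right a) by lra.
    intros Hx. apply H. split; auto. }
  assert (E' : forall x, a <= x <= b -> (vint f x c n + vint f x n d)%C = vint f x c d).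
  { intros y Hy. apply vint_chasles. intros x. rewrite (Rmin_left n), (Rmin_left c), (Rmax_right n), (Rmax_right c) by lra.
    intros Hx. apply H. split; auto. }
  unfold contour. rewrite <- (E c), <- (E d), <- (E' a), <- (E' b) by lra. ring.
Qed.

(** The primitive [F] turns each side into a difference of corner values, and these cancel. *)
Lemma contour_affine p l s a b c d : contour (fun z => p + l * (z - s))%C a b c d = RtoC 0.
Proof.
  set (F := (fun z => p * z + l * ((z - s) * (z - s)) * / 2)%C).
  assert (N2 : RtoC 2 <> RtoC 0).
  { intros E. apply RtoC_inj in E. lra. }
  assert (HF : forall z, is_complex_derive F z (p + l * (z - s))%C).
  { intros z. unfold F. assert (I : is_complex_derive (fun z => z - s)%C z (1 + 0)%C).
    { apply cd_plus; [apply cd_id|apply cd_const]. }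
    eapply cd_eq.
    - apply cd_plus; [apply cd_mult; [apply cd_const|apply cd_id]|].
      apply (cd_mult (fun z => l * ((z - s) * (z - s)))%C (fun _ => / 2)%C); [|apply cd_const].
      apply cd_mult; [apply cd_const|]. apply cd_mult; exact I.
    - cbv beta. field; auto. }
  assert (Hc : forall z, ccont (fun z => p + l * (z - s))%C z).
  { intros z. eapply cd_cont. apply cd_plus; [apply cd_const|]. apply cd_mult; [apply cd_const|].
    apply cd_plus; [apply cd_id|apply cd_const]. }
  unfold contour. rewrite !(hint_FTC F), !(vint_FTC F) by auto. ring.
Qed.

Lemma contour_ext f g a b c d : (forall z, f z = g z) -> contour f a b c d = contour g a b c d.
Proof.
  intros H. unfold contour, hint, vint.
  rewrite (CInt_ext (fun t => 1 * f ((0%R, c) + RtoC t * 1))%C (fun t => 1 * g ((0%R, c) + RtoC t * 1))%C),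
    (CInt_ext (fun t => 1 * f ((0%R, d) + RtoC t * 1))%C (fun t => 1 * g ((0%R, d) + RtoC t * 1))%C),
    (CInt_ext (fun t => Ci * f (RtoC a + RtoC t * Ci))%C (fun t => Ci * g (RtoC a + RtoC t * Ci))%C),
    (CInt_ext (fun t => Ci * f (RtoC b + RtoC t * Ci))%C (fun t => Ci * g (RtoC b + RtoC t * Ci))%C);
    intros; now rewrite ?H.
Qed.

Lemma contour_bound f a b c d M : a <= b -> c <= d ->
  (forall z, in_rect a b c d z -> ccont f z /\ Cmod (f z) <= M) ->
  Cmod (contour f a b c d) <= 2 * ((b - a) + (d - c)) * M.
Proof.
  intros Hab Hcd H.
  assert (Hh : forall y, c <= y <= d -> Cmod (hint f y a b) <= (b - a) * M).
  { intros y Hy. rewrite <- (Rabs_pos_eq (b - a)) by lra. apply hint_bound.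
    intros x. rewrite Rmin_left, Rmax_right by lra. intros Hx. apply H. split; auto. }
  assert (Hv : forall x, a <= x <= b -> Cmod (vint f x c d) <= (d - c) * M).
  { intros x Hx. rewrite <- (Rabs_pos_eq (d - c)) by lra. apply vint_bound.
    intros y. rewrite Rmin_left, Rmax_right by lra. intros Hy. apply H. split; auto. }
  unfold contour.
  assert (H1 := Hh c ltac:(lra)). assert (H2 := Hh d ltac:(lra)).
  assert (H3 := Hv a ltac:(lra)). assert (H4 := Hv b ltac:(lra)).
  eapply Rle_trans; [apply Cmod_minus_le|].
  eapply Rle_trans; [apply Rplus_le_compat_r, Cmod_minus_le|].
  eapply Rle_trans; [apply Rplus_le_compat_r, Rplus_le_compat_r, Cmod_triangle|]. lra.
Qed.

Lemma ccont_plus f g s : ccont f s -> ccont g s -> ccont (fun z => f z + g z)%C s.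
Proof.
  intros Hf Hg eps Heps.
  destruct (Hf (eps / 2) ltac:(lra)) as [d1 [Hd1 K1]].
  destruct (Hg (eps / 2) ltac:(lra)) as [d2 [Hd2 K2]].
  exists (Rmin d1 d2). split; [now apply Rmin_pos|]. intros z Hz.
  specialize (K1 z (Rlt_le_trans _ _ _ Hz (Rmin_l _ _))).
  specialize (K2 z (Rlt_le_trans _ _ _ Hz (Rmin_r _ _))).
  replace (f z + g z - (f s + g s))%C with ((f z - f s) + (g z - g s))%C by ring.
  eapply Rle_lt_trans; [apply Cmod_triangle|]. lra.
Qed.

(** The bound propagated by bisection is proportional to the area, so it adds up over quarters. Near
    a point the affine part of [f] integrates to 0 and the rest is at most [eps] times the
    half-perimeter [h], so the integral is at most [2 eps h^2]. As the small rectangle is similar to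
    the large one, [h^2] is [S ^ 2 / A] times its area. *)
Lemma Goursat f a b c d : a < b -> c < d ->
  (forall z, in_rect a b c d z -> exists l, is_complex_derive f z l) ->
  contour f a b c d = RtoC 0.
Proof.
  intros Hab Hcd Hf.
  assert (Hc : forall z, in_rect a b c d z -> ccont f z).
  { intros z Hz. destruct (Hf z Hz) as [l Hl]. now apply cd_cont with l. }
  set (S := (b - a) + (d - c)). set (A := (b - a) * (d - c)).
  assert (HS : 0 < S) by (unfold S; lra). assert (HA : 0 < A) by (unfold A; nra).
  assert (Main : forall eps, 0 < eps ->
    Cmod (contour f a b c d) <= eps * (2 * S ^ 2 / A) * ((b - a) * (d - c))).
  { intros eps Heps.
    (* The order premises confine the claim to rectangles inside the original one, where [f] is
       differentiable. *)
    assert (Hb := rect_bisection (fun a' b' c' d' => a <= a' -> a' <= b' -> b' <= b ->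
      c <= c' -> c' <= d' -> d' <= d ->
      Cmod (contour f a' b' c' d') <= eps * (2 * S ^ 2 / A) * ((b' - a') * (d' - c')))
      a b c d ltac:(lra) ltac:(lra)).
    apply Hb; try lra; clear Hb.
    - intros a' b' c' d' H1 H2 H3 H4 Ga Gab Gb Gc Gcd Gd.
      specialize (H1 ltac:(lra) ltac:(lra) ltac:(lra) ltac:(lra) ltac:(lra) ltac:(lra)).
      specialize (H2 ltac:(lra) ltac:(lra) ltac:(lra) ltac:(lra) ltac:(lra) ltac:(lra)).
      specialize (H3 ltac:(lra) ltac:(lra) ltac:(lra) ltac:(lra) ltac:(lra) ltac:(lra)).
      specialize (H4 ltac:(lra) ltac:(lra) ltac:(lra) ltac:(lra) ltac:(lra) ltac:(lra)).
      rewrite (contour_split f a' ((a' + b') / 2) b' c' ((c' + d') / 2) d') by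
        (try lra; intros z [Z1 Z2]; apply Hc; split; lra).
      eapply Rle_trans; [apply Cmod_triangle|].
      eapply Rle_trans; [apply Rplus_le_compat_r, Cmod_triangle|].
      eapply Rle_trans; [apply Rplus_le_compat_r, Rplus_le_compat_r, Cmod_triangle|]. 
      eapply Rle_trans; [exact (Rplus_le_compat _ _ _ _ (Rplus_le_compat _ _ _ _ (Rplus_le_compat _ _ _ _ H1 H2) H3) H4)|].
      right. field. lra.
    - intros x y Hx Hy.
      destruct (Hf (x, y) (conj Hx Hy)) as [l Hl].
      assert (Hl2 := Hl). rewrite is_complex_derive_eps in Hl2.
      destruct (Hl2 eps Heps) as [e [He K]].
      destruct (rect_local a b c d x y e ltac:(lra) ltac:(lra) He) as [N HN].
      exists N. intros n Hn a' b' c' d' A' B' C' D' E1 E2 _ _ _ _ _ _.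
      specialize (HN n Hn a' b' c' d' ltac:(lra) ltac:(lra) E1 E2).
      set (r := (fun z => f z + ((- f (x, y)) + (- l) * (z - (x, y))))%C).
      set (h := (fun z => f (x, y) + l * (z - (x, y)))%C).
      assert (Cr : forall z, in_rect a' b' c' d' z -> ccont r z).
      { intros z Hz. apply ccont_plus.
        - apply Hc. destruct Hz; split; lra.
        - eapply cd_cont. apply cd_plus; [apply cd_const|]. apply cd_mult; [apply cd_const|].
          apply cd_plus; [apply cd_id|apply cd_const]. }
      assert (Ch : forall z, ccont h z).
      { intros z. eapply cd_cont. apply cd_plus; [apply cd_const|]. apply cd_mult; [apply cd_const|].
        apply cd_plus; [apply cd_id|apply cd_const]. }
      assert (E : contour f a' b' c' d' = contour r a' b' c' d').
      { assert (Er : contour (fun z => r z + h z)%C a' b' c' d' = (contour r a' b' c' d' + contour h a' b' c' d')%C).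
        { unfold contour. rewrite !hint_plus, !vint_plus; [ring|..];
            intros t; rewrite Rmin_left, Rmax_right by lra; intros Ht; (split; [apply Cr; split; simpl; lra|apply Ch]). }
        assert (Z : contour h a' b' c' d' = RtoC 0) by apply contour_affine.
        rewrite Z, Cplus_0_r in Er. rewrite <- Er. apply contour_ext.
        intros; unfold r, h; ring. }
      rewrite E.
      eapply Rle_trans; [apply (contour_bound r a' b' c' d' (eps * ((b' - a') + (d' - c')))); try lra|].
      + intros z Hz. split; [now apply Cr|].
        specialize (K z (HN z Hz)). unfold r.
        replace (f z + (- f (x, y) + - l * (z - (x, y))))%C with (f z - f (x, y) - l * (z - (x, y)))%C by ring.
        eapply Rle_trans; [exact K|]. apply Rmult_le_compat_l; [lra|].
        eapply Rle_trans; [apply Cmod_le_abs|]. destruct Hz as [Z1 Z2]. destruct z as [zx zy]; unfold Re, Im in *; simpl in *.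
        apply Rplus_le_compat; apply Rabs_le; lra.
      + rewrite E1, E2. right. unfold S, A. field.
        split; [|split]; try lra. apply pow_nonzero; lra. }
  apply Cmod_eq_0. apply Rle_antisym; [|apply Cmod_ge_0].
  apply le_epsilon. intros eps Heps. rewrite Rplus_0_l.
  specialize (Main (eps / (2 * S ^ 2)) ltac:(apply Rdiv_lt_0_compat; nra)).
  eapply Rle_trans; [exact Main|]. right. unfold A in *. field. split; [|split]; try lra.
Qed.

(** * Primitives and logarithms *)

(** With two points it contains the rectangle they span, so Goursat's theorem for rectangles
    suffices to build primitives; it also contains a whole vertical half-line. *)
Definition quadrant (al be : R) (z : C) : Prop := al < Re z /\ be < Im z.

Lemma hint_swap f y a b : (forall x, Rmin a b <= x <= Rmax a b -> ccont f (x, y)) ->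
  hint f y b a = (- hint f y a b)%C.
Proof. intros H. apply CInt_swap. intros x Hx. now apply hint_pcont, H. Qed.

Lemma vint_swap f x a b : (forall y, Rmin a b <= y <= Rmax a b -> ccont f (x, y)) ->
  vint f x b a = (- vint f x a b)%C.
Proof. intros H. apply CInt_swap. intros y Hy. now apply vint_pcont, H. Qed.

(** Reversed and degenerate rectangles reduce to ordered ones by changes of sign. Primitives need
    them, as a point may lie on any side of the base point. *)
Lemma Goursat_quadrant al be f a b c d : 
  (forall z, quadrant al be z -> exists l, is_complex_derive f z l) ->
  al < a -> al < b -> be < c -> be < d ->
  contour f a b c d = RtoC 0.
Proof.
  intros Hf Ha Hb Hc Hd.
  assert (Hcont : forall z, quadrant al be z -> ccont f z).
  { intros z Hz. destruct (Hf z Hz) as [l Hl]. now apply cd_cont with l. }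
  assert (Hh : forall y u v, be < y -> al < u -> al < v -> hint f y v u = (- hint f y u v)%C).
  { intros y u v Hy Hu Hv. apply hint_swap. intros x Hx. apply Hcont.
    split; simpl; auto. apply Rlt_le_trans with (Rmin u v); [now apply Rmin_glb_lt|lra]. }
  assert (Hv : forall x u v, al < x -> be < u -> be < v -> vint f x v u = (- vint f x u v)%C).
  { intros x u v Hx Hu Hv. apply vint_swap. intros y Hy. apply Hcont.
    split; simpl; auto. apply Rlt_le_trans with (Rmin u v); [now apply Rmin_glb_lt|lra]. }
  assert (G : forall a b c d, al < a -> be < c -> a < b -> c < d -> contour f a b c d = RtoC 0).
  { intros. apply Goursat; auto. intros z [Z1 Z2]. apply Hf. split; lra. }
  assert (G2 : forall a b, al < a -> al < b -> a < b -> contour f a b c d = RtoC 0).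
  { intros a' b' Ha' Hb' Hab. destruct (Rtotal_order c d) as [H|[H|H]].
    - now apply G.
    - subst. unfold contour, vint. rewrite !CInt_point. ring.
    - assert (E := G a' b' d c Ha' Hd Hab H). unfold contour in *.
      rewrite (Hv a' d c), (Hv b' d c) by auto.
      transitivity (- (0))%C; [|ring]. rewrite <- E. ring. }
  destruct (Rtotal_order a b) as [H|[H|H]].
  - now apply G2.
  - subst. unfold contour, hint. rewrite !CInt_point. ring.
  - assert (E := G2 b a Hb Ha H). unfold contour in *.
    rewrite (Hh c b a), (Hh d b a) by auto.
    transitivity (- (0))%C; [|ring]. rewrite <- E. ring.
Qed.

(** Integrate from [(x0, y0)] horizontally and then vertically. By Goursat the increment between two
    points is again the integral along two such legs ([Diff]), and continuity of [f] gives the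
    derivative. *)
Lemma primitive_quadrant al be f :
  (forall z, quadrant al be z -> exists l, is_complex_derive f z l) ->
  exists P, forall z, quadrant al be z -> is_complex_derive P z (f z).
Proof.
  intros Hf.
  assert (Hcont : forall z, quadrant al be z -> ccont f z).
  { intros z Hz. destruct (Hf z Hz) as [l Hl]. now apply cd_cont with l. }
  set (x0 := al + 1). set (y0 := be + 1).
  assert (X0 : al < x0) by (unfold x0; lra). assert (Y0 : be < y0) by (unfold y0; lra).
  assert (Mn : forall k u v, k < u -> k < v -> k < Rmin u v) by (intros; now apply Rmin_glb_lt).
  set (P := fun z => (hint f y0 x0 (Re z) + vint f (Re z) y0 (Im z))%C).
  assert (Diff : forall x y x' y', quadrant al be (x, y) -> quadrant al be (x', y') ->
    (P (x', y') - P (x, y))%C = (hint f y x x' + vint f x' y y')%C).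
  { intros x y x' y' [Hx Hy] [Hx' Hy']. simpl in *. unfold P; simpl.
    assert (G := Goursat_quadrant al be f x x' y0 y Hf Hx Hx' Y0 Hy). unfold contour in G.
    assert (C1 : (hint f y0 x0 x + hint f y0 x x')%C = hint f y0 x0 x').
    { apply hint_chasles. intros t Ht. apply Hcont. split; simpl; auto.
      eapply Rlt_le_trans; [|apply Ht]. auto. }
    assert (C2 : (vint f x' y0 y + vint f x' y y')%C = vint f x' y0 y').
    { apply vint_chasles. intros t Ht. apply Hcont. split; simpl; auto.
      eapply Rlt_le_trans; [|apply Ht]. auto. }
    rewrite <- C1, <- C2.
    apply Ceq_minus. rewrite <- G. ring. }
  exists P. intros z Hz. apply is_complex_derive_eps. intros eps Heps.
  (* Half of [eps] for each leg, since each leg may be as long as the modulus of the increment. *)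
  destruct (Hcont z Hz (eps / 2) ltac:(lra)) as [d1 [Hd1 K]].
  destruct z as [x y]. assert (Hz' := Hz). destruct Hz' as [Hx Hy]; simpl in Hx, Hy.
  set (d := Rmin (d1 / 2) (Rmin (x - al) (y - be))).
  assert (Hd : 0 < d) by (unfold d; repeat apply Rmin_pos; lra).
  assert (L1 : d <= d1 / 2) by apply Rmin_l.
  assert (L2 : d <= x - al) by (eapply Rle_trans; [apply Rmin_r|apply Rmin_l]).
  assert (L3 : d <= y - be) by (eapply Rle_trans; [apply Rmin_r|apply Rmin_r]).
  exists d. split; auto. intros [x' y'] Hw.
  assert (Wx := Rle_lt_trans _ _ _ (Re_le_Cmod _) Hw).
  assert (Wy := Rle_lt_trans _ _ _ (Im_le_Cmod _) Hw). simpl in Wx, Wy.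
  assert (Wx' := Wx). assert (Wy' := Wy).
  apply Rabs_lt_between in Wx'. apply Rabs_lt_between in Wy'.
  assert (Hw' : quadrant al be (x', y')) by (split; simpl; lra).
  rewrite (Diff x y x' y' Hz Hw').
  assert (Seg : forall u v t, Rmin u v <= t <= Rmax u v -> Rabs (t - u) <= Rabs (v - u)).
  { intros u v t Ht. unfold Rmin, Rmax in Ht. destruct (Rle_dec u v).
    - rewrite !Rabs_pos_eq; lra.
    - rewrite !Rabs_left1; lra. }
  set (h := fun w => (f w + (- f (x, y)))%C).
  assert (Hh : forall w, quadrant al be w -> ccont h w).
  { intros w Hq. apply ccont_plus; auto. eapply cd_cont, cd_const. }
  assert (Q1 : forall t, Rmin x x' <= t <= Rmax x x' -> quadrant al be (t, y) /\ Cmod (h (t, y)) <= eps / 2).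
  { intros t Ht. assert (St := Seg _ _ _ Ht). split.
    - split; simpl; auto. eapply Rlt_le_trans; [|apply Ht]. apply Mn; auto. lra.
    - apply Rlt_le. apply (K (t, y)). eapply Rle_lt_trans; [apply Cmod_le_abs|]. unfold Re, Im; simpl.
      replace (y + - y) with 0 by ring. rewrite Rabs_R0. unfold Rminus in St. lra. }
  assert (Q2 : forall t, Rmin y y' <= t <= Rmax y y' -> quadrant al be (x', t) /\ Cmod (h (x', t)) <= eps / 2).
  { intros t Ht. assert (St := Seg _ _ _ Ht). split.
    - split; simpl; [lra|]. eapply Rlt_le_trans; [|apply Ht]. apply Mn; auto. lra.
    - apply Rlt_le. apply (K (x', t)). eapply Rle_lt_trans; [apply Cmod_le_abs|]. unfold Re, Im; simpl.
      unfold Rminus in St. lra. }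
  assert (E1 : hint f y x x' = (hint h y x x' + RtoC (x' - x)%R * f (x, y))%C).
  { transitivity (hint (fun w => h w + f (x, y))%C y x x').
    - apply CInt_ext. intros. unfold h. ring.
    - rewrite hint_plus.
      + f_equal. unfold hint. rewrite CInt_const. ring.
      + intros t Ht. split; [apply Hh, Q1, Ht|eapply cd_cont, cd_const]. }
  assert (E2 : vint f x' y y' = (vint h x' y y' + RtoC (y' - y)%R * (Ci * f (x, y)))%C).
  { transitivity (vint (fun w => h w + f (x, y))%C x' y y').
    - apply CInt_ext. intros. unfold h. ring.
    - rewrite vint_plus.
      + f_equal. unfold vint. rewrite CInt_const. ring.
      + intros t Ht. split; [apply Hh, Q2, Ht|eapply cd_cont, cd_const]. }
  assert (Ed : ((x', y') - (x, y))%C = (RtoC (x' - x)%R + RtoC (y' - y)%R * Ci)%C).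
  { apply C_ext; unfold Ci, Re, Im; simpl; ring. }
  rewrite E1, E2.
  replace (_ - _)%C with (hint h y x x' + vint h x' y y')%C by (rewrite Ed; ring).
  eapply Rle_trans; [apply Cmod_triangle|].
  assert (B1 : Cmod (hint h y x x') <= Rabs (x' - x) * (eps / 2)).
  { apply hint_bound. intros t Ht. destruct (Q1 t Ht). split; auto. }
  assert (B2 : Cmod (vint h x' y y') <= Rabs (y' - y) * (eps / 2)).
  { apply vint_bound. intros t Ht. destruct (Q2 t Ht). split; auto. }
  assert (M1 := Re_le_Cmod ((x', y') - (x, y))%C).
  assert (M2 := Im_le_Cmod ((x', y') - (x, y))%C).
  unfold Re in M1; unfold Im in M2; simpl in M1, M2. unfold Rminus in *. nra.
Qed.

(** The quadrant is convex: integrate the zero derivative along the segment. *)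
Lemma constant_of_derive_0 al be f :
  (forall z, quadrant al be z -> is_complex_derive f z (RtoC 0)) ->
  forall z w, quadrant al be z -> quadrant al be w -> f z = f w.
Proof.
  intros Hf z w Hz Hw.
  assert (Q : forall t, 0 <= t <= 1 -> quadrant al be (z + RtoC t * (w - z))%C).
  { assert (L : forall k u v t, k < u -> k < v -> 0 <= t <= 1 -> k < u + t * (v - u)).
    { intros k u v t Hu Hv Ht. destruct (Rle_lt_dec u v); [nra|].
      assert (0 <= (1 - t) * (u - v)) by (apply Rmult_le_pos; lra). lra. }
    intros t Ht. unfold quadrant in *. destruct z as [zx zy], w as [wx wy].
    unfold Re, Im in *; simpl in *. assert (L1 := L al zx wx t). assert (L2 := L be zy wy t). lra. }
  assert (E : (f (z + RtoC 1 * (w - z)) - f (z + RtoC 0 * (w - z)))%C = RtoC 0).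
  { rewrite <- (CInt_FTC f (fun _ => RtoC 0)).
    - rewrite (CInt_ext _ (fun _ => RtoC 0)) by (intros; ring). rewrite CInt_const. ring.
    - intros t. rewrite Rmin_left, Rmax_right by lra. intros Ht. split; [now apply Hf, Q|].
      eapply cd_cont, cd_const. }
  replace (z + RtoC 1 * (w - z))%C with w in E by ring.
  replace (z + RtoC 0 * (w - z))%C with z in E by ring.
  symmetry. now apply Ceq_minus.
Qed.

Lemma Cexp_surj (c : C) : 0 < Re c -> Cexp (ln (Cmod c), atan (Im c / Re c)) = c.
Proof.
  intros Hc. assert (P : 0 < Cmod c).
  { eapply Rlt_le_trans; [exact Hc|]. eapply Rle_trans; [apply Rle_abs|apply Re_le_Cmod]. }
  unfold Cexp; simpl. rewrite exp_ln by auto. rewrite cos_atan, sin_atan.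
  assert (S : sqrt (1 + (Im c / Re c)²) = Cmod c / Re c).
  { replace (1 + (Im c / Re c)²) with ((Cmod c / Re c) ^ 2).
    - apply sqrt_pow2. apply Rlt_le, Rdiv_lt_0_compat; auto.
    - unfold Rdiv. rewrite Rpow_mult_distr, Cmod_sqr. unfold Rsqr. field. lra. }
  rewrite S. apply C_ext; simpl; field; lra.
Qed.

(** [g] is a primitive of [f1 / f], and [f * Cexp (- g)] has derivative 0. Prescribing [w] selects
    the branch, which matters later when a logarithm must be small. *)
Lemma holo2_log al be f : holo2 (quadrant al be) f ->
  (forall z, quadrant al be z -> f z <> RtoC 0) ->
  forall s w, quadrant al be s -> Cexp w = f s ->
  exists g, holo2 (quadrant al be) g /\ g s = w /\
    forall z, quadrant al be z -> Cexp (g z) = f z.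
Proof.
  intros [f1 Hf] H0 s w Hs Hw.
  destruct (primitive_quadrant al be (fun z => f1 z * / f z)%C) as [P HP].
  { intros z Hz. destruct (Hf z Hz) as [F1 [l Hl]]. eexists.
    apply cd_mult; [exact Hl|]. apply cd_inv; [exact F1|auto]. }
  exists (fun z => P z + (w - P s))%C. split; [|split].
  - exists (fun z => f1 z * / f z)%C. intros z Hz. split.
    + eapply cd_eq; [apply cd_plus; [now apply HP|apply cd_const]|]. ring.
    + destruct (Hf z Hz) as [F1 [l Hl]]. eexists.
      apply cd_mult; [exact Hl|]. apply cd_inv; [exact F1|auto].
  - ring.
  - intros z Hz.
    set (q := fun z => (f z * Cexp (- (1) * (P z + (w - P s))))%C).
    assert (Q : q z = q s).
    { apply (constant_of_derive_0 al be); auto. intros u Hu. unfold q.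
      destruct (Hf u Hu) as [F1 _]. eapply cd_eq.
      - apply cd_mult; [exact F1|].
        apply (cd_comp Cexp (fun z => - (1) * (P z + (w - P s)))%C); [|apply cd_Cexp].
        apply cd_mult; [apply cd_const|]. apply cd_plus; [now apply HP|apply cd_const].
      - cbv beta. field. now apply H0. }
    assert (Q1 : q s = RtoC 1).
    { unfold q. rewrite <- Hw, <- Cexp_plus. transitivity (Cexp 0); [|apply Cexp_0]. f_equal. ring. }
    rewrite Q1 in Q. unfold q in Q.
    replace (- (1) * (P z + (w - P s)))%C with (- (P z + (w - P s)))%C in Q by ring.
    rewrite Cexp_opp in Q.
    rewrite <- (Cmult_1_r (Cexp _)), <- Q. field. apply Cexp_neq_0.
Qed.

(** * Identity theorem and interpolation *)

Lemma cd_unique f s l m : is_complex_derive f s l -> is_complex_derive f s m -> l = m.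
Proof.
  intros Hl Hm. rewrite is_complex_derive_eps in Hl. rewrite is_complex_derive_eps in Hm.
  apply Ceq_minus, Cmod_eq_0. apply Rle_antisym; [|apply Cmod_ge_0].
  apply le_epsilon. intros eps Heps. rewrite Rplus_0_l.
  destruct (Hl (eps / 2) ltac:(lra)) as [d1 [Hd1 K1]].
  destruct (Hm (eps / 2) ltac:(lra)) as [d2 [Hd2 K2]].
  set (h := Rmin d1 d2 / 2). assert (0 < Rmin d1 d2) by now apply Rmin_pos.
  assert (h1 := Rmin_l d1 d2). assert (h2 := Rmin_r d1 d2).
  assert (Hh : 0 < h) by (unfold h; lra).
  assert (E : Cmod (s + RtoC h - s) = h).
  { replace (s + RtoC h - s)%C with (RtoC h) by ring. rewrite Cmod_R. apply Rabs_pos_eq; lra. }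
  specialize (K1 (s + RtoC h)%C). specialize (K2 (s + RtoC h)%C). rewrite E in K1, K2.
  specialize (K1 ltac:(unfold h; lra)). specialize (K2 ltac:(unfold h; lra)).
  assert (Q : Cmod ((l - m) * RtoC h) <= eps * h).
  { replace ((l - m) * RtoC h)%C with
      ((f (s + RtoC h) - f s - m * (s + RtoC h - s)) - (f (s + RtoC h) - f s - l * (s + RtoC h - s)))%C by ring.
    eapply Rle_trans; [apply Cmod_minus_le|]. lra. }
  rewrite Cmod_mult, Cmod_R, (Rabs_pos_eq h) in Q by lra.
  now apply Rmult_le_reg_r in Q.
Qed.

Lemma Re_sqr (w : C) : Re (w * w)%C = Re w * Re w - Im w * Im w.
Proof. apply re_mult. Qed.

(** [f] has only one known derivative, so the maximum principle is applied to a primitive [P],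
    normalized to vanish for [1 < Re z]. The weight [Cexp (E z)] has modulus 1 at [w] and is
    exponentially small in [L'] on the three sides where [P] is merely bounded, while [P] vanishes
    on the fourth. Letting [L'] grow kills [P w], and [f] is the derivative of [P]. *)
Lemma holo_identity (f : C -> C) :
  (forall z, 0 < Re z -> exists l, is_complex_derive f z l) ->
  (forall z, 1 < Re z -> f z = RtoC 0) ->
  forall z, 0 < Re z -> f z = RtoC 0.
Proof.
  (* The rectangle around [w] reaches 4 below it, and [w] must fill a neighbourhood of [s], taken of
     radius at most 1. *)
  intros Hf H1 s Hs. set (be := Im s - 5).
  destruct (primitive_quadrant 0 be f) as [P0 HP0].
  { intros z [Hz _]. auto. }
  set (z1 := (2, Im s) : C).
  set (P := fun z => (P0 z + - P0 z1)%C).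
  assert (HP : forall z, quadrant 0 be z -> is_complex_derive P z (f z)).
  { intros z Hz. eapply cd_eq; [apply cd_plus; [now apply HP0|apply cd_const]|]. ring. }
  assert (PR : forall z, quadrant 1 be z -> P z = RtoC 0).
  { intros z Hz. rewrite (constant_of_derive_0 1 be P) with (w := z1); auto.
    - unfold P. ring.
    - intros w [W1 W2]. rewrite <- (H1 w W1). apply HP. split; lra.
    - split; simpl; [lra|unfold be; lra]. }
  assert (Z : forall w, quadrant 0 (be + 4) w -> P w = RtoC 0).
  { intros w [W1 W2]. destruct (Rlt_le_dec 1 (Re w)) as [L|L].
    { apply PR. split; lra. }
    set (a := Re w / 2). assert (Ha : 0 < a <= 1 / 2) by (unfold a; lra).
    assert (HC : forall z, in_rect a 2 (Im w - 4) (Im w + 4) z -> quadrant 0 be z).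
    { intros z [Z1 Z2]. split; lra. }
    destruct (rect_bounded (fun z => Cmod (P z)) a 2 (Im w - 4) (Im w + 4)) as [B HB]; try lra.
    { intros z Hz. apply rcont_Cmod. eapply cd_cont. apply HP. auto. }
    assert (HB0 : 0 <= B).
    { eapply Rle_trans; [apply (Cmod_ge_0 (P w))|]. apply HB. split; unfold a; lra. }
    assert (Main : forall L, 0 < L -> Cmod (P w) <= B * exp (- (L * (a / 2)))).
    { intros L' HL.
      (* Here [Re w = 2 a]. On the left side the exponent is at most [L' * (- a + a / 2)]; on the
         horizontal sides the square contributes [- 16] against at most [4], and [/ (2 * a) >= 1]
         makes this outweigh the linear term. *)
      set (E := fun z => (RtoC L' * ((z - w) + RtoC (/ (2 * a)) * ((z - w) * (z - w))))%C).
      assert (RE : forall z, Re (E z) = L' * ((Re z - Re w) +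
        / (2 * a) * ((Re z - Re w) * (Re z - Re w) - (Im z - Im w) * (Im z - Im w)))).
      { intros z. unfold E. rewrite re_scal_l, re_plus, re_scal_l, Re_sqr. reflexivity. }
      assert (Hm : Cmod (P w * Cexp (E w)) <= B * exp (- (L' * (a / 2)))).
      { apply (max_modulus (fun z => P z * Cexp (E z))%C a 2 (Im w - 4) (Im w + 4)); try lra.
        - apply holo2_mult.
          + exists f. intros z Hz. split; [now apply HP, HC|]. apply Hf. now apply HC.
          + apply holo2_exp. apply holo2_mult; [apply holo2_const|].
            apply holo2_plus; [|apply holo2_mult; [apply holo2_const|apply holo2_mult]];
              apply holo2_minus; try apply holo2_id; apply holo2_const.
        - intros z [Hz Hb]. rewrite Cmod_mult, Cmod_Cexp, RE.
          assert (Ia : 0 < / (2 * a)) by (apply Rinv_0_lt_compat; lra).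
          assert (Ea : / (2 * a) * a = 1 / 2) by (field; lra).
          assert (Bz := HB z Hz). assert (Hz' := Hz). destruct Hz' as [Hzx Hzy].
          assert (D : Re w = 2 * a) by (unfold a; field).
          set (k := / (2 * a)) in *. clearbody k.
          destruct Hb as [Hb|[Hb|Hb]].
          + apply Rmult_le_compat; auto using Cmod_ge_0. { apply Rlt_le, exp_pos. }
            apply exp_le. rewrite Hb, D.
            replace (- (L' * (a / 2))) with (L' * (- (a / 2))) by ring.
            apply Rmult_le_compat_l; [lra|].
            assert (0 <= k * ((Im z - Im w) * (Im z - Im w))).
            { apply Rmult_le_pos; [lra|]. apply Rle_0_sqr. }
            assert (k * (a * a) = a / 2) by (rewrite <- Rmult_assoc, Ea; field). nra.
          + rewrite PR by (split; lra). rewrite Cmod_0, Rmult_0_l.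
            apply Rmult_le_pos; auto. apply Rlt_le, exp_pos.
          + apply Rmult_le_compat; auto using Cmod_ge_0. { apply Rlt_le, exp_pos. }
            apply exp_le.
            replace (- (L' * (a / 2))) with (L' * (- (a / 2))) by ring.
            apply Rmult_le_compat_l; [lra|].
            assert (S : (Im z - Im w) * (Im z - Im w) = 16) by (destruct Hb as [-> | ->]; ring).
            rewrite S. assert (V : (Re z - Re w) * (Re z - Re w) <= 4) by nra.
            assert (k * (12) >= k * a * 12 * 2) by nra.
            assert (k * ((Re z - Re w) * (Re z - Re w) - 16) <= k * (- 12)) by (apply Rmult_le_compat_l; lra).
            nra.
        - split; unfold a; lra. }
      rewrite Cmod_mult, Cmod_Cexp, RE in Hm.
      replace (L' * _) with 0 in Hm by ring. rewrite exp_0, Rmult_1_r in Hm. exact Hm. }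
    apply Cmod_eq_0. apply Rle_antisym; [|apply Cmod_ge_0].
    apply le_epsilon. intros eps Heps. rewrite Rplus_0_l.
    set (x := B / eps + 1). assert (Hx : 0 < x).
    { unfold x. assert (0 <= B / eps) by (apply Rdiv_le_0_compat; lra). lra. }
    specialize (Main (x / (a / 2)) ltac:(apply Rdiv_lt_0_compat; lra)).
    replace (x / (a / 2) * (a / 2)) with x in Main by (field; lra).
    eapply Rle_trans; [exact Main|]. rewrite exp_Ropp.
    assert (Ex := exp_ineq1_le x). apply Rle_div_l; [apply exp_pos|].
    assert (B = eps * (x - 1)) by (unfold x; field; lra). nra. }
  apply (cd_unique P s).
  - apply HP. split; unfold be; lra.
  - apply cd_ext_loc with (fun _ => RtoC 0); [|apply cd_const].
    exists (Rmin (Re s) 1). split; [apply Rmin_pos; lra|]. intros z Hz. symmetry. apply Z.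
    assert (Z1 := Rlt_le_trans _ _ _ (Rle_lt_trans _ _ _ (Re_le_Cmod _) Hz) (Rmin_l _ _)).
    assert (Z2 := Rlt_le_trans _ _ _ (Rle_lt_trans _ _ _ (Im_le_Cmod _) Hz) (Rmin_r _ _)).
    apply Rabs_lt_between in Z1. apply Rabs_lt_between in Z2.
    unfold Cminus in Z1, Z2. rewrite re_plus, re_opp in Z1. rewrite im_plus, im_opp in Z2.
    split; unfold be; lra.
Qed.

(* Borel-Caratheodory combined with the three lines theorem: [g = f / (2A - f)] satisfies
   [|g| <= 1], and [|g| <= b / A] on the right side; interpolate to the centre. *)
Lemma interpolate_center (f : C -> C) (s : C) (a T A b : R) :
  0 < a <= 1 / 2 -> 0 < T -> 0 < b -> 16 * b <= A -> ln (A / b) <= T ^ 2 ->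
  holo2 (in_rect (Re s - a) (Re s + a) (Im s - T) (Im s + T)) f ->
  (forall z, in_rect (Re s - a) (Re s + a) (Im s - T) (Im s + T) z -> Re (f z) <= A) ->
  (forall z, in_rect (Re s - a) (Re s + a) (Im s - T) (Im s + T) z ->
     Re z = Re s + a -> Cmod (f z) <= b) ->
  Cmod (f s) <= 8 * sqrt (A * b).
Proof.
  intros Ha HT Hb HAb HlnT Hf HA Hright.
  set (D := in_rect (Re s - a) (Re s + a) (Im s - T) (Im s + T)) in *.
  assert (Hs : D s) by (split; lra).
  assert (Hden : forall z, D z -> (RtoC (2 * A) - f z)%C <> RtoC 0).
  { intros z Hz E. assert (R := f_equal Re E). unfold Cminus in R. rewrite re_plus, re_opp in R.
    specialize (HA z Hz). simpl in R. unfold Re in *. lra. }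
  assert (Hle : forall z, D z -> Cmod (f z) <= Cmod (RtoC (2 * A) - f z)).
  { intros z Hz. specialize (HA z Hz). apply Rsqr_incr_0; try apply Cmod_ge_0.
    rewrite !Rsqr_pow2, !Cmod_sqr. unfold Cminus. rewrite re_plus, re_opp, im_plus, im_opp, re_RtoC, im_RtoC. nra. }
  set (g := fun z => (f z * / (RtoC (2 * A) - f z))%C).
  assert (Hg1 : forall z, D z -> Cmod (g z) <= 1).
  { intros z Hz. unfold g. rewrite Cmod_mult, Cmod_inv by auto.
    assert (P := proj1 (Cmod_gt_0 _) (Hden z Hz)). apply Rle_div_l; auto.
    specialize (Hle z Hz). lra. }
  (* Balances the sides: the weight [exp (- a * L)] on the left and [b / A * exp (a * L)] on the
     right are both [sqrt (b / A)]. *)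
  set (L := ln (A / b) / (2 * a)).
  assert (HL : exp (- (2 * a * L)) = b / A).
  { unfold L. replace (2 * a * (ln (A / b) / (2 * a))) with (ln (A / b)) by (field; lra).
    rewrite exp_Ropp, exp_ln by (apply Rdiv_lt_0_compat; lra). field. lra. }
  assert (HL0 : 0 < L).
  { apply Rdiv_lt_0_compat; [|lra]. rewrite <- ln_1. apply ln_increasing; [lra|].
    apply Rlt_div_r; lra. }
  assert (HLT : 2 * a * L <= T ^ 2).
  { unfold L. replace (2 * a * (ln (A / b) / (2 * a))) with (ln (A / b)) by (field; lra). auto. }
  assert (Hgr : forall z, D z -> Re z = Re s + a -> Cmod (g z) <= exp (- (2 * a * L))).
  { intros z Hz Er. specialize (Hright z Hz Er). rewrite HL. unfold g.
    rewrite Cmod_mult, Cmod_inv by auto.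
    assert (P := proj1 (Cmod_gt_0 _) (Hden z Hz)).
    assert (Q : A <= Cmod (RtoC (2 * A) - f z)).
    { assert (H := Cmod_triangle' (RtoC (2 * A)) (f z)). rewrite Cmod_R, Rabs_pos_eq in H by lra. lra. }
    unfold Rdiv. apply Rmult_le_compat; auto using Cmod_ge_0.
    - apply Rlt_le, Rinv_0_lt_compat; auto.
    - apply Rinv_le_contravar; lra. }
  (* The square gives Gaussian decay in height. By [HLT] it outweighs the linear part on the
     horizontal sides, at the cost of the factor [exp (a * a) <= 2]. *)
  set (E := fun z => (RtoC L * (z - s) + (z - s) * (z - s))%C).
  assert (RE : forall z, Re (E z) = L * (Re z - Re s) + ((Re z - Re s) * (Re z - Re s) - (Im z - Im s) * (Im z - Im s))).
  { intros z. unfold E. rewrite re_plus, re_scal_l, Re_sqr. reflexivity. }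
  assert (Hm : Cmod (g s * Cexp (E s)) <= exp (a * a - a * L)).
  { apply (max_modulus (fun z => g z * Cexp (E z))%C (Re s - a) (Re s + a) (Im s - T) (Im s + T)); try lra; auto.
    - apply holo2_mult.
      + apply holo2_mult; auto. apply holo2_inv; auto.
        apply holo2_minus; auto. apply holo2_const.
      + assert (Hzs : holo2 D (fun z => z - s)%C).
        { apply (holo2_minus D (fun z => z) (fun _ => s)); [apply holo2_id|apply holo2_const]. }
        apply (holo2_exp D E). unfold E.
        apply (holo2_plus D (fun z => RtoC L * (z - s))%C (fun z => (z - s) * (z - s))%C).
        * apply (holo2_mult D (fun _ => RtoC L)); [apply holo2_const|exact Hzs].
        * apply (holo2_mult D (fun z => z - s)%C (fun z => z - s)%C); exact Hzs.
    - intros z [Hz Hbd]. rewrite Cmod_mult, Cmod_Cexp, RE.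
      assert (Hz' := Hz). destruct Hz' as [Zx Zy].
      assert (Y0 : 0 <= (Im z - Im s) * (Im z - Im s)) by apply Rle_0_sqr.
      destruct Hbd as [Hx|[Hx|Hy]].
      + rewrite <- (Rmult_1_l (exp (a * a - a * L))). apply Rmult_le_compat; auto using Cmod_ge_0.
        { apply Rlt_le, exp_pos. } apply exp_le. rewrite Hx. nra.
      + replace (exp (a * a - a * L)) with (exp (- (2 * a * L)) * exp (a * L + a * a))
          by (rewrite <- exp_plus; f_equal; ring).
        apply Rmult_le_compat; auto using Cmod_ge_0. { apply Rlt_le, exp_pos. }
        apply exp_le. rewrite Hx. nra.
      + rewrite <- (Rmult_1_l (exp (a * a - a * L))). apply Rmult_le_compat; auto using Cmod_ge_0.
        { apply Rlt_le, exp_pos. } apply exp_le.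
        assert (S : (Im z - Im s) * (Im z - Im s) = T ^ 2) by (destruct Hy as [-> | ->]; ring).
        rewrite S. assert ((Re z - Re s) * (Re z - Re s) <= a * a) by nra.
        assert (L * (Re z - Re s) <= L * a) by (apply Rmult_le_compat_l; lra). lra. }
  rewrite Cmod_mult, Cmod_Cexp, RE in Hm.
  replace (L * _ + _) with 0 in Hm by ring. rewrite exp_0, Rmult_1_r in Hm.
  set (r := sqrt (b / A)).
  assert (Hr : exp (- (a * L)) = r).
  { unfold r. rewrite <- HL. replace (- (2 * a * L)) with (- (a * L) + - (a * L)) by ring.
    rewrite exp_plus. rewrite sqrt_square; auto. apply Rlt_le, exp_pos. }
  assert (He : exp (a * a) <= 2).
  { assert (H := exp_ineq1_le (- (a * a))). rewrite exp_Ropp in H.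
    assert (P := exp_pos (a * a)).
    apply Rmult_le_reg_r with (/ exp (a * a)); [now apply Rinv_0_lt_compat|].
    rewrite Rinv_r by lra. nra. }
  assert (Hq : Cmod (g s) <= 2 * r).
  { eapply Rle_trans; [exact Hm|]. unfold Rminus. rewrite exp_plus, Hr.
    apply Rmult_le_compat_r; auto. apply sqrt_pos. }
  (* Then [2 * r <= 1 / 2], and [Cmod (f s)] on the right of [Cmod (f s) <= 2 * r * (2 * A + Cmod (f
     s))] can be absorbed. *)
  assert (Hr4 : r <= 1 / 4).
  { unfold r. rewrite <- (sqrt_square (1 / 4)) by lra. apply sqrt_le_1_alt. apply Rle_div_l; lra. }
  assert (Eq : (f s = g s * (RtoC (2 * A) - f s))%C).
  { unfold g. rewrite <- Cmult_assoc, Cinv_l by auto. ring. }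
  assert (M : Cmod (f s) <= Cmod (g s) * (2 * A + Cmod (f s))).
  { rewrite Eq at 1. rewrite Cmod_mult. apply Rmult_le_compat_l; [apply Cmod_ge_0|].
    eapply Rle_trans; [apply Cmod_minus_le|]. rewrite Cmod_R, Rabs_pos_eq; lra. }
  assert (F0 := Cmod_ge_0 (f s)). assert (G0 := Cmod_ge_0 (g s)).
  assert (Es : A * r = sqrt (A * b)).
  { unfold r. rewrite <- (sqrt_square A) at 1 by lra. rewrite <- sqrt_mult; try nra.
    - f_equal. field. lra.
    - apply Rdiv_le_0_compat; lra. }
  rewrite <- Es. nra.
Qed.

(** * Sums over primes and the first theorem of Mertens *)

Fixpoint psum (f : nat -> R) (N : nat) : R :=
  match N with
  | O => 0
  | S n => psum f n + (if prime.prime n then f n else 0)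
  end.

Section ArithmeticFacts.
Import ssreflect ssrfun ssrbool eqtype ssrnat seq div bigop prime binomial fintype.

Lemma INR_expn p k : INR (p ^ k)%N = INR p ^ k.
Proof. by elim: k => [|k IH]; rewrite ?expn0 // expnS mult_INR IH. Qed.

(** Unique factorization. Any [N] above [n] will do, as larger primes have exponent 0. *)
Lemma ln_prime_decomp (n N : nat) : (0 < n)%N -> (n < N)%N ->
  ln (INR n) = psum (fun p => INR (logn p n) * ln (INR p)) N.
Proof.
  move=> n0 nN. case: N nN => // N nN.
  have E := widen_partn predT (nN : (n <= N)%N). rewrite partnT // in E.
  rewrite {1}E. elim: N.+1 {E nN} => [|m IH]; first by rewrite big_geq //= ln_1.
  rewrite big_nat_recr //= mult_INR ln_mult.
  - rewrite IH. congr (_ + _). case: ifP => pm.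
    + rewrite INR_expn ln_pow //. by apply: lt_0_INR; apply/ltP; apply: prime_gt0.
    + by rewrite lognE pm /= ?expn0 /= ln_1.
  - apply: lt_0_INR; apply/ltP. apply: prodn_gt0 => i.
    by rewrite pfactor_gt0.
  - apply: lt_0_INR; apply/ltP. by rewrite pfactor_gt0.
Qed.

Lemma INR_prime_ge_2 p : prime p -> 2 <= INR p.
Proof. move=> /prime_gt1 /leP /le_INR; rewrite /=; lra. Qed.

(** The central coefficient is one term of the expansion of [(1 + 1)^(2 m)]. *)
Lemma ln_central_binomial (m : nat) : ln (INR 'C(m + m, m)) <= INR (m + m)%N * ln 2.
Proof.
  have B : ('C(m + m, m) <= 2 ^ (m + m))%N.
  { rewrite -[2%N]/(1 + 1)%N expnDn.
    have mi : (m < (m + m).+1)%N by rewrite ltnS leq_addr.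
    rewrite (bigD1 (Ordinal mi)) //= !exp1n !muln1. exact: leq_addr. }
  have P : (0 < 'C(m + m, m))%N by rewrite bin_gt0 leq_addr.
  rewrite -ln_pow; last lra.
  apply: ln_le; first by apply: lt_0_INR; apply/ltP.
  have -> : 2 ^ (m + m)%N = INR (2 ^ (m + m))%N by rewrite INR_expn.
  apply: le_INR. by apply/leP.
Qed.

Lemma prime_dvd_fact p n : prime p -> (p %| n`!)%N = (p <= n)%N.
Proof.
  move=> pp. apply/idP/idP; last by move=> pn; apply: dvdn_fact; rewrite prime_gt0.
  elim: n => [|n IH]; first by rewrite fact0 dvdn1 => /eqP E; rewrite E in pp.
  rewrite factS Euclid_dvdM // => /orP [/dvdn_leq -> //|/IH]. exact: leqW.
Qed.

(** Such a prime divides [(2 m)!] but not [m!]. *)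
Lemma prime_logn_central m p : prime p -> (m < p)%N -> (p <= m + m)%N ->
  (0 < logn p 'C(m + m, m))%N.
Proof.
  move=> pp mp pmm.
  have P : (0 < 'C(m + m, m))%N by rewrite bin_gt0 leq_addr.
  have E := @bin_fact (m + m) m (leq_addr _ _). rewrite addnK in E.
  rewrite lognE pp P /=.
  suff -> : (p %| 'C(m + m, m))%N by [].
  have D : (p %| (m + m)`!)%N by rewrite prime_dvd_fact.
  rewrite -E !Euclid_dvdM // !prime_dvd_fact // (leqNgt p m) mp /= orbF in D. exact: D.
Qed.

(** The first term of Legendre's formula. *)
Lemma logn_fact_lower p n : prime p -> INR n / INR p - 1 <= INR (logn p n`!).
Proof.
  move=> pp. have p0 := INR_prime_ge_2 p pp.
  case: n => [|n]; first by rewrite /= /Rdiv Rmult_0_l; have := pos_INR (logn p 0`!); lra.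
  rewrite logn_fact // big_ltn // expn1.
  have L : (n.+1 < (n.+1 %/ p).+1 * p)%N by rewrite ltn_ceil // prime_gt0.
  move/ltP/lt_INR: L. rewrite mult_INR (S_INR (n.+1 %/ p)) plus_INR.
  set s := INR (\sum_(_ <= _ < _) _). have : 0 <= s by apply: pos_INR.
  move=> s0 L. suff : INR n.+1 / INR p < INR (n.+1 %/ p) + 1 by lra.
  by apply/Rlt_div_l; lra.
Qed.

(** All terms of Legendre's formula, bounded by a geometric series. *)
Lemma logn_fact_upper p n : prime p -> INR (logn p n`!) <= INR n / (INR p - 1).
Proof.
  move=> pp. have p0 := INR_prime_ge_2 p pp.
  rewrite logn_fact //.
  suff H : forall k, INR (\sum_(1 <= i < k.+1) n %/ p ^ i)%N <= INR n / (INR p - 1) * (1 - / INR p ^ k).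
  { apply: Rle_trans (H n) _. rewrite -[X in _ <= X]Rmult_1_r. apply: Rmult_le_compat_l.
    - apply: Rdiv_le_0_compat; [exact: pos_INR|lra].
    - have := Rinv_0_lt_compat _ (pow_lt (INR p) n ltac:(lra)). lra. }
  elim=> [|k IH]; first by rewrite big_geq //= Rinv_1 Rminus_diag Rmult_0_r; lra.
  rewrite big_nat_recr //= plus_INR.
  have pk := pow_lt (INR p) k ltac:(lra).
  have D : INR (n %/ p ^ k.+1) <= INR n / INR p ^ k.+1.
  { apply/Rle_div_r; first by apply: pow_lt; lra.
    rewrite -INR_expn -mult_INR. apply: le_INR. apply/leP. exact: leq_divM. }
  apply: Rle_trans (Rplus_le_compat _ _ _ _ IH D) _.
  apply: Req_le. rewrite /=. field. lra.
Qed.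

End ArithmeticFacts.

(** * Rules for sums over primes, and Chebyshev's bound *)

Lemma psum_ext f g N : (forall p, prime.prime p = true -> (p < N)%nat -> f p = g p) -> psum f N = psum g N.
Proof.
  induction N as [|N IH]; intros H; simpl; auto.
  rewrite IH by (intros; apply H; auto; lia).
  destruct (prime.prime N) eqn:E; auto. rewrite H; auto.
Qed.

Lemma psum_plus f g N : psum (fun p => f p + g p) N = psum f N + psum g N.
Proof. induction N as [|N IH]; simpl; [ring|]. rewrite IH. destruct (prime.prime N); ring. Qed.

Lemma psum_scal c f N : psum (fun p => c * f p) N = c * psum f N.
Proof. induction N as [|N IH]; simpl; [ring|]. rewrite IH. destruct (prime.prime N); ring. Qed.

Lemma psum_incr_le f g a b : (a <= b)%nat ->
  (forall p, prime.prime p = true -> (a <= p < b)%nat -> f p <= g p) ->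
  psum f b - psum f a <= psum g b - psum g a.
Proof.
  induction 1 as [|b Hab IH]; intros H; [lra|]. simpl.
  assert (psum f b - psum f a <= psum g b - psum g a) by (apply IH; intros; apply H; auto; lia).
  destruct (prime.prime b) eqn:E; [|lra]. specialize (H b E ltac:(lia)). lra.
Qed.

Lemma psum_le f g N : (forall p, prime.prime p = true -> (p < N)%nat -> f p <= g p) -> psum f N <= psum g N.
Proof.
  intros H. assert (K := psum_incr_le f g 0 N ltac:(lia)). simpl in K.
  rewrite !Rminus_0_r in K. apply K. intros; apply H; auto; lia.
Qed.

Lemma psum_0 N : psum (fun _ => 0) N = 0.
Proof. induction N as [|N IH]; simpl; auto. rewrite IH. destruct (prime.prime N); ring. Qed.

Lemma psum_incr f a b : (a <= b)%nat ->
  (forall p, prime.prime p = true -> (a <= p < b)%nat -> 0 <= f p) -> psum f a <= psum f b.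
Proof.
  intros Hab H. assert (K := psum_incr_le (fun _ => 0) f a b Hab H). rewrite !psum_0 in K. lra.
Qed.

Lemma INR_pow2 m : INR (2 ^ m)%nat = 2 ^ m.
Proof. rewrite pow_INR. reflexivity. Qed.

Lemma ln_prime_pos p : prime.prime p = true -> 0 < ln (INR p).
Proof.
  intros H. apply INR_prime_ge_2 in H. rewrite <- ln_1. apply ln_increasing; lra.
Qed.

(** Chebyshev: every prime in [(m, 2 m]] divides the central binomial coefficient, which is at most
    [4^m]. *)
Lemma theta_block m : (0 < m)%nat ->
  psum (fun p => ln (INR p)) (m + m + 1) - psum (fun p => ln (INR p)) (m + 1) <= INR (m + m) * ln 2.
Proof.
  intros Hm. set (c := binomial.binomial (m + m) m).
  assert (P : is_true (ssrnat.leq 1 c)).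
  { unfold c. rewrite binomial.bin_gt0. apply ssrnat.leq_addr. }
  assert (Q : (c < c + (m + m) + 1)%nat) by lia.
  eapply Rle_trans; [|apply (ln_central_binomial m)].
  change (psum (fun p => ln (INR p)) (m + m + 1) - psum (fun p => ln (INR p)) (m + 1) <= ln (INR c)).
  (* The bound exceeds both [c], for the factorization, and [m + m], so that the range of primes in
     question is included. *)
  rewrite (ln_prime_decomp c (c + (m + m) + 1)); auto.
  2:{ apply (ssrbool.introT ssrnat.leP). lia. }
  set (f := fun p => INR (prime.logn p c) * ln (INR p)).
  assert (Hf : forall p, prime.prime p = true -> 0 <= f p).
  { intros p Hp. apply Rmult_le_pos; [apply pos_INR|]. left; now apply ln_prime_pos. }
  apply Rle_trans with (psum f (m + m + 1) - psum f (m + 1)).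
  - apply psum_incr_le; [lia|]. intros p Hp Hr.
    assert (L := prime_logn_central m p Hp).
    assert (L1 : is_true (ssrnat.leq 1 (prime.logn p c))).
    { apply L; apply (ssrbool.introT ssrnat.leP); change (ssrnat.addn m m) with (m + m)%nat; lia. }
    apply (ssrbool.elimT ssrnat.leP) in L1. apply le_INR in L1. simpl in L1.
    assert (G := ln_prime_pos p Hp). unfold f. nra.
  - assert (psum f (m + m + 1) <= psum f (c + (m + m) + 1)) by (apply psum_incr; auto; lia).
    assert (0 <= psum f (m + 1)).
    { change 0 with (psum f 0). apply psum_incr; auto; lia. }
    lra.
Qed.

(** Each doubling adds at most [2 * 2 ^ m * ln 2], and these gains form a geometric progression. *)
Lemma theta_dyadic m : psum (fun p => ln (INR p)) (2 ^ m + 1) <= 2 * 2 ^ m * ln 2.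
Proof.
  assert (L2 : 0 < ln 2) by (rewrite <- ln_1; apply ln_increasing; lra).
  induction m as [|m IH].
  - simpl. lra.
  - assert (H0 : (0 < 2 ^ m)%nat) by (apply Nat.neq_0_lt_0, Nat.pow_nonzero; lia).
    assert (H := theta_block (2 ^ m) H0).
    replace (2 ^ S m)%nat with (2 ^ m + 2 ^ m)%nat by (simpl; lia).
    rewrite plus_INR, INR_pow2 in H. simpl pow. lra.
Qed.


Lemma ln_1p_le x : -1 < x -> ln (1 + x) <= x.
Proof.
  intros Hx. rewrite <- (ln_exp x) at 2. apply ln_le; [lra|]. apply exp_ineq1_le.
Qed.

Lemma ln_succ_bounds x : 0 < x -> / (x + 1) <= ln (x + 1) - ln x <= / x.
Proof.
  intros Hx. assert (I0 : 0 < / x) by now apply Rinv_0_lt_compat.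
  assert (I1 : 0 < / (x + 1)) by (apply Rinv_0_lt_compat; lra). split.
  - assert (I : -1 < - / (x + 1)).
    { assert (/ (x + 1) < / 1) by (apply Rinv_lt_contravar; lra). lra. }
    assert (E := ln_1p_le (- / (x + 1)) I).
    replace (1 + - / (x + 1)) with (x * / (x + 1)) in E by (field; lra).
    rewrite ln_mult, ln_Rinv in E by lra. lra.
  - rewrite <- ln_div by lra. replace ((x + 1) / x) with (1 + / x) by (field; lra).
    apply ln_1p_le; lra.
Qed.

Lemma ln_fact_bounds n : (0 < n)%nat ->
  INR n * ln (INR n) - INR n <= ln (INR (ssrnat.factorial n)) <= INR n * ln (INR n).
Proof.
  induction n as [|n IH]; [lia|]. intros _.
  destruct n as [|n].
  - simpl. rewrite ln_1. lra.
  - specialize (IH ltac:(lia)). rewrite ssrnat.factS.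
    change (ssrnat.muln (S (S n)) (ssrnat.factorial (S n))) with (S (S n) * ssrnat.factorial (S n))%nat.
    assert (F : 0 < INR (ssrnat.factorial (S n))).
    { apply lt_0_INR. apply (ssrbool.elimT ssrnat.ltP). apply ssrnat.fact_gt0. }
    rewrite mult_INR, ln_mult by (first [exact F | apply lt_0_INR; apply Nat.lt_0_succ]).
    set (k := S n) in *. rewrite (S_INR k).
    assert (K : 0 < INR k) by (apply lt_0_INR; unfold k; lia).
    assert (M : ln (INR k) <= ln (INR k + 1)) by (apply ln_le; lra).
    destruct (ln_succ_bounds (INR k) K) as [_ N].
    assert (N' : INR k * (ln (INR k + 1) - ln (INR k)) <= 1).
    { apply Rle_trans with (INR k * / INR k); [apply Rmult_le_compat_l; lra|right; field; lra]. }
    nra.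
Qed.

(* [(ln n + 2) / n] telescopes above [ln n / (n (n - 1))]. *)
Lemma sum_ln_over_square N : (1 <= N)%nat ->
  psum (fun p => ln (INR p) / (INR p * (INR p - 1))) (N + 1) <= 2 - (ln (INR N) + 2) / INR N.
Proof.
  induction 1 as [|n Hn IH].
  - simpl. rewrite ln_1. lra.
  - replace (S n + 1)%nat with (S (n + 1)) by lia. replace (n + 1)%nat with (S n) in * by lia.
    set (f := fun p => ln (INR p) / (INR p * (INR p - 1))) in *.
    change (psum f (S (S n))) with (psum f (S n) + (if prime.prime (S n) then f (S n) else 0)).
    assert (K : 1 <= INR n) by (apply (le_INR 1); lia).
    assert (L0 : 0 <= ln (INR n + 1)) by (rewrite <- ln_1; apply ln_le; lra).
    assert (F : f (S n) <= (ln (INR n) + 2) / INR n - (ln (INR n + 1) + 2) / (INR n + 1)).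
    { unfold f. rewrite S_INR.
      replace ((ln (INR n) + 2) / INR n - (ln (INR n + 1) + 2) / (INR n + 1)) with
        (((INR n + 1) * (ln (INR n) - ln (INR n + 1)) + ln (INR n + 1) + 2) / ((INR n + 1) * (INR n + 1 - 1)))
        by (field; lra).
      apply Rmult_le_compat_r. { left. apply Rinv_0_lt_compat. nra. }
      destruct (ln_succ_bounds (INR n) ltac:(lra)) as [_ N].
      assert (N' : (INR n + 1) * (ln (INR n + 1) - ln (INR n)) <= (INR n + 1) * / INR n) by (apply Rmult_le_compat_l; lra).
      assert ((INR n + 1) * / INR n <= 2).
      { apply Rle_div_l; lra. }
      lra. }
    assert (F0 : 0 <= f (S n)).
    { unfold f. rewrite S_INR. apply Rmult_le_pos; auto. left; apply Rinv_0_lt_compat; nra. }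
    rewrite S_INR. destruct (prime.prime (S n)); lra.
Qed.

Lemma sum_ln_over_square_le N : psum (fun p => ln (INR p) / (INR p * (INR p - 1))) N <= 2.
Proof.
  apply Rle_trans with (psum (fun p => ln (INR p) / (INR p * (INR p - 1))) (N + 1 + 1)).
  - apply psum_incr; [lia|]. intros p Hp _. assert (G := ln_prime_pos p Hp). apply INR_prime_ge_2 in Hp.
    apply Rdiv_le_0_compat; [lra|nra].
  - eapply Rle_trans; [apply sum_ln_over_square; lia|].
    assert (1 <= INR (N + 1)) by (apply (le_INR 1); lia).
    assert (0 <= ln (INR (N + 1))) by (rewrite <- ln_1; apply ln_le; lra).
    assert (0 <= (ln (INR (N + 1)) + 2) / INR (N + 1)) by (apply Rdiv_le_0_compat; lra). lra.
Qed.

(** For [N = 2 ^ M], [ln N!] is [N ln N] up to [N], and also the sum of the valuations times [ln p],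
    which Legendre's formula compares with [N / p]. Rounding costs [theta N], of order [N] by
    Chebyshev; the higher powers cost at most [2 N]. Dividing by [N] leaves an error between [- 3]
    and [2 * ln 2], and excluding [p = N] costs at most 1 more. *)
Lemma Mertens_first_dyadic M :
  Rabs (psum (fun p => ln (INR p) / INR p) (2 ^ M) - INR M * ln 2) <= 4.
Proof.
  set (f := fun p => ln (INR p) / INR p).
  set (N := (2 ^ M)%nat).
  assert (N0 : (0 < N)%nat) by (apply Nat.neq_0_lt_0, Nat.pow_nonzero; lia).
  assert (N1 : 1 <= INR N) by (apply (le_INR 1); lia).
  assert (LN : ln (INR N) = INR M * ln 2) by (unfold N; rewrite INR_pow2, ln_pow; lra).
  assert (L2 : 0 < ln 2) by (rewrite <- ln_1; apply ln_increasing; lra).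
  assert (L21 : ln 2 <= 1).
  { rewrite <- (ln_exp 1). apply ln_le; [lra|]. assert (H := exp_ineq1_le 1). lra. }
  destruct (ln_fact_bounds N N0) as [B1 B2].
  set (F := ssrnat.factorial N) in *.
  assert (HF : is_true (ssrnat.leq 1 F)) by apply ssrnat.fact_gt0.
  assert (NF : (N <= F)%nat).
  { apply (ssrbool.elimT ssrnat.leP). apply ssrnat.fact_geq. }
  assert (D : ln (INR F) = psum (fun p => INR (prime.logn p F) * ln (INR p)) (N + 1)).
  { rewrite (ln_prime_decomp F (F + 1)); auto.
    2:{ apply (ssrbool.introT ssrnat.leP). lia. }
    assert (H : forall k, (N + 1 <= k)%nat -> psum (fun p => INR (prime.logn p F) * ln (INR p)) k
       = psum (fun p => INR (prime.logn p F) * ln (INR p)) (N + 1)).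
    { induction 1; auto. simpl. rewrite IHle. destruct (prime.prime m) eqn:E; [|ring].
      assert (H1 := prime_dvd_fact m N E).
      assert (Z : prime.logn m F = 0%nat).
      { rewrite prime.lognE. unfold F. rewrite E, H1.
        destruct (ssrnat.leq m N) eqn:El; [|now rewrite !Bool.andb_false_r].
        apply (ssrbool.elimT ssrnat.leP) in El. lia. }
      rewrite Z. simpl. ring. }
    apply H. lia. }
  assert (fpos : forall p, prime.prime p = true -> 0 <= f p <= 1).
  { intros p Hp. assert (G := ln_prime_pos p Hp). apply INR_prime_ge_2 in Hp.
    unfold f. split; [apply Rdiv_le_0_compat; lra|]. apply Rle_div_l; [lra|].
    assert (E := ln_1p_le (INR p - 1)). replace (1 + (INR p - 1)) with (INR p) in E by ring. lra. }
  assert (T : psum f N <= psum f (N + 1) <= psum f N + 1).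
  { replace (N + 1)%nat with (S N) by lia. simpl. destruct (prime.prime N) eqn:E; [|lra].
    specialize (fpos N E). lra. }
  assert (U : INR N * psum f (N + 1) - psum (fun p => ln (INR p)) (N + 1) <= ln (INR F)).
  { rewrite D, <- psum_scal.
    replace (psum (fun p => ln (INR p)) (N + 1)) with (- psum (fun p => -1 * ln (INR p)) (N + 1))
      by (rewrite psum_scal; ring).
    unfold Rminus. rewrite Ropp_involutive, <- psum_plus. apply psum_le.
    intros p Hp _. assert (G := ln_prime_pos p Hp). assert (K := logn_fact_lower p N Hp).
    apply INR_prime_ge_2 in Hp. unfold f.
    replace (INR N * (ln (INR p) / INR p) + -1 * ln (INR p)) with ((INR N / INR p - 1) * ln (INR p)) by (field; lra).
    apply Rmult_le_compat_r; auto. lra. }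
  assert (V : ln (INR F) <= INR N * (psum f (N + 1) + 2)).
  { apply Rle_trans with (INR N * (psum f (N + 1) + psum (fun p => ln (INR p) / (INR p * (INR p - 1))) (N + 1))).
    - rewrite D, <- psum_plus, <- psum_scal. apply psum_le.
      intros p Hp _. assert (G := ln_prime_pos p Hp). assert (K := logn_fact_upper p N Hp).
      apply INR_prime_ge_2 in Hp. unfold f.
      replace (INR N * (ln (INR p) / INR p + ln (INR p) / (INR p * (INR p - 1)))) with
        ((INR N / (INR p - 1)) * ln (INR p)) by (field; lra).
      apply Rmult_le_compat_r; auto. lra.
    - apply Rmult_le_compat_l; [lra|]. assert (H := sum_ln_over_square_le (N + 1)). lra. }
  assert (Th : psum (fun p => ln (INR p)) (N + 1) <= 2 * INR N * ln 2).
  { unfold N. rewrite INR_pow2. apply theta_dyadic. }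
  rewrite LN in *.
  assert (X1 : psum f (N + 1) <= INR M * ln 2 + 2 * ln 2).
  { apply Rmult_le_reg_l with (INR N); [lra|]. nra. }
  assert (X2 : INR M * ln 2 - 1 <= psum f (N + 1) + 2).
  { apply Rmult_le_reg_l with (INR N); [lra|]. nra. }
  apply Rabs_le. lra.
Qed.

(** On the primes [2 ^ m <= p < 2 ^ (m + 1)] the logarithm lies between [m * ln 2] and
    [(m + 1) * ln 2], so weights depending on [ln p] become weights depending on [m]. *)
Definition block (f : nat -> R) (m : nat) : R := psum f (2 ^ S m) - psum f (2 ^ m).

Lemma pow2_le_S m : (2 ^ m <= 2 ^ S m)%nat.
Proof. simpl; lia. Qed.

Lemma block_le f g m :
  (forall p, prime.prime p = true -> INR m * ln 2 <= ln (INR p) <= INR (S m) * ln 2 -> f p <= g p) ->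
  block f m <= block g m.
Proof.
  intros H. apply psum_incr_le; [apply pow2_le_S|]. intros p Hp Hr. apply H; auto.
  assert (P := INR_prime_ge_2 p Hp).
  assert (L : 2 ^ m <= INR p <= 2 ^ S m) by (rewrite <- !INR_pow2; split; apply le_INR; lia).
  assert (2 ^ m > 0) by (apply pow_lt; lra).
  rewrite <- !ln_pow by lra. split; apply ln_le; lra.
Qed.

Lemma block_scal c f m : block (fun p => c * f p) m = c * block f m.
Proof. unfold block. rewrite !psum_scal. ring. Qed.

Lemma block_plus f g m : block (fun p => f p + g p) m = block f m + block g m.
Proof. unfold block. rewrite !psum_plus. ring. Qed.

Lemma ln2_bounds : 1 / 2 <= ln 2 <= 1.
Proof.
  split.
  - assert (H := exp_ineq1_le (- (1/2))). rewrite exp_Ropp in H.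
    assert (E := exp_pos (1/2)).
    rewrite <- (ln_exp (1/2)). apply ln_le; auto.
    apply Rmult_le_reg_r with (/ exp (1/2)); [now apply Rinv_0_lt_compat|].
    rewrite Rinv_r by lra. lra.
  - rewrite <- (ln_exp 1). apply ln_le; [lra|]. assert (H := exp_ineq1_le 1). lra.
Qed.

(** Two errors of 4 from Mertens, plus [ln 2 <= 1]. *)
Lemma block_lnp_le m : block (fun p => ln (INR p) / INR p) m <= 9.
Proof.
  assert (H1 := Mertens_first_dyadic m). assert (H2 := Mertens_first_dyadic (S m)).
  apply Rabs_le_between in H1. apply Rabs_le_between in H2. rewrite S_INR in H2.
  assert (B := ln2_bounds). unfold block. lra.
Qed.

Lemma block_lnp_ge_0 m : 0 <= block (fun p => ln (INR p) / INR p) m.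
Proof.
  unfold block. assert (psum (fun p => ln (INR p) / INR p) (2 ^ m) <= psum (fun p => ln (INR p) / INR p) (2 ^ S m)); [|lra].
  apply psum_incr; [apply pow2_le_S|]. intros p Hp _. assert (G := ln_prime_pos p Hp).
  apply INR_prime_ge_2 in Hp. apply Rdiv_le_0_compat; lra.
Qed.

(** Writes [p^(s-1)] as [p^s / p] and inserts the factor [ln p / (m ln 2) >= 1], which brings in the
    bounded block sum of [ln p / p] and the saving [1 / m]. The maximum covers both signs of [s];
    [18] is [9 / ln 2] with [ln 2 >= 1 / 2]. *)
Lemma block_Rpower_le s m : (0 < m)%nat -> 
  block (fun p => Rpower (INR p) (s - 1)) m <= 18 * Rmax (exp (s * (INR m * ln 2))) (exp (s * (INR (S m) * ln 2))) / INR m.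
Proof.
  intros Hm. set (X := Rmax _ _).
  assert (M0 : 1 <= INR m) by (apply (le_INR 1); lia).
  assert (B := ln2_bounds).
  assert (X0 : 0 < X) by (eapply Rlt_le_trans; [apply exp_pos|apply Rmax_l]).
  apply Rle_trans with (block (fun p => (X / (INR m * ln 2)) * (ln (INR p) / INR p)) m).
  - apply block_le. intros p Hp [L1 L2]. apply INR_prime_ge_2 in Hp.
    unfold Rpower. replace ((s - 1) * ln (INR p)) with (s * ln (INR p) + - ln (INR p)) by ring.
    rewrite exp_plus, exp_Ropp, exp_ln by lra.
    replace (X / (INR m * ln 2) * (ln (INR p) / INR p)) with (X * (ln (INR p) / (INR m * ln 2)) * / INR p)
      by (field; repeat split; nra).
    apply Rmult_le_compat_r; [left; apply Rinv_0_lt_compat; lra|].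
    assert (EX : exp (s * ln (INR p)) <= X).
    { unfold X. destruct (Rle_lt_dec 0 s).
      - eapply Rle_trans; [|apply Rmax_r]. apply exp_le. apply Rmult_le_compat_l; lra.
      - eapply Rle_trans; [|apply Rmax_l]. apply exp_le.
        replace (s * ln (INR p)) with (- ((- s) * ln (INR p))) by ring.
        replace (s * (INR m * ln 2)) with (- ((- s) * (INR m * ln 2))) by ring.
        apply Ropp_le_contravar. apply Rmult_le_compat_l; lra. }
    assert (1 <= ln (INR p) / (INR m * ln 2)) by (apply Rle_div_r; nra).
    nra.
  - rewrite block_scal. assert (U := block_lnp_le m). assert (U0 := block_lnp_ge_0 m).
    apply Rle_trans with (X / (INR m * ln 2) * 9).
    + apply Rmult_le_compat_l; auto. apply Rdiv_le_0_compat; nra.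
    + replace (18 * X / INR m) with (X / (INR m * ln 2) * (18 * ln 2)) by (field; lra).
      apply Rmult_le_compat_l; [apply Rdiv_le_0_compat; nra|lra].
Qed.

(** * The third theorem of Mertens, upper bound *)

Lemma exp_INR_pow x m : exp (x * (INR m * ln 2)) = exp (x * ln 2) ^ m.
Proof.
  induction m as [|m IH]; [simpl; rewrite Rmult_0_l, Rmult_0_r; apply exp_0|].
  rewrite S_INR. simpl. rewrite <- IH, <- exp_plus. f_equal. ring.
Qed.

(** The blocks grow with ratio [r = 2^s], so the last one dominates and its saving [1 / M] is
    inherited by the whole sum. *)
Lemma psum_Rpower_le s : 0 < s -> exists K, 0 < K /\ forall M, (0 < M)%nat ->
  psum (fun p => Rpower (INR p) (s - 1)) (2 ^ M) <= K * exp (s * ln 2) ^ M / INR M.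
Proof.
  intros Hs. set (r := exp (s * ln 2)). assert (B := ln2_bounds).
  assert (Hr : 1 < r).
  { unfold r. assert (H := exp_ineq1_le (s * ln 2)). nra. }
  set (f := fun p => Rpower (INR p) (s - 1)).
  assert (fp : forall a b, (a <= b)%nat -> psum f a <= psum f b).
  { intros a b H. apply psum_incr; auto. intros. left. apply exp_pos. }
  (* Beyond [2 r / (r - 1)] the factor [r] exceeds [(M + 1) / M] by enough for the induction step
     from [M] to [M + 1]. *)
  destruct (nfloor_ex (2 * r / (r - 1))) as [M0 [_ HM0]].
  { apply Rdiv_le_0_compat; lra. }
  set (M1 := S M0). rewrite <- S_INR in HM0. fold M1 in HM0.
  (* The first entry makes the induction step work, the second covers all [M <= M1]. *)
  set (K := Rmax (36 * r / (r - 1)) (INR M1 * psum f (2 ^ M1))).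
  assert (K1 : 36 * r / (r - 1) <= K) by apply Rmax_l.
  assert (K2 : INR M1 * psum f (2 ^ M1) <= K) by apply Rmax_r.
  assert (K0 : 0 < K). { eapply Rlt_le_trans; [|exact K1]. apply Rdiv_lt_0_compat; lra. }
  exists K. split; auto. intros M HM.
  destruct (Nat.le_gt_cases M M1) as [L|L].
  - assert (I0 : 1 <= INR M) by (apply (le_INR 1); lia).
    assert (I1 : INR M <= INR M1) by (apply le_INR; auto).
    apply Rle_trans with (psum f (2 ^ M1)). { apply fp. apply Nat.pow_le_mono_r; lia. }
    apply Rle_div_r; [lra|].
    assert (P0 : 0 <= psum f (2 ^ M1)) by (apply (fp 0%nat); lia).
    assert (1 <= r ^ M) by (apply pow_R1_Rle; lra). nra.
  - assert (G : forall k, psum f (2 ^ (k + M1)) <= K * r ^ (k + M1) / INR (k + M1)).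
    { clear M HM L. induction k as [|k IH].
      - simpl (0 + M1)%nat. assert (I1 : 1 <= INR M1) by (apply (le_INR 1); unfold M1; lia).
        apply Rle_div_r; [lra|]. assert (1 <= r ^ M1) by (apply pow_R1_Rle; lra). nra.
      - set (M := (k + M1)%nat) in *. simpl (S k + M1)%nat. fold M.
        assert (BM := block_Rpower_le s M ltac:(unfold M, M1; lia)).
        unfold block in BM. fold f in BM.
        rewrite !exp_INR_pow in BM. fold r in BM.
        assert (PM : 0 < r ^ M) by (apply pow_lt; lra).
        rewrite Rmax_right in BM by (simpl; nra).
        assert (I0 : INR M1 <= INR M) by (apply le_INR; unfold M; lia).
        assert (I1 : 1 <= INR M1) by (apply (le_INR 1); unfold M1; lia).
        assert (Q : 2 * r < (r - 1) * (INR M + 1)).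
        { apply Rlt_div_l in HM0; [|lra]. nra. }
        apply Rle_trans with (K * r ^ M / INR M + 18 * r ^ S M / INR M); [lra|].
        rewrite S_INR. simpl (r ^ S M).
        apply Rle_div_r; [lra|].
        replace ((K * r ^ M / INR M + 18 * (r * r ^ M) / INR M) * (INR M + 1)) with
          (r ^ M * ((K + 18 * r) * (INR M + 1) / INR M)) by (field; lra).
        replace (K * (r * r ^ M)) with (r ^ M * (K * r)) by ring.
        apply Rmult_le_compat_l; [lra|]. apply Rle_div_l; [lra|].
        assert (K3 : 36 * r <= K * (r - 1)) by (apply Rle_div_l in K1; lra).
        assert (2 * (r * INR M - INR M - 1) >= (r - 1) * (INR M + 1)) by nra.
        assert (K * (r * INR M - INR M - 1) >= K * ((r - 1) * (INR M + 1) / 2)) by (apply Rmult_ge_compat_l; lra).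
        assert (K * (r - 1) * (INR M + 1) >= 36 * r * (INR M + 1)) by (apply Rmult_ge_compat_r; lra). nra. }
    specialize (G (M - M1)%nat). replace (M - M1 + M1)%nat with M in G by lia. exact G.
Qed.

(** Here the blocks decay geometrically and the first dominates; [/ INR (k + M)] is replaced by
    [/ INR M]. An arbitrary end [N] is covered by a power of 2. *)
Lemma psum_Rpower_tail b : 0 < b -> exists K, 0 < K /\ forall M N, (0 < M)%nat ->
  psum (fun p => Rpower (INR p) (- b - 1)) N - psum (fun p => Rpower (INR p) (- b - 1)) (2 ^ M)
    <= K * exp (- b * ln 2) ^ M / INR M.
Proof.
  intros Hb. set (r := exp (- b * ln 2)). assert (B := ln2_bounds).
  assert (Hr : 0 < r < 1).
  { split; [apply exp_pos|]. unfold r. rewrite <- exp_0. apply exp_increasing. nra. }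
  set (f := fun p => Rpower (INR p) (- b - 1)).
  assert (fp : forall a b, (a <= b)%nat -> psum f a <= psum f b).
  { intros a c H. apply psum_incr; auto. intros. left. apply exp_pos. }
  exists (18 / (1 - r)). split; [apply Rdiv_lt_0_compat; lra|]. intros M N HM.
  assert (I0 : 1 <= INR M) by (apply (le_INR 1); lia).
  assert (PM : forall k, 0 < r ^ k) by (intros; apply pow_lt; lra).
  assert (G : forall k, psum f (2 ^ (k + M)) - psum f (2 ^ M) <= 18 / (1 - r) * (r ^ M - r ^ (k + M)) / INR M).
  { induction k as [|k IH].
    - simpl (0 + M)%nat. rewrite !Rminus_diag. unfold Rdiv. rewrite Rmult_0_r, Rmult_0_l. lra.
    - assert (BM := block_Rpower_le (- b) (k + M) ltac:(lia)).
      unfold block in BM. fold f in BM.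
      rewrite !exp_INR_pow in BM. fold r in BM. simpl (S k + M)%nat.
      assert (P := PM (k + M)%nat).
      rewrite Rmax_left in BM by (simpl; nra).
      assert (I1 : INR M <= INR (k + M)) by (apply le_INR; lia).
      assert (18 * r ^ (k + M) / INR (k + M) <= 18 * r ^ (k + M) / INR M).
      { apply Rmult_le_compat_l; [lra|]. apply Rinv_le_contravar; lra. }
      replace (18 / (1 - r) * (r ^ M - r ^ S (k + M)) / INR M) with
        (18 / (1 - r) * (r ^ M - r ^ (k + M)) / INR M + 18 * r ^ (k + M) / INR M)
        by (simpl; field; lra).
      lra. }
  destruct (Nat.le_gt_cases N (2 ^ M)) as [L|L].
  - apply Rle_trans with 0; [specialize (fp N _ L); lra|].
    specialize (PM M). apply Rdiv_le_0_compat; [|lra]. apply Rmult_le_pos; [|lra].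
    apply Rdiv_le_0_compat; lra.
  - assert (N2 : (N <= 2 ^ (N + M))%nat).
    { apply Nat.le_trans with (2 ^ N)%nat; [|apply Nat.pow_le_mono_r; lia].
      apply Nat.lt_le_incl, Nat.pow_gt_lin_r. lia. }
    apply fp in N2. specialize (G N). assert (P := PM (N + M)%nat).
    eapply Rle_trans; [|eapply Rle_trans; [exact G|]]; [lra|].
    apply Rmult_le_compat_r; [left; apply Rinv_0_lt_compat; lra|].
    apply Rmult_le_compat_l; [apply Rdiv_le_0_compat; lra|lra].
Qed.

Lemma is_lim_seq_inv_S : is_lim_seq (fun n => / INR (S n)) 0.
Proof.
  apply (is_lim_seq_incr_1 (fun n => / INR n)). apply is_lim_seq_spec. intros d.
  destruct (archimed_cor1 d (cond_pos d)) as [N [HN H0]]. exists N. intros n Hn.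
  assert (0 < INR N) by (apply lt_0_INR; auto).
  assert (INR N <= INR n) by (apply le_INR; auto).
  rewrite Rminus_0_r, Rabs_pos_eq by (left; apply Rinv_0_lt_compat; lra).
  eapply Rle_lt_trans; [|exact HN]. apply Rinv_le_contravar; auto.
Qed.

(** * Real partial sums and a convergence test *)

Fixpoint rsum (f : nat -> R) (N : nat) : R :=
  match N with O => 0 | S n => rsum f n + f n end.

Lemma rsum_ext f g N : (forall n, (n < N)%nat -> f n = g n) -> rsum f N = rsum g N.
Proof. induction N; intros H; simpl; auto. rewrite IHN, H; auto. Qed.

Lemma rsum_le f g N : (forall n, (n < N)%nat -> f n <= g n) -> rsum f N <= rsum g N.
Proof.
  induction N; intros H; simpl; [lra|]. assert (H1 := H N ltac:(lia)).
  assert (rsum f N <= rsum g N) by (apply IHN; auto). lra.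
Qed.

Lemma rsum_plus f g N : rsum (fun n => f n + g n) N = rsum f N + rsum g N.
Proof. induction N; simpl; [ring|]. rewrite IHN. ring. Qed.

Lemma rsum_scal c f N : rsum (fun n => c * f n) N = c * rsum f N.
Proof. induction N; simpl; [ring|]. rewrite IHN. ring. Qed.

Lemma rsum_block f M : rsum (block f) M = psum f (2 ^ M).
Proof.
  induction M.
  - simpl. ring.
  - simpl rsum. rewrite IHM. unfold block. ring.
Qed.

Lemma rsum_tele w N : rsum (fun m => w m - w (S m)) N = w O - w N.
Proof. induction N; simpl; [ring|]. rewrite IHN. ring. Qed.

Lemma monotone_bounded_cv (u : nat -> R) (B : R) :
  (forall n, u n <= u (S n)) -> (forall n, u n <= B) -> exists l, is_lim_seq u (Finite l).
Proof.
  intros H1 H2. destruct (ex_finite_lim_seq_incr u B H1 H2) as [l Hl]. now exists l.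
Qed.

Lemma summation_by_parts V w N :
  rsum (fun m => (V (S m) - V m) * w m) N =
  V N * w N - V O * w O + rsum (fun m => V (S m) * (w m - w (S m))) N.
Proof. induction N; simpl; [ring|]. rewrite IHN. ring. Qed.

(** After summation by parts, adding [B] to [V] makes all terms nonnegative and at most [2 * B]
    times a telescoping sum; the added part telescopes as well. *)
Lemma Dirichlet_test (V w : nat -> R) (B : R) :
  (forall n, Rabs (V n) <= B) -> (forall n, w (S n) <= w n) -> is_lim_seq w 0 ->
  exists l, is_lim_seq (rsum (fun m => (V (S m) - V m) * w m)) (Finite l).
Proof.
  intros HV Hw Hw0.
  assert (w0 : forall n, 0 <= w n).
  { intros n. apply (is_lim_seq_decr_compare w 0); auto. }
  destruct (monotone_bounded_cv (rsum (fun m => (V (S m) + B) * (w m - w (S m)))) (2 * B * w O)) as [l Hl].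
  - intros n. simpl. specialize (HV (S n)). apply Rabs_le_between in HV. specialize (Hw n).
    assert (0 <= (V (S n) + B) * (w n - w (S n))) by (apply Rmult_le_pos; lra). lra.
  - intros n. apply Rle_trans with (rsum (fun m => 2 * B * (w m - w (S m))) n).
    + apply rsum_le. intros m _. specialize (HV (S m)). apply Rabs_le_between in HV. specialize (Hw m).
      apply Rmult_le_compat_r; lra.
    + rewrite (rsum_scal (2 * B) (fun m => w m - w (S m))), rsum_tele. specialize (w0 n).
      assert (0 <= B) by (eapply Rle_trans; [apply Rabs_pos|apply (HV O)]). nra.
  - exists (0 - V O * w O + (l - B * (w O - 0))).
    apply is_lim_seq_ext with (fun N => (V N * w N - V O * w O) +
      (rsum (fun m => (V (S m) + B) * (w m - w (S m))) N - B * (w O - w N))).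
    { intros N. rewrite summation_by_parts. f_equal.
      rewrite <- rsum_tele, <- (rsum_scal B (fun m => w m - w (S m))).
      rewrite (rsum_ext (fun m => (V (S m) + B) * (w m - w (S m)))
        (fun m => V (S m) * (w m - w (S m)) + B * (w m - w (S m)))) by (intros; ring).
      rewrite rsum_plus. ring. }
    assert (VW : is_lim_seq (fun N => V N * w N) 0).
    { apply is_lim_seq_abs_0. apply is_lim_seq_le_le with (fun _ => 0) (fun n => B * w n).
      - intros n. split; [apply Rabs_pos|]. rewrite Rabs_mult, (Rabs_pos_eq (w n)) by auto.
        apply Rmult_le_compat_r; auto.
      - apply is_lim_seq_const.
      - replace (Finite 0) with (Rbar_mult B 0) by (simpl; f_equal; ring).
        now apply is_lim_seq_scal_l. }
    apply is_lim_seq_plus'; [apply is_lim_seq_minus'; [auto|apply is_lim_seq_const]|].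
    apply is_lim_seq_minus'; auto. apply (is_lim_seq_scal_l _ B (w O - 0)).
    apply is_lim_seq_minus'; auto. apply is_lim_seq_const.
Qed.

Definition mertens_term (p : nat) : R := - ln (1 - / INR p).

Lemma mertens_term_bounds p : prime.prime p = true ->
  / INR p <= mertens_term p <= / INR p + / (INR p * (INR p - 1)).
Proof.
  intros Hp. apply INR_prime_ge_2 in Hp. unfold mertens_term.
  assert (I : / INR p <= / 2) by (apply Rinv_le_contravar; lra).
  assert (I0 : 0 < / INR p) by (apply Rinv_0_lt_compat; lra).
  split.
  - assert (H := ln_1p_le (- / INR p) ltac:(lra)). unfold Rminus. lra.
  - assert (E : - ln (1 - / INR p) = ln (1 + / (INR p - 1))).
    { rewrite <- ln_Rinv by lra. f_equal. field. lra. }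
    rewrite E. assert (I1 : 0 < / (INR p - 1)) by (apply Rinv_0_lt_compat; lra).
    replace (/ INR p + / (INR p * (INR p - 1))) with (/ (INR p - 1)) by (field; lra).
    apply ln_1p_le; lra.
Qed.

Lemma psum_inv_square_le N : psum (fun p => / (INR p * (INR p - 1))) N <= 4.
Proof.
  apply Rle_trans with (psum (fun p => 2 * (ln (INR p) / (INR p * (INR p - 1)))) N).
  - apply psum_le. intros p Hp _. apply INR_prime_ge_2 in Hp. assert (B := ln2_bounds).
    assert (L : ln 2 <= ln (INR p)) by (apply ln_le; lra).
    assert (0 < / (INR p * (INR p - 1))) by (apply Rinv_0_lt_compat; nra).
    unfold Rdiv. nra.
  - rewrite psum_scal. assert (H := sum_ln_over_square_le N). lra.
Qed.

(** On block [m] replace [ln p] by [(m + 1) ln 2]. The resulting errors are nonnegative and bounded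
    by a telescoping sum, because [ln p >= m ln 2], plus the convergent sum of [1 / (p (p - 1))].
    What remains is the bounded error of Mertens' first theorem, differenced and weighted by
    [1 / (m + 1)], to which the Dirichlet test applies. *)
Lemma mertens_converges :
  exists c, is_lim_seq (fun M => psum mertens_term (2 ^ M) - rsum (fun m => / INR (S m)) M) (Finite c).
Proof.
  set (g := fun p => ln (INR p) / INR p). assert (B := ln2_bounds).
  set (w := fun m => / INR (S m)).
  assert (W : forall m, 0 < w m) by (intros; apply Rinv_0_lt_compat, lt_0_INR; lia).
  assert (Wd : forall m, w (S m) <= w m).
  { intros m. apply Rinv_le_contravar; [apply lt_0_INR; lia|apply le_INR; lia]. }
  assert (W0 : is_lim_seq w 0) by apply is_lim_seq_inv_S.
  set (A := fun m => block mertens_term m - block g m * (w m / ln 2)).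
  (* [A m] is the error of replacing [-ln (1 - 1/p)] by [ln p / (p (m+1) ln 2)] on the block [m]. *)
  assert (HA : forall m, 0 <= A m <= block (fun p => / (INR p * (INR p - 1))) m + (9 / ln 2) * (w (pred m) - w m)).
  { intros m. unfold A. assert (Wm := W m). assert (U9 := block_lnp_le m). assert (U0 := block_lnp_ge_0 m).
    fold g in U9, U0.
    assert (WE : w m * (INR m + 1) = 1) by (unfold w; rewrite S_INR; field; rewrite <- S_INR; apply not_0_INR; lia).
    assert (Wl : 0 < w m / ln 2) by (apply Rdiv_lt_0_compat; lra). split.
    - assert (H : block (fun p => (w m / ln 2) * g p) m <= block mertens_term m).
      { apply block_le. intros p Hp [L1 L2]. rewrite S_INR in L2. assert (T := mertens_term_bounds p Hp).
        apply INR_prime_ge_2 in Hp. eapply Rle_trans; [|apply T]. unfold g.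
        replace (w m / ln 2 * (ln (INR p) / INR p)) with ((w m * ln (INR p) / ln 2) * / INR p) by (field; lra).
        rewrite <- (Rmult_1_l (/ INR p)) at 2. apply Rmult_le_compat_r; [left; apply Rinv_0_lt_compat; lra|].
        apply Rle_div_l; [lra|]. nra. }
      rewrite block_scal in H. lra.
    (* Block 0 contains only the number 1 and no prime, so the value of [pred] at 0 does no harm. *)
    - destruct m as [|m].
      + assert (Z : forall f, block f 0 = 0).
        { intros f. unfold block. simpl. ring. }
        rewrite !Z. simpl pred. lra.
      + assert (H : block mertens_term (S m) <= block (fun p => / (INR p * (INR p - 1)) + (w m / ln 2) * g p) (S m)).
        { apply block_le. intros p Hp [L1 L2]. assert (T := mertens_term_bounds p Hp).
          apply INR_prime_ge_2 in Hp. eapply Rle_trans; [apply T|]. rewrite Rplus_comm.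
          apply Rplus_le_compat_l. unfold g.
          replace (w m / ln 2 * (ln (INR p) / INR p)) with ((w m * ln (INR p) / ln 2) * / INR p) by (field; lra).
          rewrite <- (Rmult_1_l (/ INR p)) at 1. apply Rmult_le_compat_r; [left; apply Rinv_0_lt_compat; lra|].
          apply Rle_div_r; [lra|].
          assert (WE' : w m * INR (S m) = 1) by (unfold w; field; apply not_0_INR; lia).
          assert (W' := W m). nra. }
        rewrite block_plus, block_scal in H. simpl pred.
        assert (D : (w m - w (S m)) / ln 2 * block g (S m) <= (w m - w (S m)) / ln 2 * 9).
        { apply Rmult_le_compat_l; auto. specialize (Wd m). apply Rdiv_le_0_compat; lra. }
        replace (9 / ln 2 * (w m - w (S m))) with ((w m - w (S m)) / ln 2 * 9) by (field; lra).
        replace (block g (S m) * (w (S m) / ln 2)) with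
          (w m / ln 2 * block g (S m) - (w m - w (S m)) / ln 2 * block g (S m)) by (field; lra).
        lra. }
  destruct (monotone_bounded_cv (rsum A) (4 + 9 / ln 2 * 1)) as [l1 Hl1].
  { intros n. simpl. specialize (HA n). lra. }
  { intros n. eapply Rle_trans; [apply rsum_le; intros m _; apply HA|].
    rewrite rsum_plus, rsum_block, rsum_scal. apply Rplus_le_compat; [apply psum_inv_square_le|].
    apply Rmult_le_compat_l; [apply Rdiv_le_0_compat; lra|].
    assert (T : forall k, rsum (fun m => w (pred m) - w m) (S k) = 1 - w k).
    { induction k; [simpl; unfold w; simpl; field|]. simpl in *. rewrite IHk. ring. }
    destruct n; [simpl; lra|]. rewrite T. specialize (W n). lra. }
  destruct (Dirichlet_test (fun M => psum g (2 ^ M) - INR M * ln 2) w 4) as [l2 Hl2]; auto.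
  { intros n. apply Mertens_first_dyadic. }
  exists (l1 + / ln 2 * l2).
  apply is_lim_seq_ext with (fun M => rsum A M + / ln 2 * rsum (fun m =>
    (psum g (2 ^ S m) - INR (S m) * ln 2 - (psum g (2 ^ m) - INR m * ln 2)) * w m) M).
  - intros M. rewrite <- rsum_block, <- rsum_scal, <- rsum_plus.
    replace (rsum (block mertens_term) M - rsum w M) with
      (rsum (block mertens_term) M + -1 * rsum w M) by ring.
    rewrite <- rsum_scal, <- rsum_plus. apply rsum_ext. intros m _.
    unfold A, block. rewrite S_INR. field. lra.
  - apply is_lim_seq_plus'; auto. apply (is_lim_seq_scal_l _ (/ ln 2) l2). exact Hl2.
Qed.

(** The difference between the logarithm and its Taylor polynomial has derivative [y ^ M / (1 - y)];
    apply the mean value theorem on [[0, x]]. *)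
Lemma log_series_lower x M : 0 < x < 1 ->
  - ln (1 - x) - x ^ M / (1 - x) <= rsum (fun m => x ^ S m / INR (S m)) M.
Proof.
  intros Hx.
  assert (D : forall y, is_derive (fun y => rsum (fun m => y ^ S m / INR (S m)) M) y (rsum (fun m => y ^ m) M)).
  { intros y. induction M as [|M IH]; [simpl; apply @is_derive_const|].
    cbn [rsum]. apply @is_derive_plus; [exact IH|].
    assert (N : INR (S M) <> 0) by (apply not_0_INR; lia).
    apply is_derive_ext with (fun y => y ^ S M * / INR (S M)); [reflexivity|].
    auto_derive; auto. simpl pred. change (match M with O => 1 | S _ => INR M + 1 end) with (INR (S M)). field. auto. }
  assert (G : forall y, y < 1 -> rsum (fun m => y ^ m) M = (1 - y ^ M) / (1 - y)).
  { intros y Hy. clear D. induction M as [|M IH]; [simpl; field; lra|]. cbn [rsum]. rewrite IH. simpl. field. lra. }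
  destruct (MVT_gen (fun y => - ln (1 - y) - rsum (fun m => y ^ S m / INR (S m)) M) 0 x
    (fun y => y ^ M / (1 - y))) as [z [Hz E]].
  - intros y. rewrite Rmin_left, Rmax_right by lra. intros Hy.
    replace (y ^ M / (1 - y)) with (/ (1 - y) - rsum (fun m => y ^ m) M) by (rewrite G by lra; field; lra).
    apply @is_derive_minus; [|apply D]. auto_derive; lra || (field; lra).
  - intros y. rewrite Rmin_left, Rmax_right by lra. intros Hy.
    apply continuity_pt_filterlim, (ex_derive_continuous (fun y => - ln (1 - y) - rsum (fun m => y ^ S m / INR (S m)) M)).
    eexists. apply @is_derive_minus; [|apply D]. auto_derive; [lra|reflexivity].
  - rewrite Rmin_left, Rmax_right in Hz by lra.
    assert (Z0 : rsum (fun m => 0 ^ S m / INR (S m)) M = 0).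
    { transitivity (rsum (fun _ => 0 * 0) M); [apply rsum_ext; intros; rewrite pow_i by lia; unfold Rdiv; ring|]. rewrite (rsum_scal 0 (fun _ => 0)). ring. }
    cbv beta in E. rewrite Z0, !Rminus_0_r, ln_1, Ropp_0, Rminus_0_r in E.
    assert (L : z ^ M / (1 - z) * x <= x ^ M / (1 - x)).
    { assert (P : 0 <= z ^ M) by (apply pow_le; lra).
      assert (Q : z ^ M <= x ^ M) by (apply pow_incr; lra).
      assert (I : / (1 - z) <= / (1 - x)) by (apply Rinv_le_contravar; lra).
      assert (I0 : 0 < / (1 - z)) by (apply Rinv_0_lt_compat; lra).
      unfold Rdiv. assert (z ^ M * / (1 - z) <= x ^ M * / (1 - x)) by (apply Rmult_le_compat; lra).
      assert (0 <= z ^ M * / (1 - z)) by (apply Rmult_le_pos; lra). nra. }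
    lra.
Qed.

(** The linear terms in [y] agree and cancel, so the defect is quadratic. It turns a weighted
    logarithm of an Euler factor at exponent 1 into that of a factor at exponent [1 + eta]. *)
Lemma convexity_defect l y : 0 <= l <= 1 -> 0 < y <= 1 / 2 ->
  l * - ln (1 - y) <= - ln (1 - l * y) + 2 * (1 - l) * (y * y).
Proof.
  intros Hl Hy.
  assert (A : ln (1 - l * y) - ln (1 - y) <= (1 - l) * y / (1 - y)).
  { rewrite <- ln_div by nra. replace ((1 - l * y) / (1 - y)) with (1 + (1 - l) * y / (1 - y)) by (field; lra).
    apply ln_1p_le. assert (0 <= (1 - l) * y / (1 - y)); [|lra]. apply Rdiv_le_0_compat; nra. }
  assert (B : ln (1 - y) <= - y) by (apply (ln_1p_le (- y)); lra).
  assert (C : y / (1 - y) <= y + 2 * (y * y)).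
  { apply Rle_div_l; [lra|]. assert (0 <= y * y * (1 - 2 * y)) by (apply Rmult_le_pos; nra). nra. }
  replace ((1 - l) * y / (1 - y)) with ((1 - l) * (y / (1 - y))) in A by (field; lra).
  assert ((1 - l) * (y / (1 - y)) <= (1 - l) * (y + 2 * (y * y))) by (apply Rmult_le_compat_l; lra).
  assert ((1 - l) * ln (1 - y) <= (1 - l) * (- y)) by (apply Rmult_le_compat_l; lra).
  lra.
Qed.

Lemma abel_upper eta M : 0 < eta <= 1 ->
  (forall N, psum (fun p => - ln (1 - Rpower (INR p) (- (1 + eta)))) N <= ln (1 + / eta)) ->
  rsum (fun m => exp (- eta * ln 2) ^ S m * (block mertens_term m - / INR (S m))) M
    <= ln (ln 2) + 9 * eta + exp (- eta * ln 2) ^ M / (1 - exp (- eta * ln 2)).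
Proof.
  intros He HZ. set (x := exp (- eta * ln 2)). assert (B := ln2_bounds).
  assert (Hx : 0 < x < 1).
  { split; [apply exp_pos|]. unfold x. rewrite <- exp_0. apply exp_increasing. nra. }
  assert (S1 : rsum (fun m => x ^ S m * block mertens_term m) M <= ln (1 + / eta) + 8 * eta).
  { apply Rle_trans with (rsum (block (fun p => - ln (1 - Rpower (INR p) (- (1 + eta)))
      + 4 * eta * (ln (INR p) / (INR p * (INR p - 1))))) M).
    - apply rsum_le. intros m _. rewrite <- block_scal. apply block_le. intros p Hp [L1 L2].
      apply INR_prime_ge_2 in Hp. unfold mertens_term.
      assert (I : / INR p <= / 2) by (apply Rinv_le_contravar; lra).
      assert (I0 : 0 < / INR p) by (apply Rinv_0_lt_compat; lra).
      assert (Lp : ln 2 <= ln (INR p)) by (apply ln_le; lra).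
      unfold x. rewrite <- exp_INR_pow. set (l := exp (- eta * (INR (S m) * ln 2))).
      assert (E1 : Rpower (INR p) (- (1 + eta)) = exp (- eta * ln (INR p)) * / INR p).
      { unfold Rpower. replace (- (1 + eta) * ln (INR p)) with (- eta * ln (INR p) + - ln (INR p)) by ring.
        rewrite exp_plus, exp_Ropp, exp_ln by lra. reflexivity. }
      rewrite E1. set (l' := exp (- eta * ln (INR p))).
      assert (Hll : l <= l') by (apply exp_le; nra).
      assert (l0 : 0 < l) by apply exp_pos.
      assert (l1 : l' <= 1) by (unfold l'; rewrite <- exp_0; apply exp_le; nra).
      assert (l2 : 1 - l <= eta * (2 * ln (INR p))).
      { assert (H := exp_ineq1_le (- eta * (INR (S m) * ln 2))). fold l in H.
        rewrite S_INR in H. nra. }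
      assert (Cd := convexity_defect l (/ INR p) ltac:(lra) ltac:(lra)).
      assert (Mon : - ln (1 - l * / INR p) <= - ln (1 - l' * / INR p)).
      { apply Ropp_le_contravar, ln_le; nra. }
      assert (Sq : / INR p * / INR p <= / (INR p * (INR p - 1))).
      { rewrite <- Rinv_mult. apply Rinv_le_contravar; nra. }
      assert (2 * (1 - l) * (/ INR p * / INR p) <= 4 * eta * (ln (INR p) / (INR p * (INR p - 1)))).
      { unfold Rdiv. replace (4 * eta * (ln (INR p) * / (INR p * (INR p - 1)))) with
          (2 * (eta * (2 * ln (INR p))) * / (INR p * (INR p - 1))) by ring.
        apply Rmult_le_compat; nra. }
      lra.
    - rewrite rsum_block, psum_plus, psum_scal. specialize (HZ (2 ^ M)%nat).
      assert (H := sum_ln_over_square_le (2 ^ M)). nra. }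
  assert (S2 := log_series_lower x M Hx).
  assert (S3 : rsum (fun m => x ^ S m * (block mertens_term m - / INR (S m))) M =
    rsum (fun m => x ^ S m * block mertens_term m) M + -1 * rsum (fun m => x ^ S m / INR (S m)) M).
  { rewrite <- rsum_scal, <- rsum_plus. apply rsum_ext. intros. unfold Rdiv. ring. }
  assert (S4 : ln (1 - x) <= ln (ln 2) + ln eta).
  { rewrite <- ln_mult by lra. apply ln_le; [lra|]. assert (H := exp_ineq1_le (- eta * ln 2)). fold x in H. lra. }
  assert (S5 : ln (1 + / eta) + ln eta <= eta).
  { rewrite <- ln_mult; [|assert (0 < / eta) by (apply Rinv_0_lt_compat; lra); lra|lra].
    replace ((1 + / eta) * eta) with (1 + eta) by (field; lra). apply ln_1p_le. lra. }
  lra.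
Qed.

(* As [M] grows, the partial sums of [block mertens_term m - 1/(m+1)] converge to some [c].  Abel's
   theorem at [x = 2^-eta], [eta -> 0], gives [c <= ln ln 2]: the first series sums to about
   [ln zeta(1 + eta)] and the harmonic one to [- ln (1 - x)].  So Euler's constant only enters through
   harmonic numbers. *)
Lemma Mertens_third_upper :
  (forall eta, 0 < eta <= 1 -> forall N,
    psum (fun p => - ln (1 - Rpower (INR p) (- (1 + eta)))) N <= ln (1 + / eta)) ->
  forall eps, 0 < eps -> exists M0, forall M, (M0 <= M)%nat ->
    psum mertens_term (2 ^ M) - rsum (fun m => / INR (S m)) M <= ln (ln 2) + eps.
Proof.
  intros HZ eps Heps.
  destruct mertens_converges as [c Hc].
  set (D := fun M => psum mertens_term (2 ^ M) - rsum (fun m => / INR (S m)) M) in *.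
  assert (HD : forall e, 0 < e -> exists M0, forall M, (M0 <= M)%nat -> Rabs (D M - c) < e).
  { intros e He. apply is_lim_seq_spec in Hc. destruct (Hc (mkposreal e He)) as [M0 H]. now exists M0. }
  (* The head of the Abel sum needs a lower bound for every [M], not only in the limit. *)
  assert (HDb : exists B, 0 <= B /\ forall M, - B <= D M).
  { destruct (HD 1 Rlt_0_1) as [M0 H0].
    assert (F : forall n, exists B, 0 <= B /\ forall M, (M < n)%nat -> - B <= D M).
    { induction n as [|n [B [B0 HB]]]; [exists 0; split; [lra|intros; lia]|].
      exists (B + Rabs (D n)). assert (P := Rabs_pos (D n)). split; [lra|]. intros M HM.
      destruct (Nat.eq_dec M n) as [->|]; [assert (Q := Rabs_maj2 (D n)); lra|].
      specialize (HB M ltac:(lia)). lra. }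
    destruct (F M0) as [B [B0 HB]]. exists (B + Rabs c + 1).
    assert (P := Rabs_pos c). split; [lra|]. intros M.
    destruct (Nat.lt_ge_cases M M0) as [L|L]; [specialize (HB M L); lra|].
    specialize (H0 M L). apply Rabs_lt_between in H0. assert (Q := Rabs_maj2 c). lra. }
  destruct HDb as [B [B0 HB]].
  assert (Key : forall e, 0 < e -> c - e <= ln (ln 2)).
  { intros e He. destruct (HD e He) as [M0 HM0].
    assert (K1 : forall eta, 0 < eta <= 1 ->
      (c - e) * exp (- eta * ln 2) ^ M0 - B * (1 - exp (- eta * ln 2) ^ M0) <= ln (ln 2) + 9 * eta).
    { intros eta Heta. set (x := exp (- eta * ln 2)). assert (BB := ln2_bounds).
      assert (Hx : 0 < x < 1).
      { split; [apply exp_pos|]. unfold x. rewrite <- exp_0. apply exp_increasing. nra. }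
      assert (K2 : forall M, (M0 <= M)%nat ->
        (c - e) * (x ^ M0 - x ^ M) - B * (1 - x ^ M0) - B * x ^ M <= ln (ln 2) + 9 * eta + x ^ M / (1 - x)).
      { intros M HM. eapply Rle_trans; [|apply (abel_upper eta M Heta (HZ eta Heta))]. fold x.
        (* Summation by parts: each summand is [D (m + 1) - D m] with weight [x ^ (m + 1)]. *)
        assert (E : forall N, rsum (fun m => x ^ S m * (block mertens_term m - / INR (S m))) N =
          x ^ N * D N + rsum (fun m => D m * (x ^ m - x ^ S m)) N).
        { induction N as [|N IH].
          - unfold D. simpl. ring.
          - cbn [rsum]. rewrite IH. unfold D, block. cbn [rsum]. simpl pow. ring. }
        rewrite E.
        (* Below [M0] only [D m >= - B] is available, beyond it [D m > c - e]; both weights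
           telescope. *)
        assert (G : (c - e) * (x ^ M0 - x ^ M) - B * (1 - x ^ M0) <= rsum (fun m => D m * (x ^ m - x ^ S m)) M).
        { assert (Dx : forall m, 0 <= x ^ m - x ^ S m).
          { intros m. assert (0 < x ^ m) by (apply pow_lt; lra). simpl. nra. }
          induction HM as [|M HM IH].
          - rewrite Rminus_diag, Rmult_0_r.
            apply Rle_trans with (rsum (fun m => - B * (x ^ m - x ^ S m)) M0).
            + rewrite (rsum_scal (- B) (fun m => x ^ m - x ^ S m)), (rsum_tele (fun m => x ^ m)). simpl. lra.
            + apply rsum_le. intros m _. apply Rmult_le_compat_r; auto.
          - cbn [rsum]. specialize (HM0 M HM). apply Rabs_lt_between in HM0. specialize (Dx M).
            assert ((c - e) * (x ^ M - x ^ S M) <= D M * (x ^ M - x ^ S M)) by (apply Rmult_le_compat_r; lra).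
            lra. }
        assert (0 < x ^ M) by (apply pow_lt; lra). specialize (HB M). nra. }
      assert (X : is_lim_seq (fun M => x ^ M) 0) by (apply is_lim_seq_geom; rewrite Rabs_pos_eq; lra).
      assert (Lf : is_lim_seq (fun M => (c - e) * (x ^ M0 - x ^ M) - B * (1 - x ^ M0) - B * x ^ M)
        ((c - e) * (x ^ M0 - 0) - B * (1 - x ^ M0) - B * 0)).
      { apply is_lim_seq_minus'; [apply is_lim_seq_minus'; [|apply is_lim_seq_const]|];
          [apply (is_lim_seq_scal_l _ _ (x ^ M0 - 0)), is_lim_seq_minus'; auto; apply is_lim_seq_const|].
        now apply (is_lim_seq_scal_l _ B 0). }
      assert (Rf : is_lim_seq (fun M => ln (ln 2) + 9 * eta + x ^ M / (1 - x)) (ln (ln 2) + 9 * eta + 0 * / (1 - x))).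
      { apply is_lim_seq_plus'; [apply is_lim_seq_const|]. now apply (is_lim_seq_scal_r _ (/ (1 - x)) 0). }
      assert (Q := is_lim_seq_le_loc _ _ _ _ (ex_intro _ M0 K2) Lf Rf). simpl in Q. lra. }
    set (et := fun k => / INR (S k)).
    assert (E0 : is_lim_seq et 0) by apply is_lim_seq_inv_S.
    assert (X1 : is_lim_seq (fun k => exp (- et k * ln 2) ^ M0) (exp (- 0 * ln 2) ^ M0)).
    { apply (is_lim_seq_continuous (fun y => exp (- y * ln 2) ^ M0) et 0); auto.
      apply continuity_pt_filterlim. apply (ex_derive_continuous (fun y => exp (- y * ln 2) ^ M0)). auto_derive. auto. }
    rewrite Ropp_0, Rmult_0_l, exp_0, pow1 in X1.
    assert (Lf : is_lim_seq (fun k => (c - e) * exp (- et k * ln 2) ^ M0 - B * (1 - exp (- et k * ln 2) ^ M0))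
      ((c - e) * 1 - B * (1 - 1))).
    { apply is_lim_seq_minus'; [now apply (is_lim_seq_scal_l _ (c - e) 1)|].
      apply (is_lim_seq_scal_l _ B (1 - 1)). apply is_lim_seq_minus'; auto. apply is_lim_seq_const. }
    assert (Rf : is_lim_seq (fun k => ln (ln 2) + 9 * et k) (ln (ln 2) + 9 * 0)).
    { apply is_lim_seq_plus'; [apply is_lim_seq_const|]. now apply (is_lim_seq_scal_l _ 9 0). }
    assert (Et : forall k, 0 < et k <= 1).
    { intros k. unfold et. rewrite S_INR. assert (P := pos_INR k).
      split; [apply Rinv_0_lt_compat; lra|]. rewrite <- Rinv_1 at 2. apply Rinv_le_contravar; lra. }
    assert (Q := is_lim_seq_le _ _ _ _ (fun k => K1 (et k) (Et k)) Lf Rf).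
    simpl in Q. lra. }
  destruct (HD (eps / 2) ltac:(lra)) as [M0 HM0]. exists M0. intros M HM.
  specialize (HM0 M HM). apply Rabs_lt_between in HM0. specialize (Key (eps / 2) ltac:(lra)).
  unfold D in HM0. lra.
Qed.

(** * The value of zeta(2) *)

Lemma rsum_add f N M : rsum f (N + M) = rsum f N + rsum (fun k => f (N + k)%nat) M.
Proof.
  induction M as [|M IH]; [rewrite Nat.add_0_r; simpl; ring|].
  rewrite Nat.add_succ_r. cbn [rsum]. rewrite IH. ring.
Qed.

Lemma rsum_rev f N : rsum (fun k => f (N - 1 - k)%nat) N = rsum f N.
Proof.
  revert f. induction N as [|N IH]; intros f; auto.
  transitivity (rsum f 1 + rsum (fun k => f (1 + k)%nat) N); [|now rewrite <- (rsum_add f 1 N)].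
  rewrite <- (IH (fun k => f (1 + k)%nat)).
  transitivity (rsum (fun k => f (S N - 1 - k)%nat) N + f (S N - 1 - N)%nat); [reflexivity|].
  replace (S N - 1 - N)%nat with 0%nat by lia.
  rewrite Rplus_comm. f_equal; [simpl; ring|].
  apply rsum_ext. intros k Hk. f_equal. lia.
Qed.

(** The odd multiples of [PI / 2^(n+2)] in the first quadrant. The halves of the angles of stage [n]
    and their complements are those of stage [n + 1]. *)
Definition basel_angle (n k : nat) : R := (2 * INR k + 1) * PI / (4 * 2 ^ n).

Lemma basel_angle_range n k : (k < 2 ^ n)%nat -> 0 < basel_angle n k < PI / 2.
Proof.
  intros Hk. assert (P := PI_RGT_0). assert (T : 0 < 2 ^ n) by (apply pow_lt; lra).
  assert (K := pos_INR k). apply le_INR in Hk. rewrite S_INR, INR_pow2 in Hk.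
  unfold basel_angle. split.
  - apply Rdiv_lt_0_compat; nra.
  - apply Rlt_div_l; [lra|]. nra.
Qed.

(** [1 / sin^2 + 1 / cos^2 = 1 / (sin^2 cos^2)], and [2 sin cos] is the sine of the double angle. *)
Lemma inv_sin2_half x : 0 < x < PI / 2 ->
  / (sin (x / 2)) ^ 2 + / (sin (PI / 2 - x / 2)) ^ 2 = 4 * / (sin x) ^ 2.
Proof.
  intros Hx. rewrite sin_shift.
  assert (S0 : 0 < sin (x / 2)) by (apply sin_gt_0; lra).
  assert (C0 : 0 < cos (x / 2)) by (apply cos_gt_0; lra).
  assert (E : sin x = 2 * sin (x / 2) * cos (x / 2)).
  { rewrite <- sin_2a. f_equal. field. }
  assert (I := sin2_cos2 (x / 2)). unfold Rsqr in I.
  rewrite E. apply Rmult_eq_reg_l with ((sin (x / 2)) ^ 2 * (cos (x / 2)) ^ 2).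
  - transitivity (cos (x / 2) ^ 2 + sin (x / 2) ^ 2); [field; lra|].
    transitivity 1; [simpl; lra|]. field. lra.
  - apply Rmult_integral_contrapositive_currified; apply pow_nonzero; lra.
Qed.

(* Hofbauer's proof: the sum is computed by duplication of the angle, then [1/sin^2 - 1 <= 1/y^2 <= 1/sin^2]. *)
Lemma basel_inv_sin2_sum n : rsum (fun k => / (sin (basel_angle n k)) ^ 2) (2 ^ n) = 2 * 4 ^ n.
Proof.
  induction n as [|n IH].
  - simpl. unfold basel_angle. simpl. replace ((2 * 0 + 1) * PI / (4 * 1)) with (PI / 4) by field.
    rewrite sin_PI4. assert (S := sqrt_sqrt 2 ltac:(lra)). assert (P : 0 < sqrt 2) by (apply sqrt_lt_R0; lra).
    replace (/ (1 / sqrt 2 * (1 / sqrt 2 * 1))) with (sqrt 2 * sqrt 2) by (field; lra). lra.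
  - replace (2 ^ S n)%nat with (2 ^ n + 2 ^ n)%nat by (simpl; lia). rewrite rsum_add.
    (* The second half of the angles consists of the complements of the first half in reverse
       order. *)
    rewrite <- (rsum_rev (fun k => / sin (basel_angle (S n) (2 ^ n + k)) ^ 2)), <- rsum_plus.
    rewrite (rsum_ext _ (fun k => 4 * / (sin (basel_angle n k)) ^ 2)).
    + rewrite rsum_scal, IH. simpl. ring.
    + intros k Hk. rewrite <- inv_sin2_half by now apply basel_angle_range.
      assert (T : 0 < 2 ^ n) by (apply pow_lt; lra).
      f_equal; f_equal; f_equal; f_equal; unfold basel_angle.
      * simpl. field. lra.
      * replace (INR (2 ^ n + (2 ^ n - 1 - k))) with (2 * 2 ^ n - 1 - INR k).
        -- simpl. field. lra.
        -- rewrite plus_INR, !minus_INR by lia. rewrite INR_pow2. simpl. ring.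
Qed.

(** [sin y < y <= tan y]; the left inequality of the conclusion is [cot^2 y <= 1 / y^2]. *)
Lemma inv_sqr_bounds y : 0 < y < PI / 2 -> / (sin y) ^ 2 - 1 <= / y ^ 2 <= / (sin y) ^ 2.
Proof.
  intros Hy. assert (S0 : 0 < sin y) by (apply sin_gt_0; lra).
  assert (C0 : 0 < cos y) by (apply cos_gt_0; lra).
  assert (L : sin y < y) by (apply sin_lt_x; lra).
  assert (T : y * cos y <= sin y).
  { destruct (MVT_gen (fun y => sin y - y * cos y) 0 y (fun y => y * sin y)) as [z [Hz E]].
    - intros. auto_derive; auto. ring.
    - intros. apply continuity_pt_filterlim, (ex_derive_continuous (fun y => sin y - y * cos y)).
      auto_derive; auto.
    - rewrite Rmin_left, Rmax_right in Hz by lra. rewrite sin_0 in E.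
      assert (0 <= sin z) by (apply sin_ge_0; lra).
      assert (0 <= z * sin z * (y - 0)) by (repeat apply Rmult_le_pos; lra). lra. }
  split.
  - assert (I := sin2_cos2 y). unfold Rsqr in I.
    replace (/ sin y ^ 2 - 1) with ((cos y / sin y) ^ 2).
    2:{ apply Rmult_eq_reg_r with (sin y ^ 2); [|apply pow_nonzero; lra].
        transitivity (cos y ^ 2); [field; lra|]. transitivity (1 - sin y ^ 2); [simpl; lra|]. field. lra. }
    rewrite <- pow_inv. apply pow_incr. split; [apply Rdiv_le_0_compat; lra|].
    apply Rle_div_l; auto. apply Rmult_le_reg_l with y; [lra|].
    replace (y * (/ y * sin y)) with (sin y) by (field; lra). lra.
  - apply Rinv_le_contravar; [apply pow_lt; auto|]. apply pow_incr. lra.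
Qed.

Lemma basel_odd_bounds n :
  PI ^ 2 / 8 - PI ^ 2 / 16 / 2 ^ n <= rsum (fun k => / (2 * INR k + 1) ^ 2) (2 ^ n) <= PI ^ 2 / 8.
Proof.
  assert (P := PI_RGT_0). assert (T : 0 < 2 ^ n) by (apply pow_lt; lra).
  assert (E : rsum (fun k => / (2 * INR k + 1) ^ 2) (2 ^ n) =
    (PI ^ 2 / (16 * 2 ^ n * 2 ^ n)) * rsum (fun k => / (basel_angle n k) ^ 2) (2 ^ n)).
  { rewrite <- rsum_scal. apply rsum_ext. intros k _. unfold basel_angle.
    assert (K := pos_INR k). field. lra. }
  assert (F : 4 ^ n = 2 ^ n * 2 ^ n) by (rewrite <- Rpow_mult_distr; f_equal; ring).
  assert (C : 0 < PI ^ 2 / (16 * 2 ^ n * 2 ^ n)).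
  { apply Rdiv_lt_0_compat; [apply pow_lt; lra|]. nra. }
  assert (U : rsum (fun k => / (basel_angle n k) ^ 2) (2 ^ n) <= 2 * 4 ^ n).
  { rewrite <- basel_inv_sin2_sum. apply rsum_le. intros k Hk. apply inv_sqr_bounds. now apply basel_angle_range. }
  assert (L : 2 * 4 ^ n - 2 ^ n <= rsum (fun k => / (basel_angle n k) ^ 2) (2 ^ n)).
  { rewrite <- basel_inv_sin2_sum.
    assert (O : forall N, rsum (fun _ => -1) N = - INR N).
    { induction N; [simpl; ring|]. cbn [rsum]. rewrite IHN, S_INR. ring. }
    replace (2 ^ n) with (- rsum (fun _ => -1) (2 ^ n)) by (rewrite O, INR_pow2; ring).
    unfold Rminus. rewrite Ropp_involutive, <- rsum_plus. apply rsum_le.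
    intros k Hk. apply (inv_sqr_bounds (basel_angle n k)). now apply basel_angle_range. }
  rewrite E, F in *. split.
  - apply Rle_trans with (PI ^ 2 / (16 * 2 ^ n * 2 ^ n) * (2 * (2 ^ n * 2 ^ n) - 2 ^ n)).
    + right. field. lra.
    + apply Rmult_le_compat_l; lra.
  - apply Rle_trans with (PI ^ 2 / (16 * 2 ^ n * 2 ^ n) * (2 * (2 ^ n * 2 ^ n))).
    + apply Rmult_le_compat_l; lra.
    + right. field. lra.
Qed.

(** Separating odd and even terms, the limit [l] satisfies [l = PI ^ 2 / 8 + l / 4]. *)
Lemma basel : is_lim_seq (rsum (fun n => / (INR (S n)) ^ 2)) (PI ^ 2 / 6).
Proof.
  set (z := fun n => / (INR (S n)) ^ 2).
  assert (P := PI_RGT_0).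
  assert (zp : forall n, 0 < z n) by (intros; apply Rinv_0_lt_compat, pow_lt, lt_0_INR; lia).
  assert (Sp : forall N, rsum z (N + N) = rsum (fun k => / (2 * INR k + 1) ^ 2) N + / 4 * rsum z N).
  { induction N as [|N IH]; [simpl; ring|].
    replace (S N + S N)%nat with (S (S (N + N))) by lia. cbn [rsum]. rewrite IH.
    assert (K := pos_INR N).
    replace (z (N + N)%nat) with (/ (2 * INR N + 1) ^ 2)
      by (unfold z; rewrite S_INR, plus_INR; f_equal; f_equal; ring).
    replace (z (S (N + N))) with (/ 4 * z N)
      by (unfold z; rewrite !S_INR, plus_INR; field; lra).
    ring. }
  assert (Mo : forall N M, (N <= M)%nat -> rsum z N <= rsum z M).
  { induction 1; [lra|]. cbn [rsum]. specialize (zp m). lra. }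
  assert (Sd : forall n, rsum z (2 ^ S n) = rsum (fun k => / (2 * INR k + 1) ^ 2) (2 ^ n) + / 4 * rsum z (2 ^ n)).
  { intros n. rewrite <- Sp. f_equal. simpl; lia. }
  assert (Bd : forall n, rsum z (2 ^ n) <= PI ^ 2 / 6).
  { induction n as [|n IH].
    - simpl. unfold z; simpl. assert (H3 := PI2_3_2). nra.
    - rewrite Sd. assert (H := basel_odd_bounds n). lra. }
  destruct (ex_finite_lim_seq_incr (rsum z) (PI ^ 2 / 6)) as [l Hl].
  { intros n. cbn [rsum]. specialize (zp n). lra. }
  { intros n. eapply Rle_trans; [|apply (Bd n)]. apply Mo. apply Nat.lt_le_incl, Nat.pow_gt_lin_r. lia. }
  replace (PI ^ 2 / 6) with l; auto.
  assert (L1 : is_lim_seq (fun n => rsum z (2 ^ n)) l).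
  { apply (is_lim_seq_subseq (rsum z) l (fun n => 2 ^ n)%nat); auto.
    apply eventually_subseq. intros n. simpl. assert (2 ^ n <> 0)%nat by (apply Nat.pow_nonzero; lia). lia. }
  assert (L2 : is_lim_seq (fun n => rsum (fun k => / (2 * INR k + 1) ^ 2) (2 ^ n)) (PI ^ 2 / 8)).
  { apply is_lim_seq_le_le with (fun n => PI ^ 2 / 8 - PI ^ 2 / 16 * (/ 2) ^ n) (fun _ => PI ^ 2 / 8).
    - intros n. rewrite pow_inv. apply basel_odd_bounds.
    - assert (G : is_lim_seq (fun n => PI ^ 2 / 8 - PI ^ 2 / 16 * (/ 2) ^ n) (PI ^ 2 / 8 - PI ^ 2 / 16 * 0)).
      { apply is_lim_seq_minus'; [apply is_lim_seq_const|]. apply (is_lim_seq_scal_l _ _ 0).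
        apply is_lim_seq_geom. rewrite Rabs_pos_eq; lra. }
      rewrite Rmult_0_r, Rminus_0_r in G. exact G.
    - apply is_lim_seq_const. }
  assert (L3 : is_lim_seq (fun n => rsum z (2 ^ S n)) (PI ^ 2 / 8 + / 4 * l)).
  { eapply is_lim_seq_ext; [intros n; symmetry; apply Sd|].
    apply is_lim_seq_plus'; auto. now apply (is_lim_seq_scal_l _ (/ 4) l). }
  assert (L4 := L1). apply is_lim_seq_incr_1 in L4.
  assert (U := is_lim_seq_unique _ _ L3). rewrite (is_lim_seq_unique _ _ L4) in U.
  injection U. lra.
Qed.

(** * Dirichlet series of periodic functions with mean zero *)

Fixpoint csum (f : nat -> C) (N : nat) : C :=
  match N with O => RtoC 0 | S n => (csum f n + f n)%C end.

Lemma csum_ext f g N : (forall n, (n < N)%nat -> f n = g n) -> csum f N = csum g N.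
Proof. induction N; intros H; simpl; auto. rewrite IHN, H; auto. Qed.

Lemma csum_plus f g N : csum (fun n => f n + g n)%C N = (csum f N + csum g N)%C.
Proof. induction N; simpl; [ring|]. rewrite IHN. ring. Qed.

Lemma csum_scal c f N : csum (fun n => c * f n)%C N = (c * csum f N)%C.
Proof. induction N; simpl; [ring|]. rewrite IHN. ring. Qed.

Lemma csum_add f N M : csum f (N + M) = (csum f N + csum (fun k => f (N + k)%nat) M)%C.
Proof.
  induction M as [|M IH]; [rewrite Nat.add_0_r; simpl; ring|].
  rewrite Nat.add_succ_r. cbn [csum]. rewrite IH. ring.
Qed.

Lemma csum_mod f N : Cmod (csum f N) <= rsum (fun n => Cmod (f n)) N.
Proof.
  induction N; simpl; [rewrite Cmod_0; lra|].
  eapply Rle_trans; [apply Cmod_triangle|]. lra.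
Qed.

Lemma csum_blocks f q K : csum (fun k => csum (fun r => f (q * k + r)%nat) q) K = csum f (q * K).
Proof.
  induction K as [|K IH]; [now rewrite Nat.mul_0_r|].
  cbn [csum]. rewrite IH. replace (q * S K)%nat with (q * K + q)%nat by lia. now rewrite csum_add.
Qed.

(** * Convergence of complex sequences and differentiation of series *)

Definition Ccv (u : nat -> C) (l : C) : Prop :=
  forall eps, 0 < eps -> exists N, forall n, (N <= n)%nat -> Cmod (u n - l) < eps.

Lemma Ccv_ext u v l : (forall n, u n = v n) -> Ccv u l -> Ccv v l.
Proof.
  intros E H eps He. destruct (H eps He) as [N HN]. exists N. intros n Hn. rewrite <- E. auto.
Qed.

Lemma Ccv_const c : Ccv (fun _ => c) c.
Proof.
  intros eps He. exists O. intros. replace (c - c)%C with (RtoC 0) by ring. now rewrite Cmod_0.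
Qed.

Lemma Ccv_plus u v l m : Ccv u l -> Ccv v m -> Ccv (fun n => u n + v n)%C (l + m)%C.
Proof.
  intros Hu Hv eps He. destruct (Hu (eps / 2) ltac:(lra)) as [N1 H1].
  destruct (Hv (eps / 2) ltac:(lra)) as [N2 H2]. exists (max N1 N2). intros n Hn.
  specialize (H1 n ltac:(lia)). specialize (H2 n ltac:(lia)).
  replace (u n + v n - (l + m))%C with ((u n - l) + (v n - m))%C by ring.
  eapply Rle_lt_trans; [apply Cmod_triangle|]. lra.
Qed.

Lemma Ccv_scal c u l : Ccv u l -> Ccv (fun n => c * u n)%C (c * l)%C.
Proof.
  intros Hu eps He. assert (P := Cmod_ge_0 c).
  destruct (Hu (eps / (Cmod c + 1))) as [N H]; [apply Rdiv_lt_0_compat; lra|].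
  exists N. intros n Hn. specialize (H n Hn). replace (c * u n - c * l)%C with (c * (u n - l))%C by ring.
  rewrite Cmod_mult. apply Rlt_div_r in H; [|lra]. assert (Q := Cmod_ge_0 (u n - l)). nra.
Qed.

Lemma Ccv_minus u v l m : Ccv u l -> Ccv v m -> Ccv (fun n => u n - v n)%C (l - m)%C.
Proof.
  intros Hu Hv. apply Ccv_ext with (fun n => u n + (- (1)) * v n)%C; [intros; ring|].
  replace (l - m)%C with (l + (- (1)) * m)%C by ring. apply Ccv_plus; auto. now apply Ccv_scal.
Qed.

Lemma Ccv_le_mod u l B : Ccv u l -> (forall n, Cmod (u n) <= B) -> Cmod l <= B.
Proof.
  intros H HB. apply le_epsilon. intros eps He. destruct (H eps He) as [N HN].
  specialize (HN N (le_n N)). specialize (HB N).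
  assert (T := Cmod_triangle' l (u N)). rewrite Cmod_minus_sym in T. lra.
Qed.

Lemma Ccv_unique u l m : Ccv u l -> Ccv u m -> l = m.
Proof.
  intros Hl Hm. apply Ceq_minus, Cmod_eq_0. apply Rle_antisym; [|apply Cmod_ge_0].
  apply le_epsilon. intros eps He. rewrite Rplus_0_l.
  destruct (Hl (eps / 2) ltac:(lra)) as [N1 H1].
  destruct (Hm (eps / 2) ltac:(lra)) as [N2 H2].
  specialize (H1 (max N1 N2) ltac:(lia)). specialize (H2 (max N1 N2) ltac:(lia)).
  replace (l - m)%C with ((u (max N1 N2) - m) - (u (max N1 N2) - l))%C by ring.
  eapply Rle_trans; [apply Cmod_minus_le|]. lra.
Qed.

Lemma Ccv_subseq u l (f : nat -> nat) : (forall n, (n <= f n)%nat) -> Ccv u l -> Ccv (fun n => u (f n)) l.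
Proof.
  intros Hf H eps He. destruct (H eps He) as [N HN]. exists N. intros n Hn. apply HN.
  specialize (Hf n). lia.
Qed.

Lemma is_series_Ccv (a : nat -> C) (l : C) :
  is_series (K := C_AbsRing) (V := C_NormedModule) a l <-> Ccv (csum a) l.
Proof.
  assert (E : forall n, sum_n (G := C_AbelianMonoid) a n = csum a (S n)).
  { induction n; [rewrite sum_O; simpl; ring|]. rewrite sum_Sn, IHn. reflexivity. }
  split.
  - intros H eps He.
    destruct (H (ball l (eps / 2))) as [N HN]. { exists (mkposreal (eps / 2) ltac:(lra)). auto. }
    exists (S N). intros n Hn. destruct n as [|n]; [lia|].
    specialize (HN n ltac:(lia)). change (sum_n a n) with (sum_n (G := C_AbelianMonoid) a n) in HN.
    rewrite E in HN. destruct HN as [H1 H2].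
    eapply Rle_lt_trans; [apply Cmod_le_abs|].
    change (Rabs (Re (csum a (S n) - l)) < eps / 2) in H1.
    change (Rabs (Im (csum a (S n) - l)) < eps / 2) in H2. lra.
  - intros H P [eps He]. destruct (H eps (cond_pos eps)) as [N HN]. exists N. intros n Hn.
    apply He. change (sum_n a n) with (sum_n (G := C_AbelianMonoid) a n). rewrite E.
    specialize (HN (S n) ltac:(lia)). split.
    + eapply Rle_lt_trans; [apply (Re_le_Cmod (csum a (S n) - l))|auto].
    + eapply Rle_lt_trans; [apply (Im_le_Cmod (csum a (S n) - l))|auto].
Qed.

Lemma Ccv_dominated (a : nat -> C) (M : nat -> R) (B : R) :
  (forall n, Cmod (a n) <= M n) -> (forall N, rsum M N <= B) ->
  exists l, Ccv (csum a) l.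
Proof.
  intros Ha HM.
  assert (M0 : forall n, 0 <= M n) by (intros; eapply Rle_trans; [apply Cmod_ge_0|apply Ha]).
  assert (E : ex_series M).
  { destruct (ex_finite_lim_seq_incr (rsum M) B) as [l Hl]; auto.
    - intros n. simpl. specialize (M0 n). lra.
    - exists l. apply is_lim_seq_incr_1 in Hl. apply (is_lim_seq_ext _ (sum_n M)) in Hl; [exact Hl|].
      induction n; [rewrite sum_O; simpl; ring|]. rewrite sum_Sn, <- IHn. reflexivity. }
  destruct (ex_series_le (K := C_AbsRing) (V := C_CompleteNormedModule) a M Ha E) as [l Hl].
  exists l. now apply is_series_Ccv.
Qed.

(** The real mean value theorem applied to the real part of [Cconj D * f], the component of [f] in
    the direction of its own increment [D]. *)
Lemma mean_value_ineq (f f1 : C -> C) (s w : C) (M : R) :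
  (forall t, 0 <= t <= 1 -> is_complex_derive f (s + RtoC t * (w - s))%C (f1 (s + RtoC t * (w - s))%C) /\
     Cmod (f1 (s + RtoC t * (w - s))%C) <= M) ->
  Cmod (f w - f s) <= M * Cmod (w - s).
Proof.
  intros H. set (D := (f w - f s)%C). set (g := fun z => (Cconj D * f z)%C).
  assert (Hd : forall t, 0 <= t <= 1 -> is_derive (fun t => Re (g (s + RtoC t * (w - s))%C)) t
     (Re (Cconj D * f1 (s + RtoC t * (w - s))%C * (w - s)))).
  { intros t Ht. apply path_derive. set (x := (s + RtoC t * (w - s))%C).
    apply cd_eq with (RtoC 0 * f x + Cconj D * f1 x)%C; [|ring].
    apply (cd_mult (fun _ => Cconj D) f); [apply cd_const|now apply H]. }
  destruct (MVT_cor2 (fun t => Re (g (s + RtoC t * (w - s))%C))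
    (fun t => Re (Cconj D * f1 (s + RtoC t * (w - s))%C * (w - s))) 0 1) as [t [E Ht]].
  { lra. } { intros t Ht. apply is_derive_Reals, Hd, Ht. }
  assert (E2 : Cmod D ^ 2 = Re (Cconj D * f1 (s + RtoC t * (w - s))%C * (w - s))).
  { rewrite Rminus_0_r, Rmult_1_r in E. rewrite <- E.
    replace (s + RtoC 1 * (w - s))%C with w by ring. replace (s + RtoC 0 * (w - s))%C with s by ring.
    unfold g. rewrite Cmod_sqr. replace (Re (Cconj D * f w) - Re (Cconj D * f s)) with (Re (Cconj D * D)).
    - rewrite re_mult, re_conj, im_conj. ring.
    - unfold D at 2. unfold Cminus. rewrite Cmult_plus_distr_l, re_plus.
      replace (Cconj D * - f s)%C with (- (Cconj D * f s))%C by ring. rewrite re_opp. ring. }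
  destruct (H t ltac:(lra)) as [_ HM].
  assert (L : Cmod D ^ 2 <= Cmod D * (M * Cmod (w - s))).
  { rewrite E2. eapply Rle_trans; [apply Rle_abs|]. eapply Rle_trans; [apply Re_le_Cmod|].
    rewrite !Cmod_mult, Cmod_conj, Rmult_assoc. apply Rmult_le_compat_l; [apply Cmod_ge_0|].
    apply Rmult_le_compat_r; [apply Cmod_ge_0|auto]. }
  destruct (Req_dec (Cmod D) 0) as [Z|Z].
  - rewrite Z. apply Rmult_le_pos; [|apply Cmod_ge_0]. eapply Rle_trans; [apply Cmod_ge_0|exact HM].
  - assert (P := Cmod_ge_0 D). apply Rmult_le_reg_l with (Cmod D); [lra|]. simpl in L. lra.
Qed.

Lemma segment_dist (s z : C) t : 0 <= t <= 1 -> Cmod (s + RtoC t * (z - s) - s) <= Cmod (z - s).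
Proof.
  intros Ht. replace (s + RtoC t * (z - s) - s)%C with (RtoC t * (z - s))%C by ring.
  rewrite Cmod_mult, Cmod_R, Rabs_pos_eq by lra. assert (P := Cmod_ge_0 (z - s)). nra.
Qed.

(** The mean value inequality twice, for [g1] and for [g] minus its linear part; this loses the
    factor 1/2. *)
Lemma taylor_ineq (g g1 g2 : C -> C) (s z : C) (d M : R) :
  (forall w, Cmod (w - s) < d -> is_complex_derive g w (g1 w) /\ is_complex_derive g1 w (g2 w) /\ Cmod (g2 w) <= M) ->
  Cmod (z - s) < d ->
  Cmod (g z - g s - g1 s * (z - s)) <= M * Cmod (z - s) ^ 2.
Proof.
  intros H Hz.
  assert (M0 : 0 <= M).
  { eapply Rle_trans; [apply Cmod_ge_0|apply (H z Hz)]. }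
  assert (H1 : forall w, Cmod (w - s) <= Cmod (z - s) -> Cmod (g1 w - g1 s) <= M * Cmod (z - s)).
  { intros w Hw. apply Rle_trans with (M * Cmod (w - s)).
    - apply mean_value_ineq with g2. intros t Ht. assert (Q := segment_dist s w t Ht).
      destruct (H (s + RtoC t * (w - s))%C) as (A & B & D); [lra|]. auto.
    - apply Rmult_le_compat_l; auto. }
  replace (g z - g s - g1 s * (z - s))%C with ((g z + (- g1 s) * z) - (g s + (- g1 s) * s))%C by ring.
  replace (M * Cmod (z - s) ^ 2) with (M * Cmod (z - s) * Cmod (z - s)) by ring.
  apply (mean_value_ineq (fun z => g z + (- g1 s) * z)%C (fun z => g1 z - g1 s)%C).
  intros t Ht. assert (Q := segment_dist s z t Ht). split; [|now apply H1].
  set (w := (s + RtoC t * (z - s))%C) in *.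
  apply cd_eq with (g1 w + (RtoC 0 * w + (- g1 s) * RtoC 1))%C; [|ring].
  apply (cd_plus g (fun z => - g1 s * z)%C); [apply H; lra|].
  apply (cd_mult (fun _ => - g1 s)%C (fun z => z)); [apply cd_const|apply cd_id].
Qed.

(** The quadratic Taylor remainders of the terms add up to [B * Cmod (z - s) ^ 2]. Domination is
    asked of the second derivatives only; the first ones need converge just at [s]. *)
Lemma series_derive (g g1 g2 : nat -> C -> C) (G : C -> C) (G1 s : C) (d B : R) (M : nat -> R) :
  0 < d ->
  (forall k z, Cmod (z - s) < d -> is_complex_derive (g k) z (g1 k z) /\
     is_complex_derive (g1 k) z (g2 k z) /\ Cmod (g2 k z) <= M k) ->
  (forall K, rsum M K <= B) ->
  (forall z, Cmod (z - s) < d -> Ccv (csum (fun k => g k z)) (G z)) ->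
  Ccv (csum (fun k => g1 k s)) G1 ->
  is_complex_derive G s G1.
Proof.
  intros Hd Hg HM HG HG1. assert (B0 : 0 <= B) by (apply (HM O)).
  assert (Ss : Cmod (s - s) < d) by (replace (s - s)%C with (RtoC 0) by ring; now rewrite Cmod_0).
  assert (Key : forall z, Cmod (z - s) < d -> Cmod (G z - G s - G1 * (z - s)) <= B * Cmod (z - s) ^ 2).
  { intros z Hz. apply Ccv_le_mod with (csum (fun k => g k z - g k s - (z - s) * g1 k s)%C).
    - apply Ccv_ext with (fun K => csum (fun k => g k z) K - csum (fun k => g k s) K - (z - s) * csum (fun k => g1 k s) K)%C.
      { intros K. unfold Cminus. induction K as [|K IH]; simpl; [ring|]. rewrite <- IH. ring. }
      replace (G1 * (z - s))%C with ((z - s) * G1)%C by ring.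
      apply Ccv_minus; [apply Ccv_minus; auto|]. now apply Ccv_scal.
    - intros K. eapply Rle_trans; [apply csum_mod|].
      apply Rle_trans with (rsum (fun k => Cmod (z - s) ^ 2 * M k) K).
      + apply rsum_le. intros k _. rewrite Rmult_comm.
        replace ((z - s) * g1 k s)%C with (g1 k s * (z - s))%C by ring.
        apply taylor_ineq with (g2 k) d; auto.
      + rewrite rsum_scal, Rmult_comm. apply Rmult_le_compat_r; auto. apply pow2_ge_0. }
  apply is_complex_derive_eps. intros eps He. exists (Rmin d (eps / (B + 1))).
  split. { apply Rmin_pos; auto. apply Rdiv_lt_0_compat; lra. }
  intros z Hz. assert (Z1 := Rlt_le_trans _ _ _ Hz (Rmin_l _ _)).
  assert (Z2 := Rlt_le_trans _ _ _ Hz (Rmin_r _ _)).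
  eapply Rle_trans; [now apply Key|]. apply Rlt_div_r in Z2; [|lra].
  assert (P := Cmod_ge_0 (z - s)). simpl. nra.
Qed.

(* The [j]-th derivative in [s] of [exp (- u s)]; with [u = ln n] this is the one of [n^-s]. *)
Definition phi (j : nat) (u : R) (s : C) : C := (RtoC ((- u) ^ j) * Cexp (- s * RtoC u))%C.

Lemma phi_derive j u s : is_complex_derive (phi j u) s (phi (S j) u s).
Proof.
  unfold phi. eapply cd_eq.
  - apply cd_mult; [apply cd_const|].
    apply (cd_comp Cexp (fun s => - s * RtoC u)%C s); [|apply cd_Cexp].
    apply cd_mult; [|apply cd_const].
    apply cd_ext with (fun z => (- (1)) * z)%C; [intros; ring|].
    apply cd_mult; [apply cd_const|apply cd_id].
  - cbv beta. rewrite !RtoC_pow, RtoC_opp. simpl Cpow. ring.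
Qed.

(** Mean value inequality in the variable [u]: differentiation brings down [s] or one factor [j],
    and the exponential is largest at the left end. *)
Lemma phi_diff j u v s : 0 <= u <= v -> 0 <= Re s ->
  Cmod (phi j v s - phi j u s) <= (INR j + Cmod s) * (1 + v) ^ j * exp (- (Re s * u)) * (v - u).
Proof.
  intros Huv Hs.
  (* [u] is made complex so that the complex mean value inequality applies. In [F1] the factor
     [INR j] removes the term with [pred j] when [j = 0]. *)
  set (F := fun w : C => (Cpow (- w) j * Cexp (- s * w))%C).
  set (F1 := fun w : C => (Cpow (- w) j * (Cexp (- s * w) * (- s)) - RtoC (INR j) * Cpow (- w) (pred j) * Cexp (- s * w))%C).
  assert (Pd : forall k w, is_complex_derive (fun w => Cpow (- w) k) w (- (RtoC (INR k) * Cpow (- w) (pred k)))%C).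
  { intros k w. induction k as [|k IH].
    - simpl. eapply cd_eq; [apply cd_const|]. ring.
    - apply cd_ext with (fun w => ((- (1)) * w) * Cpow (- w) k)%C.
      { intros z. rewrite Cpow_S. ring. }
      eapply cd_eq; [apply cd_mult; [apply cd_mult; [apply cd_const|apply cd_id]|exact IH]|].
      cbv beta. rewrite S_INR, RtoC_plus. destruct k as [|k].
      + simpl. ring.
      + simpl pred. rewrite !Cpow_S. ring. }
  assert (FD : forall w, is_complex_derive F w (F1 w)).
  { intros w. unfold F, F1. eapply cd_eq.
    - apply cd_mult; [apply Pd|]. apply (cd_comp Cexp (fun w => - s * w)%C w); [|apply cd_Cexp].
      apply cd_mult; [apply cd_const|apply cd_id].
    - cbv beta. ring. }
  assert (E : forall u, F (RtoC u) = phi j u s).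
  { intros x. unfold F, phi. rewrite RtoC_pow, RtoC_opp. reflexivity. }
  rewrite <- !E.
  apply Rle_trans with ((INR j + Cmod s) * (1 + v) ^ j * exp (- (Re s * u)) * Cmod (RtoC v - RtoC u)).
  2:{ rewrite <- RtoC_minus, Cmod_R, Rabs_pos_eq by lra. lra. }
  apply mean_value_ineq with F1. intros t Ht. split; [apply FD|].
  replace (RtoC u + RtoC t * (RtoC v - RtoC u))%C with (RtoC (u + t * (v - u)))
    by (rewrite RtoC_plus, RtoC_mult, RtoC_minus; ring).
  set (x := u + t * (v - u)).
  assert (Hx : u <= x <= v) by (unfold x; nra).
  unfold F1.
  assert (EX : Cmod (Cexp (- s * RtoC x)) <= exp (- (Re s * u))).
  { rewrite Cmod_Cexp, re_scal_r, re_opp. apply exp_le. nra. }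
  assert (Px : forall k, (k <= j)%nat -> Cmod (Cpow (- RtoC x) k) <= (1 + v) ^ j).
  { intros k Hk. rewrite Cmod_pow, <- RtoC_opp, Cmod_R, Rabs_Ropp, Rabs_pos_eq by lra.
    apply Rle_trans with ((1 + v) ^ k); [apply pow_incr; lra|]. apply Rle_pow; [lra|auto]. }
  assert (V0 : 0 <= (1 + v) ^ j) by (apply pow_le; lra).
  assert (e0 := exp_pos (- (Re s * u))).
  eapply Rle_trans; [apply Cmod_minus_le|]. rewrite !Cmod_mult, Cmod_opp, Cmod_R, (Rabs_pos_eq (INR j)) by apply pos_INR.
  assert (P1 := Px j (le_n j)). assert (P2 := Px (pred j) ltac:(lia)).
  assert (s0 := Cmod_ge_0 s). assert (j0 := pos_INR j).
  replace ((INR j + Cmod s) * (1 + v) ^ j * exp (- (Re s * u))) with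
    ((1 + v) ^ j * (exp (- (Re s * u)) * Cmod s) + INR j * (1 + v) ^ j * exp (- (Re s * u))) by ring.
  apply Rplus_le_compat.
  - apply Rmult_le_compat; auto using Cmod_ge_0. { apply Rmult_le_pos; apply Cmod_ge_0. }
    apply Rmult_le_compat_r; auto.
  - apply Rmult_le_compat; auto using Cmod_ge_0. { apply Rmult_le_pos; auto; apply Cmod_ge_0. }
    apply Rmult_le_compat_l; auto.
Qed.

Lemma ln_INR_S_ge_0 k : 0 <= ln (INR (S k)).
Proof.
  rewrite <- ln_1. apply ln_le; [lra|]. apply (le_INR 1). lia.
Qed.

(** Comparison with the integral in telescoping form: the term at [n + 1] is at most
    [(n^(-d) - (n+1)^(-d)) / d]. *)
Lemma zeta_partial_le d N : 0 < d -> rsum (fun k => exp (- (1 + d) * ln (INR (S k)))) N <= 1 + / d.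
Proof.
  intros Hd. assert (Id : 0 < / d) by now apply Rinv_0_lt_compat.
  assert (H : rsum (fun k => exp (- (1 + d) * ln (INR (S k)))) (S N) <= 1 + / d * (1 - exp (- d * ln (INR (S N))))).
  { induction N as [|N IH].
    - simpl. rewrite ln_1, !Rmult_0_r, exp_0. lra.
    - cbn [rsum] in *. set (X := rsum _ N + _) in *.
      set (n := INR (S N)) in *. rewrite (S_INR (S N)). fold n.
      assert (Hn : 1 <= n) by (apply (le_INR 1); lia).
      destruct (ln_succ_bounds n ltac:(lra)) as [L _].
      assert (E1 : exp (- d * ln n) = exp (- d * ln (n + 1)) * exp (d * (ln (n + 1) - ln n)))
        by (rewrite <- exp_plus; f_equal; ring).
      assert (E2 := exp_ineq1_le (d * (ln (n + 1) - ln n))).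
      assert (E3 : exp (- (1 + d) * ln (n + 1)) = exp (- d * ln (n + 1)) * / (n + 1)).
      { replace (- (1 + d) * ln (n + 1)) with (- d * ln (n + 1) + - ln (n + 1)) by ring.
        rewrite exp_plus, exp_Ropp, exp_ln by lra. reflexivity. }
      rewrite E3. rewrite E1 in IH.
      set (y := exp (- d * ln (n + 1))) in *. assert (y0 : 0 < y) by apply exp_pos.
      set (z := exp (d * (ln (n + 1) - ln n))) in *.
      assert (F : y * / (n + 1) <= / d * (y * z - y)).
      { replace (/ d * (y * z - y)) with (y * (/ d * (z - 1))) by ring.
        apply Rmult_le_compat_l; [lra|]. apply Rmult_le_reg_l with d; auto.
        rewrite <- Rmult_assoc, Rinv_r, Rmult_1_l by lra.
        assert (d * / (n + 1) <= d * (ln (n + 1) - ln n)) by (apply Rmult_le_compat_l; lra). lra. }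
      lra. }
  assert (P := exp_pos (- d * ln (INR (S N)))). cbn [rsum] in H.
  assert (Q := exp_pos (- (1 + d) * ln (INR (S N)))). nra.
Qed.

(** With [L] a logarithm: powers of logarithms cost an arbitrarily small power. *)
Lemma poly_le_exp (a d : R) (j : nat) : 0 <= a -> 0 < d ->
  exists K, 0 < K /\ forall L, 0 <= L -> (a + L) ^ j <= K * exp (d * L).
Proof.
  revert d. induction j as [|j IH]; intros d Ha Hd.
  - exists 1. split; [lra|]. intros L HL. simpl. assert (H := exp_ineq1_le (d * L)). nra.
  - destruct (IH (d / 2) Ha ltac:(lra)) as [K [K0 HK]].
    exists ((a + 2 / d) * K). assert (D : 0 < 2 / d) by (apply Rdiv_lt_0_compat; lra).
    split; [nra|]. intros L HL. specialize (HK L HL).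
    assert (H := exp_ineq1_le (d / 2 * L)).
    assert (A : a + L <= (a + 2 / d) * exp (d / 2 * L)).
    { assert (L = 2 / d * (d / 2 * L)) by (field; lra).
      assert (0 <= d / 2 * L) by nra.
      assert (2 / d * (d / 2 * L) <= 2 / d * exp (d / 2 * L)) by (apply Rmult_le_compat_l; lra). nra. }
    replace (exp (d * L)) with (exp (d / 2 * L) * exp (d / 2 * L)) by (rewrite <- exp_plus; f_equal; field).
    assert (e0 := exp_pos (d / 2 * L)). simpl.
    replace ((a + 2 / d) * K * (exp (d / 2 * L) * exp (d / 2 * L))) with
      (((a + 2 / d) * exp (d / 2 * L)) * (K * exp (d / 2 * L))) by ring.
    apply Rmult_le_compat; auto; [lra|]. apply pow_le; lra.
Qed.

(** Blocks start at [q * k + 1], matching series that begin at 1. The bound by 1 and the vanishing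
    of block sums are all that the continuation uses, so it applies also to the square of a
    character minus its mean. *)
Definition mean_zero (q : nat) (c : nat -> C) : Prop :=
  (0 < q)%nat /\ (forall n, Cmod (c n) <= 1) /\
  forall k, csum (fun r => c (S (q * k + r))) q = RtoC 0.

Definition dterm (c : nat -> C) (j : nat) (s : C) (n : nat) : C :=
  (c (S n) * phi j (ln (INR (S n))) s)%C.

Definition dblock (q : nat) (c : nat -> C) (j k : nat) (s : C) : C :=
  csum (fun r => dterm c j s (q * k + r)) q.

Lemma csum_derive (f f1 : nat -> C -> C) s N :
  (forall n, is_complex_derive (f n) s (f1 n s)) ->
  is_complex_derive (fun z => csum (fun n => f n z) N) s (csum (fun n => f1 n s) N).
Proof. intros H. induction N; simpl; [apply cd_const|]. now apply cd_plus. Qed.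

Lemma dblock_derive q c j k s : is_complex_derive (dblock q c j k) s (dblock q c (S j) k s).
Proof.
  apply (csum_derive (fun r z => dterm c j z (q * k + r)) (fun r z => dterm c (S j) z (q * k + r))).
  intros r. eapply cd_eq; [apply cd_mult; [apply cd_const|apply phi_derive]|]. unfold dterm. ring.
Qed.

(** Since the coefficients of a block add up to 0, the value of [phi] at the start of the block may
    be subtracted. The differences gain [ln y - ln x <= q / (k + 1)], one more power of decay, which
    gives convergence for [0 < Re s]. One factor [INR q] bounds this gap, the other counts the
    terms. *)
Lemma dblock_bound q c j k s : mean_zero q c -> 0 <= Re s ->
  Cmod (dblock q c j k s) <= INR q ^ 2 * (INR j + Cmod s) * (1 + ln (INR q) + ln (INR (S k))) ^ j
    * exp (- (1 + Re s) * ln (INR (S k))).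
Proof.
  intros (q_pos & c_le_1 & c_mean) Hs. set (x := INR (S (q * k))). set (L := ln (INR (S k))).
  assert (Q1 : 1 <= INR q) by (apply (le_INR 1); lia).
  assert (X0 : INR (S k) <= x) by (apply le_INR; nia).
  assert (K1 : 1 <= INR (S k)) by (apply (le_INR 1); lia).
  assert (Lq : 0 <= ln (INR q)) by (rewrite <- ln_1; apply ln_le; lra).
  assert (L0 : 0 <= L) by apply ln_INR_S_ge_0.
  assert (Lx : L <= ln x) by (apply ln_le; lra).
  set (B := (INR j + Cmod s) * (1 + ln (INR q) + L) ^ j * exp (- (1 + Re s) * L) * INR q).
  assert (E : dblock q c j k s = csum (fun r => c (S (q * k + r)) * (phi j (ln (INR (S (q * k + r)))) s - phi j (ln x) s))%C q).
  { transitivity (dblock q c j k s - phi j (ln x) s * csum (fun r => c (S (q * k + r))) q)%C.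
    - rewrite c_mean. ring.
    - unfold dblock, dterm. transitivity (csum (fun r => c (S (q * k + r)) * phi j (ln (INR (S (q * k + r)))) s) q
        + (- phi j (ln x) s) * csum (fun r => c (S (q * k + r))) q)%C; [ring|].
      rewrite <- csum_scal, <- csum_plus. apply csum_ext. intros; ring. }
  rewrite E. eapply Rle_trans; [apply csum_mod|].
  apply Rle_trans with (rsum (fun _ => B * 1) q).
  - apply rsum_le. intros r Hr. rewrite Cmod_mult, Rmult_1_r.
    set (y := INR (S (q * k + r))).
    assert (Y : x <= y) by (apply le_INR; lia).
    assert (Y2 : y <= INR q * INR (S k)) by (unfold y; rewrite <- mult_INR; apply le_INR; nia).
    assert (Y3 : y - x <= INR q).
    { unfold y, x. rewrite !S_INR, plus_INR. apply le_INR in Hr. rewrite S_INR in Hr. lra. }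
    assert (Ly : ln x <= ln y) by (apply ln_le; lra).
    assert (Ly2 : ln y <= ln (INR q) + L) by (unfold L; rewrite <- ln_mult by lra; apply ln_le; lra).
    assert (D := phi_diff j (ln x) (ln y) s ltac:(lra) Hs).
    assert (Dl : ln y - ln x <= INR q * exp (- L)).
    { rewrite <- ln_div by lra. replace (y / x) with (1 + (y - x) / x) by (field; lra).
      assert (0 <= (y - x) / x) by (apply Rdiv_le_0_compat; lra).
      eapply Rle_trans; [apply ln_1p_le; lra|]. unfold Rdiv, L. rewrite exp_Ropp, exp_ln by lra.
      apply Rmult_le_compat; try lra. left; apply Rinv_0_lt_compat; lra. apply Rinv_le_contravar; lra. }
    assert (P1 := Cmod_ge_0 s). assert (P2 := pos_INR j).
    assert (P3 : 0 <= (1 + ln y) ^ j) by (apply pow_le; lra).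
    assert (P4 : (1 + ln y) ^ j <= (1 + ln (INR q) + L) ^ j) by (apply pow_incr; lra).
    assert (P5 : exp (- (Re s * ln x)) <= exp (- (Re s * L))) by (apply exp_le; nra).
    assert (P6 := exp_pos (- (Re s * ln x))).
    apply Rle_trans with (1 * Cmod (phi j (ln y) s - phi j (ln x) s)).
    { apply Rmult_le_compat_r; [apply Cmod_ge_0|auto]. }
    rewrite Rmult_1_l. eapply Rle_trans; [exact D|]. unfold B.
    replace (- (1 + Re s) * L) with (- (Re s * L) + - L) by ring. rewrite exp_plus.
    replace ((INR j + Cmod s) * (1 + ln (INR q) + L) ^ j * (exp (- (Re s * L)) * exp (- L)) * INR q) with
      ((INR j + Cmod s) * (1 + ln (INR q) + L) ^ j * exp (- (Re s * L)) * (INR q * exp (- L))) by ring.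
    apply Rmult_le_compat; try lra; [repeat apply Rmult_le_pos; lra|].
    apply Rmult_le_compat; try lra; [repeat apply Rmult_le_pos; lra|].
    apply Rmult_le_compat_l; lra.
  - rewrite rsum_scal. replace (rsum (fun _ => 1) q) with (INR q).
    + right. unfold B. ring.
    + clear. induction q as [|n IH]; [reflexivity|]. rewrite S_INR, IH. reflexivity.
Qed.

(** The powers of the logarithm are absorbed by half of the exponent [s0]; the other half leaves a
    convergent sum. *)
Lemma dblock_local_bound q c j s0 R : mean_zero q c -> 0 < s0 ->
  exists M B, (forall k s, s0 <= Re s -> Cmod s <= R -> Cmod (dblock q c j k s) <= M k) /\
    forall K, rsum M K <= B.
Proof.
  intros Hc Hs0. assert (Q1 : 1 <= INR q) by (apply (le_INR 1); destruct Hc; lia).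
  assert (Lq : 0 <= ln (INR q)) by (rewrite <- ln_1; apply ln_le; lra).
  destruct (poly_le_exp (1 + ln (INR q)) (s0 / 2) j ltac:(lra) ltac:(lra)) as [K [K0 HK]].
  assert (R0 : 0 <= Rabs R) by apply Rabs_pos.
  set (A := INR q ^ 2 * (INR j + Rabs R) * K). assert (J0 := pos_INR j).
  assert (A0 : 0 <= A) by (unfold A; repeat apply Rmult_le_pos; try lra; apply pow2_ge_0).
  exists (fun k => A * exp (- (1 + s0 / 2) * ln (INR (S k)))), (A * (1 + / (s0 / 2))). split.
  - intros k s Hs HR. set (L := ln (INR (S k))). assert (L0 : 0 <= L) by apply ln_INR_S_ge_0.
    eapply Rle_trans; [apply dblock_bound; auto; lra|]. fold L. unfold A.
    specialize (HK L L0). assert (HRR := Rle_abs R). assert (C0 := Cmod_ge_0 s).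
    replace (- (1 + s0 / 2) * L) with (s0 / 2 * L + - (1 + s0) * L) by field. rewrite exp_plus.
    replace (INR q ^ 2 * (INR j + Rabs R) * K * (exp (s0 / 2 * L) * exp (- (1 + s0) * L))) with
      (INR q ^ 2 * (INR j + Rabs R) * (K * exp (s0 / 2 * L)) * exp (- (1 + s0) * L)) by ring.
    assert (q2 : 0 <= INR q ^ 2) by apply pow2_ge_0.
    apply Rmult_le_compat.
    + repeat apply Rmult_le_pos; try lra. apply pow_le; lra.
    + left; apply exp_pos.
    + apply Rmult_le_compat; auto; [apply Rmult_le_pos; lra|apply pow_le; lra|].
      apply Rmult_le_compat_l; lra.
    + apply exp_le. apply Rmult_le_compat_r; lra.
  - intros N. rewrite (rsum_scal A (fun k => exp (- (1 + s0 / 2) * ln (INR (S k))))).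
    apply Rmult_le_compat_l; auto. apply zeta_partial_le. lra.
Qed.

Lemma dblock_sum_exists q c j s : mean_zero q c -> 0 < Re s ->
  exists l, Ccv (csum (fun k => dblock q c j k s)) l.
Proof.
  intros Hc Hs. destruct (dblock_local_bound q c j (Re s) (Cmod s) Hc Hs) as (M & B & H1 & H2).
  apply Ccv_dominated with M B; auto. intros k. apply H1; lra.
Qed.

(** [dsum q c 0] is the continued series and [dsum q c j] its [j]-th derivative. The chosen limit is
    meaningful for mean-zero [c] and [0 < Re s], by [dblock_sum_exists]. *)
Definition dsum (q : nat) (c : nat -> C) (j : nat) (s : C) : C :=
  epsilon (inhabits (RtoC 0)) (Ccv (csum (fun k => dblock q c j k s))).

Lemma dsum_cv q c j s : mean_zero q c -> 0 < Re s -> Ccv (csum (fun k => dblock q c j k s)) (dsum q c j s).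
Proof. intros Hc Hs. unfold dsum. apply epsilon_spec. now apply dblock_sum_exists. Qed.

Lemma dsum_derive q c j s : mean_zero q c -> 0 < Re s ->
  is_complex_derive (dsum q c j) s (dsum q c (S j) s).
Proof.
  intros Hc Hs.
  destruct (dblock_local_bound q c (S (S j)) (Re s / 2) (Cmod s + Re s / 2) Hc ltac:(lra)) as (M & B & H1 & H2).
  assert (Near : forall z, Cmod (z - s) < Re s / 2 -> Re s / 2 <= Re z /\ Cmod z <= Cmod s + Re s / 2).
  { intros z Hz. split.
    - assert (T := Re_le_Cmod (z - s)). unfold Cminus in T at 1. rewrite re_plus, re_opp in T.
      assert (U := Rle_lt_trans _ _ _ T Hz). apply Rabs_lt_between in U. lra.
    - assert (T := Cmod_triangle' z s). lra. }
  apply series_derive with (g := dblock q c j) (g1 := dblock q c (S j)) (g2 := dblock q c (S (S j)))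
    (d := Re s / 2) (B := B) (M := M); auto; try lra.
  - intros k z Hz. destruct (Near z Hz). split; [apply dblock_derive|]. split; [apply dblock_derive|auto].
  - intros z Hz. destruct (Near z Hz). apply dsum_cv; auto. lra.
  - now apply dsum_cv.
Qed.

(** The blocks are at most [q^2 |s| (k + 1)^(-3/2)], and [3 = 1 + / (1 / 2)] bounds the sum of these
    powers. *)
Lemma dsum_linear_bound q c s : mean_zero q c -> 1 / 2 <= Re s ->
  Cmod (dsum q c 0 s) <= 3 * INR q ^ 2 * Cmod s.
Proof.
  intros Hc Hs. apply Ccv_le_mod with (csum (fun k => dblock q c 0 k s)).
  - apply dsum_cv; auto. lra.
  - intros N. eapply Rle_trans; [apply csum_mod|].
    apply Rle_trans with (rsum (fun k => INR q ^ 2 * Cmod s * exp (- (1 + 1 / 2) * ln (INR (S k)))) N).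
    + apply rsum_le. intros k _. eapply Rle_trans; [apply dblock_bound; auto; lra|].
      simpl (INR 0). rewrite Rplus_0_l, pow_O, Rmult_1_r.
      apply Rmult_le_compat_l; [apply Rmult_le_pos; [apply pow2_ge_0|apply Cmod_ge_0]|].
      apply exp_le. apply Rmult_le_compat_r; [apply ln_INR_S_ge_0|lra].
    + rewrite (rsum_scal (INR q ^ 2 * Cmod s) (fun k => exp (- (1 + 1 / 2) * ln (INR (S k))))).
      assert (Z := zeta_partial_le (1 / 2) N ltac:(lra)).
      assert (0 <= INR q ^ 2 * Cmod s) by (apply Rmult_le_pos; [apply pow2_ge_0|apply Cmod_ge_0]).
      replace (3 * INR q ^ 2 * Cmod s) with (INR q ^ 2 * Cmod s * (1 + / (1 / 2))) by field.
      apply Rmult_le_compat_l; auto.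
Qed.

Lemma Cmod_phi0 u s : Cmod (phi 0 u s) = exp (- Re s * u).
Proof.
  unfold phi. rewrite Cmod_mult, Cmod_Cexp, re_scal_r, re_opp. simpl. rewrite Cmod_1. ring.
Qed.

Lemma dseries_cv c s : (forall n, Cmod (c n) <= 1) -> 1 < Re s ->
  exists l, Ccv (csum (dterm c 0 s)) l.
Proof.
  intros Hc Hs. apply Ccv_dominated with (fun k => exp (- (1 + (Re s - 1)) * ln (INR (S k)))) (1 + / (Re s - 1)).
  - intros n. unfold dterm. rewrite Cmod_mult, Cmod_phi0.
    replace (- (1 + (Re s - 1))) with (- Re s) by ring.
    assert (E := exp_pos (- Re s * ln (INR (S n)))). specialize (Hc (S n)). nra.
  - intros N. apply zeta_partial_le. lra.
Qed.

Lemma dsum_eq_series q c s l : mean_zero q c -> 1 < Re s ->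
  Ccv (csum (dterm c 0 s)) l -> dsum q c 0 s = l.
Proof.
  intros Hc Hs Hl. apply Ccv_unique with (csum (fun k => dblock q c 0 k s)).
  - apply dsum_cv; auto. lra.
  - apply Ccv_ext with (fun K => csum (dterm c 0 s) (q * K)).
    + intros K. symmetry. apply (csum_blocks (dterm c 0 s)).
    + apply (Ccv_subseq (csum (dterm c 0 s))); auto. intros n. destruct Hc. nia.
Qed.

(** * Sieving and Euler products *)

(** The reciprocal of the partial Euler product; in this form no division occurs. *)
Fixpoint pprod (a : nat -> C) (N : nat) : C :=
  match N with
  | O => RtoC 1
  | S n => (pprod a n * (if prime.prime n then 1 - a n else 1))%C
  end.

(** The [N]-rough numbers of sieve theory, tested prime by prime to match the recursion of
    [pprod]. *)
Fixpoint rough (N n : nat) : bool :=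
  match N with
  | O => true
  | S m => (rough m n && negb (prime.prime m && div.dvdn m n))%bool
  end.

Section RoughNumbers.
Import ssreflect ssrfun ssrbool eqtype ssrnat seq div bigop prime binomial fintype.

Lemma rough_mul N P m : prime P -> (N <= P)%N -> rough N (P * m)%N = rough N m.
Proof.
  move=> pP. elim: N => [//|N IH] NP /=. rewrite IH ?(ltnW NP) //.
  case pN: (prime N) => //=. rewrite Euclid_dvdM //.
  by rewrite dvdn_prime2 // (ltn_eqF NP).
Qed.

(** Otherwise the least prime factor of [n] would be below [N]. *)
Lemma rough_ge N n : rough N n -> (1 < n)%N -> (N <= n)%N.
Proof.
  move=> R n1. rewrite leqNgt. apply/negP => nN.
  have H : forall M p, prime p -> (p %| n)%N -> (p < M)%N -> rough M n -> False.
  { elim=> [//|M IH] p pp pn pM /= /andP [R1 R2].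
    move: pM; rewrite ltnS leq_eqVlt => /orP [/eqP E|pM]; last exact: (IH p).
    by rewrite -E pp pn in R2. }
  apply: (H N (pdiv n)) => //; [exact: pdiv_prime|exact: pdiv_dvd|].
  apply: leq_ltn_trans nN. exact/pdiv_leq/ltnW.
Qed.

Lemma rough_1 N : rough N 1.
Proof. elim: N => [//|N /= ->] /=. case pN: (prime N) => //=. by rewrite dvdn1 (gtn_eqF (prime_gt1 pN)). Qed.

Lemma divnS_dvd d m : (0 < d)%N -> (m.+1 %/ d = (if (d %| m.+1) then (m %/ d).+1 else m %/ d))%N.
Proof. move=> d0. rewrite divnS //. by case: ifP. Qed.

Lemma dvdn_divnK d m : (0 < d)%N -> (d %| m.+1)%N -> (d * (m %/ d).+1 = m.+1)%N.
Proof. move=> d0 dm. have := divnS m d0. rewrite dm add1n => <-. by rewrite mulnC divnK. Qed.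

Lemma leq_div_self m d : (0 < d)%N -> (m <= d * (m %/ d).+1)%N.
Proof. move=> d0. rewrite mulnC. apply: ltnW. by rewrite ltn_ceil. Qed.

End RoughNumbers.

Lemma csum_multiples (f : nat -> C) d K : (0 < d)%nat ->
  csum (fun k => if div.dvdn d (S k) then f (S k) else RtoC 0) K = csum (fun m => f (d * S m)%nat) (div.divn K d).
Proof.
  intros Hd. assert (Hd' : is_true (ssrnat.leq 1 d)) by (now apply (ssrbool.introT ssrnat.leP)).
  induction K as [|K IH]; [rewrite div.div0n; reflexivity|].
  cbn [csum]. rewrite IH, divnS_dvd by auto.
  destruct (div.dvdn d (S K)) eqn:E.
  - cbn [csum]. f_equal. f_equal. symmetry. now apply dvdn_divnK.
  - ring.
Qed.

Definition ctotally_mult (a : nat -> C) : Prop :=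
  a 1%nat = RtoC 1 /\ forall m n, (0 < m)%nat -> (0 < n)%nat -> a (m * n)%nat = (a m * a n)%C.

(** Euler's sieve: subtracting [a N] times the series removes the multiples of the prime [N]. It is
    carried out on partial sums, the one up to [K] against the one up to [K / N], so mere
    convergence is enough. *)
Lemma sieve (a : nat -> C) (L : C) (N : nat) : ctotally_mult a ->
  Ccv (csum (fun k => a (S k))) L ->
  Ccv (csum (fun k => if rough N (S k) then a (S k) else RtoC 0)) (L * pprod a N)%C.
Proof.
  intros [_ Ha] HL. induction N as [|N IH].
  - simpl. rewrite Cmult_1_r. exact HL.
  - cbn [pprod rough]. destruct (prime.prime N) eqn:pN.
    2:{ simpl. rewrite Cmult_1_r. apply Ccv_ext with (2 := IH). intros K. apply csum_ext. intros k _.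
        now rewrite Bool.andb_true_r. }
    set (b := fun n => if rough N n then a n else RtoC 0).
    assert (N0 : (0 < N)%nat).
    { apply INR_prime_ge_2 in pN. apply INR_lt. simpl. lra. }
    assert (E : forall K, csum (fun k => if (rough N (S k) && negb (true && div.dvdn N (S k)))%bool then a (S k) else RtoC 0) K
      = (csum (fun k => b (S k)) K - a N * csum (fun k => b (S k)) (div.divn K N))%C).
    { intros K.
      assert (E1 : csum (fun m => b (N * S m)%nat) (div.divn K N) = (a N * csum (fun k => b (S k)) (div.divn K N))%C).
      { rewrite <- csum_scal. apply csum_ext. intros m _. unfold b.
        assert (RM : rough N (N * S m)%nat = rough N (S m))
          by exact (rough_mul N N (S m) pN (ssrnat.leqnn N)).
        rewrite RM.
        destruct (rough N (S m)); [|ring]. apply Ha; lia. }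
      rewrite <- E1, <- csum_multiples by auto.
      unfold Cminus. replace (- csum (fun k => if div.dvdn N (S k) then b (S k) else RtoC 0) K)%C with
        ((- (1)) * csum (fun k => if div.dvdn N (S k) then b (S k) else RtoC 0) K)%C by ring.
      rewrite <- csum_scal, <- csum_plus. apply csum_ext. intros k _. unfold b.
      destruct (rough N (S k)), (div.dvdn N (S k)); simpl; ring. }
    eapply Ccv_ext; [intros K; symmetry; apply E|].
    replace (L * (pprod a N * (1 - a N)))%C with (L * pprod a N - a N * (L * pprod a N))%C by ring.
    apply Ccv_minus; [exact IH|]. apply Ccv_scal.
    (* From [K >= N * (K0 + 1)] the quotient [K / N] is at least [K0]. *)
    intros eps He. destruct (IH eps He) as [K0 HK]. exists (N * S K0)%nat. intros K HKK. apply HK.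
    assert (Q := leq_div_self K N ltac:(now apply (ssrbool.introT ssrnat.leP))).
    apply (ssrbool.elimT ssrnat.leP) in Q. change (ssrnat.muln N (S (div.divn K N))) with (N * S (div.divn K N))%nat in Q.
    nia.
Qed.

(** After sieving, only the term at 1 and terms beyond [N] survive, and the latter form part of an
    absolutely convergent tail. Stated as a limit of products, it also shows [L] to be nonzero. *)
Lemma euler_product (a : nat -> C) (L : C) (B : R) : ctotally_mult a ->
  (forall N, rsum (fun k => Cmod (a (S k))) N <= B) ->
  Ccv (csum (fun k => a (S k))) L ->
  Ccv (fun N => L * pprod a N)%C (RtoC 1).
Proof.
  intros Ha HB HL. set (A := fun k => Cmod (a (S k))) in *.
  assert (A0 : forall k, 0 <= A k) by (intros; apply Cmod_ge_0).
  destruct (ex_finite_lim_seq_incr (rsum A) B) as [l Hl]; auto.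
  { intros n. simpl. specialize (A0 n). lra. }
  assert (Hle : forall n, rsum A n <= l).
  { intros n. apply (is_lim_seq_incr_compare (rsum A) l Hl). intros m. simpl. specialize (A0 m). lra. }
  intros eps He. apply is_lim_seq_spec in Hl. destruct (Hl (mkposreal (eps / 2) ltac:(lra))) as [N0 HN0].
  exists (S (S N0)). intros N HN.
  apply Rle_lt_trans with (eps / 2); [|lra].
  apply Ccv_le_mod with (fun K => csum (fun k => if rough N (S k) then a (S k) else RtoC 0) (S K) - 1)%C.
  { apply Ccv_minus; [|apply Ccv_const].
    apply (Ccv_subseq (csum (fun k => if rough N (S k) then a (S k) else RtoC 0)) _ S); [lia|].
    now apply sieve. }
  intros K. replace (S K) with (1 + K)%nat by lia. rewrite csum_add. simpl (csum _ 1).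
  rewrite (rough_1 N : rough N 1 = true).
  destruct Ha as [Ha1 _]. rewrite Ha1.
  replace (0 + 1 + _ - 1)%C with (csum (fun k => if rough N (S (1 + k)) then a (S (1 + k)) else RtoC 0) K) by ring.
  eapply Rle_trans; [apply csum_mod|].
  apply Rle_trans with (rsum (fun k => if Nat.leb N0 k then A (S k) else 0) K).
  - apply rsum_le. intros k _. destruct (rough N (S (1 + k))) eqn:R.
    + apply rough_ge in R; [|reflexivity]. apply (ssrbool.elimT ssrnat.leP) in R.
      assert (L1 : Nat.leb N0 k = true) by (apply Nat.leb_le; lia). rewrite L1. unfold A. simpl. lra.
    + rewrite Cmod_0. destruct (Nat.leb N0 k); [apply A0|lra].
  - assert (T : forall K, rsum (fun k => if Nat.leb N0 k then A (S k) else 0) K <= rsum A (S K + N0) - rsum A (S N0)).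
    { clear K. assert (Mo : forall m n, (m <= n)%nat -> rsum A m <= rsum A n).
      { induction 1; [lra|]. simpl. specialize (A0 m0). lra. }
      assert (T' : forall K, (K <= N0)%nat -> rsum (fun k => if Nat.leb N0 k then A (S k) else 0) K = 0).
      { induction K; intros H; simpl; auto. rewrite IHK by lia.
        assert (L1 : Nat.leb N0 K = false) by (apply Nat.leb_gt; lia). rewrite L1. ring. }
      assert (T2 : forall j, rsum (fun k => if Nat.leb N0 k then A (S k) else 0) (N0 + j) = rsum A (S (N0 + j)) - rsum A (S N0)).
      { induction j.
        - rewrite !Nat.add_0_r, T' by lia. ring.
        - rewrite Nat.add_succ_r. cbn [rsum] in *. rewrite IHj.
          assert (L1 : Nat.leb N0 (N0 + j) = true) by (apply Nat.leb_le; lia). rewrite L1. ring. }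
      intros K. destruct (Nat.le_gt_cases K N0).
      - rewrite T' by auto. specialize (Mo (S N0) (S K + N0)%nat ltac:(lia)). lra.
      - replace K with (N0 + (K - N0))%nat at 1 by lia. rewrite T2.
        apply Rplus_le_compat_r. apply Mo. lia. }
    eapply Rle_trans; [apply T|]. specialize (Hle (S K + N0)%nat).
    specialize (HN0 (S N0) ltac:(lia)).
    change (Rabs (rsum A (S N0) - l) < eps / 2) in HN0. apply Rabs_lt_between in HN0. lra.
Qed.

(** [(s - 1) n^(-s)] differs from [n^(1-s) - (n+1)^(1-s)] by at most [2 |s - 1| |s| n^(-2)], and the
    latter telescopes. The bound stays finite as [Re s] tends to 1 away from the pole, as the 3-4-1
    argument requires. *)
Lemma zeta_partial_bound s N : 1 < Re s -> s <> RtoC 1 ->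
  Cmod (csum (dterm (fun _ => RtoC 1) 0 s) N) <= 4 * Cmod s + 2 / Cmod (s - 1).
Proof.
  intros Hs H1.
  assert (S1 : (s - 1)%C <> RtoC 0) by (intros E; apply H1; now apply Ceq_minus).
  assert (P1 := proj1 (Cmod_gt_0 _) S1). assert (s0 := Cmod_ge_0 s).
  set (th := fun u => Cexp ((1 - s) * RtoC u)).
  assert (Step : forall k, Cmod ((s - 1) * dterm (fun _ => RtoC 1) 0 s k - (th (ln (INR (S k))) - th (ln (INR (S (S k))))))
    <= 2 * Cmod (s - 1) * Cmod s * exp (- (1 + 1) * ln (INR (S k)))).
  { intros k. set (n := INR (S k)). set (u := ln n). set (v := ln (INR (S (S k)))).
    assert (Hn : 1 <= n) by (apply (le_INR 1); lia).
    assert (En : INR (S (S k)) = n + 1) by (unfold n; now rewrite (S_INR (S k))).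
    assert (u0 : 0 <= u) by (unfold u; rewrite <- ln_1; apply ln_le; lra).
    assert (Hv : u <= v) by (unfold u, v; apply ln_le; rewrite ?En; lra).
    assert (Hvu : v - u <= / n).
    { unfold u, v. rewrite En. apply ln_succ_bounds. lra. }
    set (p := phi 0 u s).
    (* Chosen so that its increment from [u] to [v] is exactly the error to be bounded, because
       [exp v - exp u = 1]. *)
    set (F := fun w : C => ((s - 1) * p * Cexp w + Cexp ((1 - s) * w))%C).
    set (F1 := fun w : C => ((s - 1) * Cexp w * (p - Cexp (- s * w)))%C).
    assert (FD : forall w, is_complex_derive F w (F1 w)).
    { intros w. unfold F, F1. eapply cd_eq.
      - apply cd_plus; [apply cd_mult; [apply cd_const|apply cd_Cexp]|].
        apply (cd_comp Cexp (fun w => (1 - s) * w)%C w); [|apply cd_Cexp].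
        apply cd_mult; [apply cd_const|apply cd_id].
      - cbv beta. replace ((1 - s) * w)%C with (w + - s * w)%C by ring. rewrite Cexp_plus. ring. }
    assert (EF : (F (RtoC v) - F (RtoC u) = (s - 1) * dterm (fun _ => RtoC 1) 0 s k - (th u - th v))%C).
    { unfold F, th, dterm. fold n. fold u. fold p. rewrite !Cexp_R.
      unfold u at 1, v at 1. rewrite En, !exp_ln by lra. rewrite RtoC_plus. ring. }
    rewrite <- EF.
    apply Rle_trans with (2 * Cmod (s - 1) * Cmod s * exp (- (1 + 1) * u) * n * Cmod (RtoC v - RtoC u)).
    - apply mean_value_ineq with F1. intros t Ht. split; [apply FD|].
      replace (RtoC u + RtoC t * (RtoC v - RtoC u))%C with (RtoC (u + t * (v - u)))
        by (rewrite RtoC_plus, RtoC_mult, RtoC_minus; ring).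
      set (x := u + t * (v - u)). assert (Hx : u <= x <= v) by (unfold x; nra).
      unfold F1. rewrite !Cmod_mult, Cmod_Cexp, re_RtoC.
      assert (D := phi_diff 0 u x s ltac:(lra) ltac:(lra)).
      assert (Ep : Cmod (p - Cexp (- s * RtoC x)) = Cmod (phi 0 x s - phi 0 u s)).
      { rewrite Cmod_minus_sym. f_equal. unfold p, phi. simpl. ring. }
      rewrite Ep. simpl (INR 0) in D. rewrite pow_O, Rplus_0_l, Rmult_1_r in D.
      assert (Ex : exp x <= 2 * n).
      { apply Rle_trans with (exp v); [apply exp_le; lra|]. unfold v. rewrite exp_ln, En; lra. }
      assert (E1 : exp (- (Re s * u)) <= exp (- u)) by (apply exp_le; nra).
      assert (In : exp (- u) = / n) by (unfold u; rewrite exp_Ropp, exp_ln; lra).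
      assert (I0 : 0 < / n) by (apply Rinv_0_lt_compat; lra).
      assert (E2 : exp (- (1 + 1) * u) = / n * / n).
      { replace (- (1 + 1) * u) with (- u + - u) by ring. now rewrite exp_plus, In. }
      rewrite E2.
      assert (D2 : Cmod (phi 0 x s - phi 0 u s) <= Cmod s * / n * / n).
      { eapply Rle_trans; [exact D|]. rewrite <- In at 1.
        apply Rmult_le_compat; try lra.
        - apply Rmult_le_pos; auto. left; apply exp_pos.
        - apply Rmult_le_compat_l; auto. }
      replace (2 * Cmod (s - 1) * Cmod s * (/ n * / n) * n) with (Cmod (s - 1) * (2 * n) * (Cmod s * / n * / n)) by ring.
      apply Rmult_le_compat; auto using Cmod_ge_0.
      + apply Rmult_le_pos; [lra|left; apply exp_pos].
      + apply Rmult_le_compat_l; lra.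
    - rewrite <- RtoC_minus, Cmod_R, Rabs_pos_eq by lra.
      replace (2 * Cmod (s - 1) * Cmod s * exp (- (1 + 1) * u)) with
        (2 * Cmod (s - 1) * Cmod s * exp (- (1 + 1) * u) * (n * / n)) at 2 by (field; lra).
      rewrite <- !Rmult_assoc. apply Rmult_le_compat_l; auto.
      repeat apply Rmult_le_pos; try lra. left; apply exp_pos. }
  assert (Tele : Cmod ((s - 1) * csum (dterm (fun _ => RtoC 1) 0 s) N - (1 - th (ln (INR (S N))))) <=
     2 * Cmod (s - 1) * Cmod s * 2).
  { assert (E : ((s - 1) * csum (dterm (fun _ => RtoC 1) 0 s) N - (1 - th (ln (INR (S N)))))%C =
      csum (fun k => (s - 1) * dterm (fun _ => RtoC 1) 0 s k - (th (ln (INR (S k))) - th (ln (INR (S (S k))))))%C N).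
    { induction N as [|N IH].
      - unfold th. cbn [csum]. change (INR 1) with 1. rewrite ln_1, (Cmult_0_r (1 - s)), Cexp_0. ring.
      - cbn [csum]. rewrite <- IH. ring. }
    rewrite E. eapply Rle_trans; [apply csum_mod|].
    eapply Rle_trans; [apply rsum_le; intros k _; apply Step|].
    rewrite (rsum_scal (2 * Cmod (s - 1) * Cmod s) (fun k => exp (- (1 + 1) * ln (INR (S k))))).
    assert (Z := zeta_partial_le 1 N Rlt_0_1). rewrite Rinv_1 in Z.
    apply Rmult_le_compat_l; [|lra]. repeat apply Rmult_le_pos; lra. }
  assert (Th : Cmod (1 - th (ln (INR (S N)))) <= 2).
  { eapply Rle_trans; [apply Cmod_minus_le|]. rewrite Cmod_1. unfold th. rewrite Cmod_Cexp, re_scal_r.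
    assert (L := ln_INR_S_ge_0 N). assert (exp (Re (1 - s) * ln (INR (S N))) <= 1); [|lra].
    apply Rle_trans with (exp 0); [|rewrite exp_0; lra]. apply exp_le.
    unfold Cminus. rewrite re_plus, re_opp, re_RtoC. nra. }
  assert (F : Cmod (s - 1) * Cmod (csum (dterm (fun _ => RtoC 1) 0 s) N) <= 4 * Cmod (s - 1) * Cmod s + 2).
  { rewrite <- Cmod_mult.
    assert (T := Cmod_triangle' ((s - 1) * csum (dterm (fun _ => RtoC 1) 0 s) N) (1 - th (ln (INR (S N))))). lra. }
  apply Rmult_le_reg_l with (Cmod (s - 1)); auto.
  replace (Cmod (s - 1) * (4 * Cmod s + 2 / Cmod (s - 1))) with (4 * Cmod (s - 1) * Cmod s + 2) by (field; lra).
  exact F.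
Qed.

(** * Non-vanishing on the line Re s = 1 *)

(** The terms of [dterm c 0 s] indexed by [n] itself, so that multiplicativity can be expressed. *)
Definition dcoef (c : nat -> C) (s : C) (n : nat) : C := (c n * phi 0 (ln (INR n)) s)%C.

Lemma phi0_0 s : phi 0 0 s = RtoC 1.
Proof. unfold phi. simpl. rewrite Cmult_0_r, Cexp_0. ring. Qed.

Lemma phi0_plus u v s : phi 0 (u + v) s = (phi 0 u s * phi 0 v s)%C.
Proof.
  unfold phi. simpl. replace (- s * RtoC (u + v))%C with (- s * RtoC u + - s * RtoC v)%C
    by (rewrite RtoC_plus; ring).
  rewrite Cexp_plus. ring.
Qed.

Lemma phi0_arg u s w : phi 0 u (s + w) = (phi 0 u s * phi 0 u w)%C.
Proof.
  unfold phi. simpl. replace (- (s + w) * RtoC u)%C with (- s * RtoC u + - w * RtoC u)%C by ring.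
  rewrite Cexp_plus. ring.
Qed.

Lemma dcoef_mult c s : ctotally_mult c -> ctotally_mult (dcoef c s).
Proof.
  intros [H1 Hm]. split.
  - unfold dcoef. rewrite H1. simpl. rewrite ln_1, phi0_0. ring.
  - intros m n Hm0 Hn0. unfold dcoef. rewrite Hm, mult_INR, ln_mult, phi0_plus by (auto; now apply lt_0_INR). ring.
Qed.

Lemma dcoef_le c s n : (forall n, Cmod (c n) <= 1) -> Cmod (dcoef c s n) <= exp (- Re s * ln (INR n)).
Proof.
  intros Hc. unfold dcoef. rewrite Cmod_mult, Cmod_phi0. specialize (Hc n).
  assert (E := exp_pos (- Re s * ln (INR n))). nra.
Qed.

Lemma euler_dirichlet c s L : ctotally_mult c -> (forall n, Cmod (c n) <= 1) -> 1 < Re s ->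
  Ccv (csum (dterm c 0 s)) L -> Ccv (fun N => L * pprod (dcoef c s) N)%C (RtoC 1).
Proof.
  intros Hm Hc Hs HL. apply euler_product with (1 + / (Re s - 1)); auto.
  - now apply dcoef_mult.
  - intros N. eapply Rle_trans; [|apply (zeta_partial_le (Re s - 1) N); lra].
    apply rsum_le. intros k _. replace (- (1 + (Re s - 1))) with (- Re s) by ring. now apply dcoef_le.
Qed.

(** The square of the modulus is at most [1 - 2 r Re z + r^2], and [1 + h <= exp h]. *)
Lemma one_minus_le (r : R) (z : C) : Cmod z <= 1 ->
  Cmod (1 - RtoC r * z) <= exp (- r * Re z + r ^ 2 / 2).
Proof.
  intros Hz. apply Rsqr_incr_0; [|apply Cmod_ge_0|left; apply exp_pos].
  rewrite !Rsqr_pow2, Cmod_sqr.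
  replace (exp (- r * Re z + r ^ 2 / 2) ^ 2) with (exp (- 2 * r * Re z + r ^ 2)).
  2:{ transitivity (exp (- r * Re z + r ^ 2 / 2) * exp (- r * Re z + r ^ 2 / 2)); [rewrite <- exp_plus; f_equal; field|ring]. }
  eapply Rle_trans; [|apply exp_ineq1_le].
  unfold Cminus. rewrite re_plus, re_opp, im_plus, im_opp, re_scal_l, im_scal_l, re_RtoC, im_RtoC.
  assert (H : Cmod z ^ 2 <= 1) by (assert (P := Cmod_ge_0 z); nra).
  rewrite Cmod_sqr in H.
  assert (0 <= r ^ 2) by apply pow2_ge_0. nra.
Qed.

(** With [z = x + i y] the linear part of the exponent is [- r] times [3 + 4 x + x^2 - y^2 = 2 (1 +
    x)^2 + (1 - x^2 - y^2)], which is nonnegative on the whole unit disc; thus character values 0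
    are included. The eight factors contribute [r^2 / 2] each. *)
Lemma three_four_one (r : R) (z : C) : 0 <= r -> Cmod z <= 1 ->
  Cmod (1 - RtoC r) ^ 3 * Cmod (1 - RtoC r * z) ^ 4 * Cmod (1 - RtoC r * (z * z)) <= exp (4 * r ^ 2).
Proof.
  intros Hr Hz.
  assert (A1 := one_minus_le r 1 ltac:(rewrite Cmod_1; lra)). rewrite Cmult_1_r, re_RtoC in A1.
  assert (A2 := one_minus_le r z Hz).
  assert (Z2 : Cmod (z * z) <= 1) by (rewrite Cmod_mult; assert (P := Cmod_ge_0 z); nra).
  assert (A3 := one_minus_le r (z * z) Z2). rewrite Re_sqr in A3.
  assert (H : Cmod z ^ 2 <= 1) by (assert (P := Cmod_ge_0 z); nra). rewrite Cmod_sqr in H.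
  set (x := Re z) in *. set (y := Im z) in *.
  apply Rle_trans with (exp (- r * 1 + r ^ 2 / 2) ^ 3 * exp (- r * x + r ^ 2 / 2) ^ 4 * exp (- r * (x * x - y * y) + r ^ 2 / 2)).
  - apply Rmult_le_compat; auto using Cmod_ge_0.
    + apply Rmult_le_pos; apply pow_le, Cmod_ge_0.
    + apply Rmult_le_compat; try (apply pow_le, Cmod_ge_0); apply pow_incr; split; auto using Cmod_ge_0.
  - simpl pow. rewrite !Rmult_1_r, <- !exp_plus. apply exp_le.
    assert (0 <= r * ((1 + x) * (1 + x))) by (apply Rmult_le_pos; [auto|apply Rle_0_sqr]).
    assert (0 <= r * (1 - x ^ 2 - y ^ 2)) by (apply Rmult_le_pos; lra).
    simpl in *. lra.
Qed.

Lemma Cmod_pprod_341 (a b d : nat -> C) (e : nat -> R) N :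
  (forall p, prime.prime p = true -> Cmod (1 - a p) ^ 3 * Cmod (1 - b p) ^ 4 * Cmod (1 - d p) <= exp (e p)) ->
  Cmod (pprod a N) ^ 3 * Cmod (pprod b N) ^ 4 * Cmod (pprod d N) <= exp (psum e N).
Proof.
  intros H. induction N as [|N IH].
  - simpl. rewrite Cmod_1, exp_0. lra.
  - cbn [pprod psum]. destruct (prime.prime N) eqn:E.
    + rewrite !Cmod_mult, exp_plus.
      replace ((Cmod (pprod a N) * Cmod (1 - a N)) ^ 3 * (Cmod (pprod b N) * Cmod (1 - b N)) ^ 4 * (Cmod (pprod d N) * Cmod (1 - d N)))
        with ((Cmod (pprod a N) ^ 3 * Cmod (pprod b N) ^ 4 * Cmod (pprod d N)) *
              (Cmod (1 - a N) ^ 3 * Cmod (1 - b N) ^ 4 * Cmod (1 - d N))) by ring.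
      apply Rmult_le_compat; auto; apply Rmult_le_pos; try apply Cmod_ge_0;
        apply Rmult_le_pos; apply pow_le, Cmod_ge_0.
    + rewrite !Cmult_1_r, Rplus_0_r. exact IH.
Qed.

Lemma Ccv_Cmod_ge (u : nat -> C) : Ccv u (RtoC 1) -> exists N, forall n, (N <= n)%nat -> 1 / 2 <= Cmod (u n).
Proof.
  intros H. destruct (H (1 / 2) ltac:(lra)) as [N HN]. exists N. intros n Hn. specialize (HN n Hn).
  assert (T := Cmod_triangle' (RtoC 1) (u n)). rewrite Cmod_1, Cmod_minus_sym in T. lra.
Qed.

(* The 3-4-1 argument.  The third factor stays bounded near [1 + 2 i t] because [c^2] minus its mean is
   again a mean-zero sequence, and the mean contributes a multiple of zeta. *)
Lemma nonvanishing_line (q : nat) (c : nat -> C) (M : C) (F : C -> C) (t : R) :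
  ctotally_mult c -> mean_zero q c ->
  (forall k, csum (fun r => c (S (q * k + r)) * c (S (q * k + r)))%C q = M) ->
  (forall s, 1 < Re s -> Ccv (csum (dterm c 0 s)) (F s)) ->
  (exists l, is_complex_derive F (1, t) l) -> t <> 0 -> F (1, t) <> RtoC 0.
Proof.
  intros Hm Hc HM HF [l Hl] Ht HF0.
  assert (Hc' := Hc). destruct Hc' as (Hq & Hc1 & _).
  assert (Q1 : 1 <= INR q) by (apply (le_INR 1); lia).
  destruct (cd_bound F (1, t) l Hl) as [d [Hd Kd]].
  set (K := Cmod l + 1) in *. assert (K1 : 1 <= K) by (unfold K; assert (P := Cmod_ge_0 l); lra).
  set (c2 := fun n => (c n * c n)%C).
  assert (Hc2 : forall n, Cmod (c2 n) <= 1).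
  { intros n. unfold c2. rewrite Cmod_mult. specialize (Hc1 n). assert (P := Cmod_ge_0 (c n)). nra. }
  assert (Hm2 : ctotally_mult c2).
  { destruct Hm as [A B]. split; unfold c2; [rewrite A; ring|]. intros m n Hm0 Hn0. rewrite B by auto. ring. }
  assert (q0 : RtoC (INR q) <> RtoC 0) by (intros E; apply RtoC_inj in E; lra).
  assert (n2 : RtoC 2 <> RtoC 0) by (intros E; apply RtoC_inj in E; lra).
  set (mu := (M / RtoC (INR q))%C).
  assert (Hmu : Cmod mu <= 1).
  { unfold mu. rewrite Cmod_div, Cmod_R, Rabs_pos_eq by (auto; lra). apply Rle_div_l; [lra|].
    rewrite <- (HM O). eapply Rle_trans; [apply csum_mod|].
    apply Rle_trans with (rsum (fun _ => 1 * 1) q).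
    - apply rsum_le. intros r _. rewrite Rmult_1_r. apply Hc2.
    - rewrite (rsum_scal 1 (fun _ => 1)). apply Rmult_le_compat_l; [lra|]. clear.
      induction q as [|n IH]; [simpl; lra|]. rewrite S_INR. cbn [rsum]. lra. }
  (* Halved to meet the bound by 1 in [mean_zero]. *)
  set (c' := fun n => (/ 2 * (c2 n - mu))%C).
  assert (Hc'mz : mean_zero q c').
  { split; [auto|]. split.
    - intros n. unfold c'. rewrite Cmod_mult, Cmod_inv, Cmod_R, Rabs_pos_eq by (auto; lra).
      assert (T := Cmod_minus_le (c2 n) mu). specialize (Hc2 n). lra.
    - intros k. unfold c'. rewrite (csum_scal (/ 2) (fun r => c2 (S (q * k + r)) - mu)%C).
      assert (E : csum (fun r => c2 (S (q * k + r)) - mu)%C q = (M - RtoC (INR q) * mu)%C).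
      { rewrite <- (HM k).
        assert (G : forall n, csum (fun r => c2 (S (q * k + r)) - mu)%C n =
          (csum (fun r => c (S (q * k + r)) * c (S (q * k + r)))%C n - RtoC (INR n) * mu)%C).
        { induction n as [|n IH]; [simpl; ring|]. rewrite S_INR, RtoC_plus. cbn [csum]. rewrite IH. unfold c2. ring. }
        apply G. }
      rewrite E. unfold mu. field. auto. }
  assert (AbsT : 0 < Rabs t) by (now apply Rabs_pos_lt).
  (* Twice the linear bound for [c'], plus the bound for zeta, with [|s| <= 2 + 2 |t|] and
     [|s - 1| >= 2 |t|]. *)
  set (B2 := 6 * INR q ^ 2 * (2 + 2 * Rabs t) + 4 * (2 + 2 * Rabs t) + 1 / Rabs t).
  assert (B20 : 0 < B2).
  { assert (0 < 1 / Rabs t) by (apply Rdiv_lt_0_compat; lra).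
    assert (0 <= 6 * INR q ^ 2 * (2 + 2 * Rabs t)) by (apply Rmult_le_pos; [assert (P := pow2_ge_0 (INR q)); lra|lra]).
    unfold B2. lra. }
  assert (HL2 : forall x L2, 1 < x < 2 -> Ccv (csum (dterm c2 0 (x, 2 * t))) L2 -> Cmod L2 <= B2).
  { intros x L2 Hx HL. set (s := (x, 2 * t) : C).
    assert (Hs : 1 < Re s) by (simpl; lra).
    assert (Cs : Cmod s <= 2 + 2 * Rabs t).
    { eapply Rle_trans; [apply Cmod_le_abs|]. unfold s, Re, Im; simpl. rewrite Rabs_mult, (Rabs_pos_eq 2), (Rabs_pos_eq x) by lra. lra. }
    assert (Cs1 : 2 * Rabs t <= Cmod (s - 1)).
    { eapply Rle_trans; [|apply Im_le_Cmod]. unfold s, Im; simpl.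
      replace (2 * t + - 0) with (2 * t) by ring. rewrite Rabs_mult, (Rabs_pos_eq 2); lra. }
    assert (Hs1 : s <> RtoC 1).
    { intros E. rewrite E in Cs1. replace (1 - 1)%C with (RtoC 0) in Cs1 by ring. rewrite Cmod_0 in Cs1. lra. }
    destruct (dseries_cv c' s (proj1 (proj2 Hc'mz)) Hs) as [L' HL'].
    assert (EL := dsum_eq_series q c' s L' Hc'mz Hs HL').
    assert (BL := dsum_linear_bound q c' s Hc'mz ltac:(lra)). rewrite EL in BL.
    assert (Z : Cmod (L2 - 2 * L') <= 4 * Cmod s + 2 / Cmod (s - 1)).
    { apply Ccv_le_mod with (fun N => csum (dterm c2 0 s) N - 2 * csum (dterm c' 0 s) N)%C.
      - apply Ccv_minus; auto. now apply Ccv_scal.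
      - intros N. replace (csum (dterm c2 0 s) N - 2 * csum (dterm c' 0 s) N)%C with (mu * csum (dterm (fun _ => RtoC 1) 0 s) N)%C.
        + rewrite Cmod_mult. assert (ZB := zeta_partial_bound s N Hs Hs1).
          assert (P := Cmod_ge_0 (csum (dterm (fun _ => RtoC 1) 0 s) N)). nra.
        + replace (csum (dterm c2 0 s) N - 2 * csum (dterm c' 0 s) N)%C with
            (csum (dterm c2 0 s) N + (- (2)) * csum (dterm c' 0 s) N)%C by ring.
          rewrite <- !csum_scal, <- csum_plus. apply csum_ext. intros n _. unfold dterm, c'. field; auto. }
    assert (I : 2 / Cmod (s - 1) <= 1 / Rabs t).
    { apply Rle_div_l; [lra|]. replace (1 / Rabs t * Cmod (s - 1)) with (Cmod (s - 1) / Rabs t) by (field; lra).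
      apply Rle_div_r; lra. }
    assert (T := Cmod_triangle (L2 - 2 * L') (2 * L')).
    replace (L2 - 2 * L' + 2 * L')%C with L2 in T by ring.
    rewrite (Cmod_mult (RtoC 2)), Cmod_R, Rabs_pos_eq in T by lra.
    assert (3 * INR q ^ 2 * Cmod s <= 3 * INR q ^ 2 * (2 + 2 * Rabs t)).
    { apply Rmult_le_compat_l; auto. assert (P := pow2_ge_0 (INR q)). lra. }
    unfold B2. lra. }
  (* Each of the [3 + 4 + 1] limits in the Euler products is at least [1 / 2] in modulus, and the
     sum of [4 / (p (p - 1))] is at most 16. *)
  set (kap := (1 / 2) ^ 8 * exp (- 16)).
  (* A zero at [(1, t)] gives [(x - 1)^4] against the growth [(2 / (x - 1))^3] of zeta; the
     remaining factor [x - 1] is contradictory for [x] close to 1. *)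
  assert (Main : forall x, 1 < x < 2 -> x - 1 < d -> kap <= 8 * K ^ 4 * B2 * (x - 1)).
  { intros x Hx Hxd.
    set (s1 := (x, 0) : C). set (s2 := (x, t) : C). set (s3 := (x, 2 * t) : C).
    assert (one_le : forall n : nat, Cmod ((fun _ : nat => RtoC 1) n) <= 1) by (intros; rewrite Cmod_1; lra).
    destruct (dseries_cv (fun _ => RtoC 1) s1 one_le ltac:(simpl; lra)) as [Z HZ].
    destruct (dseries_cv c2 s3 Hc2 ltac:(simpl; lra)) as [L2 HL].
    assert (BL2 := HL2 x L2 Hx HL).
    assert (HFs := HF s2 ltac:(simpl; lra)).
    assert (m1 : ctotally_mult (fun _ => RtoC 1)) by (split; [reflexivity|intros; ring]).
    destruct (Ccv_Cmod_ge _ (euler_dirichlet _ s1 Z m1 one_le ltac:(simpl; lra) HZ)) as [N1 E1].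
    destruct (Ccv_Cmod_ge _ (euler_dirichlet _ s2 _ Hm Hc1 ltac:(simpl; lra) HFs)) as [N2 E2].
    destruct (Ccv_Cmod_ge _ (euler_dirichlet _ s3 L2 Hm2 Hc2 ltac:(simpl; lra) HL)) as [N3 E3].
    set (N := (N1 + N2 + N3)%nat).
    specialize (E1 N ltac:(unfold N; lia)). specialize (E2 N ltac:(unfold N; lia)). specialize (E3 N ltac:(unfold N; lia)).
    rewrite Cmod_mult in E1, E2, E3.
    assert (PP := Cmod_pprod_341 (dcoef (fun _ => RtoC 1) s1) (dcoef c s2) (dcoef c2 s3) (fun p => 4 * / (INR p * (INR p - 1))) N).
    assert (PP1 : Cmod (pprod (dcoef (fun _ => RtoC 1) s1) N) ^ 3 * Cmod (pprod (dcoef c s2) N) ^ 4 * Cmod (pprod (dcoef c2 s3) N) <= exp 16).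
    { eapply Rle_trans; [apply PP|].
      - intros p Hp. assert (p2 := INR_prime_ge_2 p Hp). clear PP.
        set (u := ln (INR p)). set (r := exp (- x * u)). set (z := (c p * phi 0 u (0, t))%C).
        assert (ER : phi 0 u s1 = RtoC r).
        { unfold phi, r, s1. simpl (_ ^ 0). replace (- (x, 0) * RtoC u)%C with (RtoC (- x * u)).
          - rewrite Cexp_R. ring.
          - apply C_ext; unfold Re, Im; simpl; ring. }
        assert (Es2 : s2 = (s1 + (0, t))%C) by (unfold s1, s2; apply C_ext; unfold Re, Im; simpl; ring).
        assert (Es3 : s3 = (s1 + ((0, t) + (0, t)))%C) by (unfold s1, s3; apply C_ext; unfold Re, Im; simpl; ring).
        assert (Hz : Cmod z <= 1).
        { unfold z. rewrite Cmod_mult, Cmod_phi0. simpl. replace (- 0 * u) with 0 by ring. rewrite exp_0.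
          specialize (Hc1 p). lra. }
        assert (r0 : 0 < r) by apply exp_pos.
        eapply Rle_trans; [|eapply Rle_trans; [apply (three_four_one r z); [lra|exact Hz]|]].
        + right. unfold dcoef. fold u. rewrite Es2, Es3, !phi0_arg, ER. unfold z, c2.
          f_equal; [f_equal|]; [f_equal|f_equal|]; f_equal; ring.
        + apply exp_le. apply Rmult_le_compat_l; [lra|].
          assert (u0 : 0 < u) by now apply ln_prime_pos.
          assert (rp : r <= / INR p).
          { unfold r. replace (/ INR p) with (exp (- u)) by (unfold u; rewrite exp_Ropp, exp_ln; lra).
            apply exp_le. nra. }
          apply Rle_trans with (/ INR p * / INR p).
          * simpl. rewrite Rmult_1_r. apply Rmult_le_compat; lra.
          * rewrite <- Rinv_mult. apply Rinv_le_contravar; nra.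
      - apply exp_le. rewrite psum_scal. assert (S := psum_inv_square_le N). lra. }
    set (P1 := Cmod (pprod (dcoef (fun _ => RtoC 1) s1) N)) in *.
    set (P2 := Cmod (pprod (dcoef c s2) N)) in *. set (P3 := Cmod (pprod (dcoef c2 s3) N)) in *.
    assert (BZ : Cmod Z <= 2 / (x - 1)).
    { apply Ccv_le_mod with (csum (dterm (fun _ => RtoC 1) 0 s1)); auto. intros n.
      eapply Rle_trans; [apply csum_mod|]. apply Rle_trans with (1 + / (x - 1)).
      - eapply Rle_trans; [|apply (zeta_partial_le (x - 1) n); lra]. apply rsum_le. intros k _.
        unfold dterm. rewrite Cmod_mult, Cmod_1, Cmod_phi0. simpl (Re s1).
        replace (- (1 + (x - 1))) with (- x) by ring. lra.
      - apply Rle_div_r; [lra|]. rewrite Rmult_plus_distr_r, Rinv_l by lra. lra. }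
    assert (BF : Cmod (F s2) <= K * (x - 1)).
    { assert (Es : Cmod (s2 - (1, t)) = x - 1).
      { replace (s2 - (1, t))%C with (RtoC (x - 1)) by (unfold s2; apply C_ext; unfold Re, Im; simpl; ring).
        rewrite Cmod_R. apply Rabs_pos_eq; lra. }
      specialize (Kd s2). rewrite Es, HF0 in Kd. specialize (Kd Hxd).
      replace (F s2 - 0)%C with (F s2) in Kd by ring. exact Kd. }
    assert (z0 := Cmod_ge_0 Z). assert (f0 := Cmod_ge_0 (F s2)). assert (l0 := Cmod_ge_0 L2).
    assert (p1 : 0 <= P1) by apply Cmod_ge_0. assert (p2 : 0 <= P2) by apply Cmod_ge_0.
    assert (p3 : 0 <= P3) by apply Cmod_ge_0.
    assert (A : (1 / 2) ^ 8 <= (Cmod Z ^ 3 * Cmod (F s2) ^ 4 * Cmod L2) * exp 16).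
    { apply Rle_trans with ((Cmod Z * P1) ^ 3 * (Cmod (F s2) * P2) ^ 4 * (Cmod L2 * P3)).
      - replace ((1 / 2) ^ 8) with ((1 / 2) ^ 3 * (1 / 2) ^ 4 * (1 / 2)) by ring.
        apply Rmult_le_compat; try lra. apply Rmult_le_compat; try lra; apply pow_incr; lra.
      - replace ((Cmod Z * P1) ^ 3 * (Cmod (F s2) * P2) ^ 4 * (Cmod L2 * P3)) with
          ((Cmod Z ^ 3 * Cmod (F s2) ^ 4 * Cmod L2) * (P1 ^ 3 * P2 ^ 4 * P3)) by ring.
        apply Rmult_le_compat_l; auto. apply Rmult_le_pos; auto. apply Rmult_le_pos; apply pow_le; auto. }
    assert (A2 : Cmod Z ^ 3 * Cmod (F s2) ^ 4 * Cmod L2 <= (2 / (x - 1)) ^ 3 * (K * (x - 1)) ^ 4 * B2).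
    { apply Rmult_le_compat; auto.
      - apply Rmult_le_pos; apply pow_le; auto.
      - apply Rmult_le_compat; try (apply pow_le; auto); apply pow_incr; split; auto. }
    replace ((2 / (x - 1)) ^ 3 * (K * (x - 1)) ^ 4 * B2) with (8 * K ^ 4 * B2 * (x - 1)) in A2 by (field; lra).
    unfold kap. replace (exp (- 16)) with (/ exp 16) by (rewrite <- exp_Ropp; f_equal; lra).
    apply Rle_div_l; [apply exp_pos|].
    eapply Rle_trans; [exact A|]. apply Rmult_le_compat_r; auto. left; apply exp_pos. }
  assert (kap0 : 0 < kap).
  { unfold kap. apply Rmult_lt_0_compat; [apply pow_lt; lra|apply exp_pos]. }
  set (C0 := 8 * K ^ 4 * B2) in *.
  assert (C00 : 0 < C0). { unfold C0. apply Rmult_lt_0_compat; auto. assert (0 < K ^ 4) by (apply pow_lt; lra). lra. }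
  set (h := Rmin (Rmin (1 / 2) (d / 2)) (kap / (2 * C0))).
  assert (h0 : 0 < h).
  { unfold h. repeat apply Rmin_pos; try lra. apply Rdiv_lt_0_compat; lra. }
  assert (h1 : h <= 1 / 2) by (eapply Rle_trans; [apply Rmin_l|apply Rmin_l]).
  assert (h2 : h <= d / 2) by (eapply Rle_trans; [apply Rmin_l|apply Rmin_r]).
  assert (h3 : h <= kap / (2 * C0)) by apply Rmin_r.
  specialize (Main (1 + h) ltac:(lra) ltac:(lra)).
  replace (1 + h - 1) with h in Main by ring.
  apply Rle_div_r in h3; [|lra]. nra.
Qed.

(** * Dirichlet characters *)

Lemma dterm_npow_neg (chi : Z -> C) s k :
  (chi (Z.of_nat (S k)) * npow_neg (S k) s)%C = dterm (fun n => chi (Z.of_nat n)) 0 s k.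
Proof. unfold dterm, phi, npow_neg. simpl (_ ^ 0). ring. Qed.

Lemma csum_Permutation (f : nat -> C) (g : nat -> nat) (q : nat) :
  Permutation (map g (seq 0 q)) (seq 0 q) -> csum (fun r => f (g r)) q = csum f q.
Proof.
  set (lsum := fold_right (fun x acc => (f x + acc)%C) (RtoC 0)). intros HP.
  assert (E : forall l l', Permutation l l' -> lsum l = lsum l').
  { induction 1; simpl; auto; [now rewrite IHPermutation|ring|congruence]. }
  assert (App : forall l x, lsum (l ++ x :: nil)%list = (lsum l + f x)%C).
  { induction l; intros; simpl; [ring|]. rewrite IHl. ring. }
  assert (S1 : forall n, lsum (seq 0 n) = csum f n).
  { induction n; auto. rewrite seq_S, App, IHn. reflexivity. }
  assert (S2 : forall n, lsum (map g (seq 0 n)) = csum (fun r => f (g r)) n).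
  { induction n; auto. rewrite seq_S, map_app. simpl map. rewrite App, IHn. reflexivity. }
  rewrite <- S1, <- S2. now apply E.
Qed.

Lemma dirichlet_chi_1 q chi : dirichlet_character q chi -> chi 1%Z = RtoC 1.
Proof.
  intros [H0 Hm Hp Hs]. assert (N : chi 1%Z <> RtoC 0) by (apply Hs, Z.gcd_1_l).
  assert (E := Hm 1%Z 1%Z). simpl in E.
  transitivity (chi 1%Z * chi 1%Z * / chi 1%Z)%C; [field; auto|]. rewrite <- E. field. auto.
Qed.

Lemma dirichlet_chi_period q chi n k : dirichlet_character q chi -> chi (n + k * Z.of_nat q)%Z = chi n.
Proof.
  intros [_ _ Hp _].
  assert (P : forall m : nat, forall n, chi (n + Z.of_nat m * Z.of_nat q)%Z = chi n).
  { induction m as [|m IH]; intros x; [f_equal; lia|].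
    rewrite <- (IH x), <- (Hp (x + Z.of_nat m * Z.of_nat q)%Z). f_equal. lia. }
  destruct (Z_le_gt_dec 0 k).
  - rewrite <- (P (Z.to_nat k) n). f_equal. rewrite Z2Nat.id by lia. reflexivity.
  - rewrite <- (P (Z.to_nat (- k)) (n + k * Z.of_nat q)%Z). f_equal. rewrite Z2Nat.id by lia. lia.
Qed.

Lemma dirichlet_chi_mod q chi n : dirichlet_character q chi -> chi (n mod Z.of_nat q)%Z = chi n.
Proof.
  intros H. assert (q0 := modulus_pos _ _ H).
  rewrite <- (dirichlet_chi_period q chi (n mod Z.of_nat q) (n / Z.of_nat q) H). f_equal.
  rewrite (Z.div_mod n (Z.of_nat q)) at 3 by lia. lia.
Qed.

(** By periodicity [chi] is bounded, hence so are the powers of [chi n], which are the values at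
    [n ^ k]. *)
Lemma dirichlet_chi_le_1 q chi n : dirichlet_character q chi -> Cmod (chi n) <= 1.
Proof.
  intros H. assert (q0 := modulus_pos _ _ H).
  set (B := rsum (fun r => Cmod (chi (Z.of_nat r))) q).
  assert (HB : forall m, Cmod (chi m) <= B).
  { intros m. rewrite <- (dirichlet_chi_mod q chi m H).
    assert (Hr := Z.mod_pos_bound m (Z.of_nat q) ltac:(lia)).
    rewrite <- (Z2Nat.id (m mod Z.of_nat q)) by lia.
    set (r := Z.to_nat (m mod Z.of_nat q)). assert (Hr' : (r < q)%nat) by (unfold r; lia).
    unfold B. clearbody r. clear -Hr'. induction q as [|N IH]; [lia|]. simpl.
    assert (P : 0 <= rsum (fun r => Cmod (chi (Z.of_nat r))) N).
    { clear. induction N; simpl; [lra|]. assert (Q := Cmod_ge_0 (chi (Z.of_nat N))). lra. }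
    destruct (Nat.eq_dec r N) as [->|]; [lra|].
    assert (Q := Cmod_ge_0 (chi (Z.of_nat N))). specialize (IH ltac:(lia)). lra. }
  destruct (Rle_lt_dec (Cmod (chi n)) 1) as [|L]; auto. exfalso.
  assert (Pw : forall k : nat, (0 < k)%nat -> Cmod (chi (n ^ Z.of_nat k)%Z) = Cmod (chi n) ^ k).
  { induction k as [|k IH]; [lia|]. intros _. destruct k as [|k].
    - change (Z.of_nat 1) with 1%Z. rewrite Z.pow_1_r. simpl. ring.
    - replace (Z.of_nat (S (S k))) with (1 + Z.of_nat (S k))%Z by lia.
      rewrite Z.pow_add_r, Z.pow_1_r, (character_mult _ _ H), Cmod_mult, IH by lia. reflexivity. }
  destruct (Pow_x_infinity (Cmod (chi n)) ltac:(rewrite Rabs_pos_eq; [lra|apply Cmod_ge_0]) (B + 1)) as [N HN].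
  specialize (HN (S N) ltac:(lia)). rewrite <- Pw in HN by lia.
  rewrite Rabs_pos_eq in HN by apply Cmod_ge_0. specialize (HB (n ^ Z.of_nat (S N))%Z). lra.
Qed.

(** Otherwise [chi] would be induced by the constant character of modulus 1. *)
Lemma primitive_nonprincipal q chi : (1 < q)%nat -> primitive_character q chi ->
  exists a, Z.gcd a (Z.of_nat q) = 1%Z /\ chi a <> RtoC 1.
Proof.
  intros Hq [H HP]. apply NNPP. intros Hn.
  apply (HP 1%nat (fun _ => RtoC 1)); auto.
  - exists q. lia.
  - split; auto; try (intros; ring). intros n. simpl. rewrite Z.gcd_1_r. split; auto.
    intros _. apply C1_nz.
  - intros n Hg. apply NNPP. intros Hc. apply Hn. now exists n.
Qed.

(** Multiplication by [a] permutes the residues, so the sum is unchanged when multiplied by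
    [chi a <> 1]. *)
Lemma dirichlet_sum_zero q chi a : dirichlet_character q chi ->
  Z.gcd a (Z.of_nat q) = 1%Z -> chi a <> RtoC 1 -> csum (fun r => chi (Z.of_nat r)) q = RtoC 0.
Proof.
  intros H Hg Ha. assert (q0 := modulus_pos _ _ H).
  set (g := fun r => Z.to_nat ((a * Z.of_nat r) mod Z.of_nat q)).
  assert (Hgb : forall r, Z.of_nat (g r) = ((a * Z.of_nat r) mod Z.of_nat q)%Z).
  { intros r. unfold g. apply Z2Nat.id. apply Z.mod_pos_bound. lia. }
  assert (HP : Permutation (map g (seq 0 q)) (seq 0 q)).
  { apply NoDup_Permutation_bis.
    - apply NoDup_map_NoDup_ForallPairs; [|apply seq_NoDup].
      intros x y Hx Hy E. apply in_seq in Hx. apply in_seq in Hy.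
      assert (E' : ((a * Z.of_nat x) mod Z.of_nat q = (a * Z.of_nat y) mod Z.of_nat q)%Z) by (rewrite <- !Hgb; now f_equal).
      assert (D : (Z.of_nat q | a * (Z.of_nat x - Z.of_nat y))%Z).
      { apply Z.mod_divide; [lia|]. rewrite Z.mul_sub_distr_l, Zminus_mod, E', Z.sub_diag. apply Z.mod_0_l. lia. }
      apply Z.gauss in D; [|now rewrite Z.gcd_comm].
      destruct D as [k Hk]. assert (k = 0)%Z by nia. lia.
    - rewrite length_map. lia.
    - intros y Hy. apply in_map_iff in Hy. destruct Hy as [x [<- _]]. apply in_seq.
      assert (B := Z.mod_pos_bound (a * Z.of_nat x) (Z.of_nat q) ltac:(lia)). rewrite <- Hgb in B. lia. }
  assert (E := csum_Permutation (fun r => chi (Z.of_nat r)) g q HP).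
  assert (E2 : csum (fun r => chi (Z.of_nat (g r))) q = (chi a * csum (fun r => chi (Z.of_nat r)) q)%C).
  { rewrite <- csum_scal. apply csum_ext. intros r _. rewrite Hgb, (dirichlet_chi_mod q chi _ H). apply (character_mult _ _ H). }
  cbv beta in E. rewrite E2 in E. set (S := csum (fun r => chi (Z.of_nat r)) q) in *.
  assert (Z : ((chi a - 1) * S)%C = RtoC 0) by (replace ((chi a - 1) * S)%C with (chi a * S - S)%C by ring; rewrite E; ring).
  apply NNPP. intros HS. apply (Cmult_neq_0 (chi a - 1) S); auto. now apply Cminus_eq_contra.
Qed.

Lemma csum_shift (f : nat -> C) q : csum (fun r => f (S r)) q = (csum f q - f O + f q)%C.
Proof. induction q; simpl; [ring|]. rewrite IHq. ring. Qed.

(** The function [h] allows the same statement to serve for [chi] and for its square. *)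
Lemma dirichlet_block q chi (h : C -> C) k : dirichlet_character q chi ->
  csum (fun r => h (chi (Z.of_nat (S (q * k + r))))) q = csum (fun r => h (chi (Z.of_nat r))) q.
Proof.
  intros H.
  transitivity (csum (fun r => h (chi (Z.of_nat (S r)))) q).
  - apply csum_ext. intros r _. f_equal. rewrite <- (dirichlet_chi_period q chi (Z.of_nat (S r)) (Z.of_nat k) H).
    f_equal. lia.
  - rewrite (csum_shift (fun r => h (chi (Z.of_nat r)))).
    assert (E : chi (Z.of_nat q) = chi (Z.of_nat 0)) by apply (character_periodic _ _ H 0%Z).
    rewrite E. ring.
Qed.

Lemma primitive_mean_zero q chi : (1 < q)%nat -> primitive_character q chi ->
  mean_zero q (fun n => chi (Z.of_nat n)).
Proof.
  intros Hq HP. destruct (primitive_nonprincipal q chi Hq HP) as [a [Hg Ha]]. destruct HP as [H _].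
  split; [lia|]. split.
  - intros n. now apply dirichlet_chi_le_1 with q.
  - intros k. rewrite (dirichlet_block q chi (fun z => z) k H). now apply dirichlet_sum_zero with a.
Qed.

Lemma primitive_not_principal q chi : (1 < q)%nat -> primitive_character q chi -> ~ principal chi.
Proof.
  intros Hq HP Hpr. destruct (primitive_nonprincipal q chi Hq HP) as [a [Hg Ha]].
  apply Ha, Hpr. destruct HP as [H _]. now apply (character_support _ _ H).
Qed.

(** Exhibits [dsum] as a continuation, so that the choice in [L_function] has the intended
    properties. *)
Lemma L_function_spec q chi : (1 < q)%nat -> primitive_character q chi ->
  is_L_function chi (L_function chi).
Proof.
  intros Hq HP. unfold L_function. apply epsilon_spec.
  assert (Hc := primitive_mean_zero q chi Hq HP).
  exists (dsum q (fun n => chi (Z.of_nat n)) 0). split.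
  - intros s Hs. unfold is_dirichlet_series. apply is_series_Ccv.
    destruct (dseries_cv (fun n => chi (Z.of_nat n)) s (proj1 (proj2 Hc)) Hs) as [l Hl].
    rewrite (dsum_eq_series q _ s l Hc Hs Hl).
    apply Ccv_ext with (2 := Hl). intros N. apply csum_ext. intros k _. symmetry. apply dterm_npow_neg.
  - intros s [Hs _]. eexists. now apply dsum_derive.
Qed.

Lemma L_function_series q chi s : (1 < q)%nat -> primitive_character q chi -> 1 < Re s ->
  Ccv (csum (dterm (fun n => chi (Z.of_nat n)) 0 s)) (L_function chi s).
Proof.
  intros Hq HP Hs. destruct (L_function_spec q chi Hq HP) as [H _]. specialize (H s Hs).
  unfold is_dirichlet_series in H. apply is_series_Ccv in H.
  apply Ccv_ext with (2 := H). intros N. apply csum_ext. intros k _. apply dterm_npow_neg.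
Qed.

Lemma L_function_eq_dsum q chi s : (1 < q)%nat -> primitive_character q chi -> 0 < Re s ->
  L_function chi s = dsum q (fun n => chi (Z.of_nat n)) 0 s.
Proof.
  intros Hq HP Hs. assert (Hc := primitive_mean_zero q chi Hq HP).
  assert (NP := primitive_not_principal q chi Hq HP).
  apply Ceq_minus.
  apply (holo_identity (fun s => L_function chi s - dsum q (fun n => chi (Z.of_nat n)) 0 s)%C); auto.
  - intros z Hz. destruct (L_function_spec q chi Hq HP) as [_ H].
    destruct (H z) as [l Hl]; [split; auto; intros; tauto|].
    assert (D := dsum_derive q _ 0 z Hc Hz). eexists.
    apply cd_ext with (fun s => L_function chi s + (- (1)) * dsum q (fun n => chi (Z.of_nat n)) 0 s)%C; [intros; ring|].
    apply cd_plus; [exact Hl|]. apply cd_mult; [apply cd_const|exact D].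
  - intros z Hz. rewrite (dsum_eq_series q _ z (L_function chi z) Hc Hz (L_function_series q chi z Hq HP Hz)). ring.
Qed.

Lemma L_function_holo2 q chi : (1 < q)%nat -> primitive_character q chi ->
  holo2 (fun z => 0 < Re z) (L_function chi).
Proof.
  intros Hq HP. assert (Hc := primitive_mean_zero q chi Hq HP).
  set (c := fun n => chi (Z.of_nat n)) in *.
  exists (dsum q c 1). intros z Hz. split.
  - apply cd_ext_loc with (dsum q c 0); [|now apply dsum_derive].
    exists (Re z). split; auto. intros w Hw. symmetry. apply L_function_eq_dsum; auto.
    assert (U := Rle_lt_trans _ _ _ (Re_le_Cmod _) Hw). unfold Cminus in U. rewrite re_plus, re_opp in U.
    apply Rabs_lt_between in U. lra.
  - eexists. now apply dsum_derive.
Qed.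

Lemma L_function_bound q chi s : (1 < q)%nat -> primitive_character q chi -> 1 / 2 <= Re s ->
  Cmod (L_function chi s) <= 3 * INR q ^ 2 * Cmod s.
Proof.
  intros Hq HP Hs. rewrite (L_function_eq_dsum q chi s Hq HP) by lra.
  apply dsum_linear_bound; auto. now apply primitive_mean_zero.
Qed.

Lemma character_ctotally_mult q chi : dirichlet_character q chi ->
  ctotally_mult (fun n => chi (Z.of_nat n)).
Proof.
  intros H. split; [now apply dirichlet_chi_1 with q|].
  intros m n _ _. rewrite Nat2Z.inj_mul. apply (character_mult _ _ H).
Qed.

Lemma pprod_zero_iff a N : pprod a N <> RtoC 0 <->
  forall p, prime.prime p = true -> (p < N)%nat -> (1 - a p)%C <> RtoC 0.
Proof.
  induction N as [|N [I1 I2]]; cbn [pprod].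
  - split; [intros; lia|]. intros _. apply C1_nz.
  - split.
    + intros H p Hp Hl. destruct (Nat.eq_dec p N) as [->|].
      * rewrite Hp in H. intros E. apply H. rewrite E. ring.
      * apply I1; auto; [|lia]. intros E. apply H. rewrite E. ring.
    + intros H. apply Cmult_neq_0; [apply I2; intros; apply H; auto|].
      destruct (prime.prime N) eqn:E; [apply H; auto|apply C1_nz].
Qed.

(** GRH to the left of the line [Re s = 1], the 3-4-1 argument on it, the Euler product to its
    right. *)
Lemma L_function_nonzero (hGRH : GRH) q chi s : (1 < q)%nat -> primitive_character q chi ->
  1 / 2 < Re s -> Im s <> 0 -> L_function chi s <> RtoC 0.
Proof.
  intros Hq HP Hs Ht. assert (Hc := primitive_mean_zero q chi Hq HP).
  assert (H := proj1 HP).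
  destruct (Rtotal_order (Re s) 1) as [L|[E|L]].
  - intros Z. specialize (hGRH q chi HP s ltac:(lra) Z). lra.
  - replace s with ((1, Im s) : C) by (apply C_ext; simpl; auto).
    apply (nonvanishing_line q (fun n => chi (Z.of_nat n)) (csum (fun r => chi (Z.of_nat r) * chi (Z.of_nat r))%C q)); auto.
    + now apply character_ctotally_mult with q.
    + intros k. apply (dirichlet_block q chi (fun z => z * z)%C k H).
    + intros z Hz. now apply L_function_series with q.
    + destruct (L_function_holo2 q chi Hq HP) as [f1 Hf]. exists (f1 (1, Im s)). apply Hf. simpl; lra.
  - intros Z. assert (Eu := euler_dirichlet _ s _ (character_ctotally_mult q chi H) (proj1 (proj2 Hc)) L (L_function_series q chi s Hq HP L)).
    destruct (Ccv_Cmod_ge _ Eu) as [N HN]. specialize (HN N (le_n N)).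
    rewrite Z, Cmult_0_l, Cmod_0 in HN. lra.
Qed.

(** * The main estimate *)

(** [T] is the product over the primes in [[N0, N)], obtained without division by a possibly
    vanishing product. *)
Lemma pprod_tail (a : nat -> C) N0 N : (N0 <= N)%nat ->
  exists T, pprod a N = (pprod a N0 * T)%C /\
    Cmod (T - 1) <= exp (psum (fun p => Cmod (a p)) N - psum (fun p => Cmod (a p)) N0) - 1.
Proof.
  induction 1 as [|N H [T [E B]]].
  - exists (RtoC 1). split; [ring|]. replace (1 - 1)%C with (RtoC 0) by ring.
    rewrite Cmod_0, Rminus_diag, exp_0. lra.
  - cbn [pprod psum]. destruct (prime.prime N).
    + exists (T * (1 - a N))%C. split; [rewrite E; ring|].
      set (x := psum (fun p => Cmod (a p)) N - psum (fun p => Cmod (a p)) N0) in *.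
      replace (psum (fun p => Cmod (a p)) N + Cmod (a N) - psum (fun p => Cmod (a p)) N0) with (x + Cmod (a N)) by (unfold x; ring).
      rewrite exp_plus. replace (T * (1 - a N) - 1)%C with ((T - 1) * (1 - a N) - a N)%C by ring.
      eapply Rle_trans; [apply Cmod_minus_le|]. rewrite Cmod_mult.
      assert (P := Cmod_ge_0 (a N)). assert (Q := Cmod_ge_0 (T - 1)).
      assert (L : Cmod (1 - a N) <= 1 + Cmod (a N)).
      { eapply Rle_trans; [apply Cmod_minus_le|]. rewrite Cmod_1. lra. }
      assert (Ex := exp_ineq1_le (Cmod (a N))).
      assert (Cmod (T - 1) * Cmod (1 - a N) <= (exp x - 1) * exp (Cmod (a N))).
      { apply Rmult_le_compat; auto using Cmod_ge_0. lra. }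
      lra.
    + exists T. rewrite Cmult_1_r, Rplus_0_r. auto.
Qed.

Lemma pprod_holo2 c N D : holo2 D (fun s => pprod (dcoef c s) N).
Proof.
  induction N as [|N IH]; cbn [pprod]; [apply holo2_const|].
  apply holo2_mult; auto. destruct (prime.prime N); [|apply holo2_const].
  apply holo2_minus; [apply holo2_const|]. apply holo2_mult; [apply holo2_const|].
  exists (phi 1 (ln (INR N))). intros z _. split; [apply phi_derive|eexists; apply phi_derive].
Qed.

Lemma pprod_nonzero c s N : (forall n, Cmod (c n) <= 1) -> 0 < Re s -> pprod (dcoef c s) N <> RtoC 0.
Proof.
  intros Hc Hs. apply pprod_zero_iff. intros p Hp _ E.
  assert (B := dcoef_le c s p Hc). assert (L := ln_prime_pos p Hp).
  assert (E' : dcoef c s p = RtoC 1) by (symmetry; now apply Ceq_minus).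
  rewrite E', Cmod_1 in B.
  assert (exp (- Re s * ln (INR p)) < exp 0) by (apply exp_increasing; nra).
  rewrite exp_0 in H. lra.
Qed.

Lemma psum_dcoef_le c s x a b : (forall n, Cmod (c n) <= 1) -> x <= Re s -> (a <= b)%nat ->
  psum (fun p => Cmod (dcoef c s p)) b - psum (fun p => Cmod (dcoef c s p)) a <=
  psum (fun p => Rpower (INR p) (- x)) b - psum (fun p => Rpower (INR p) (- x)) a.
Proof.
  intros Hc Hx Hab. apply psum_incr_le; auto. intros p Hp _.
  eapply Rle_trans; [now apply dcoef_le|]. unfold Rpower. apply exp_le.
  assert (L := ln_prime_pos p Hp). nra.
Qed.

Lemma ln_Cmod_pprod_le c s N : (forall n, Cmod (c n) <= 1) -> 0 < Re s ->
  ln (Cmod (pprod (dcoef c s) N)) <= psum (fun p => Cmod (dcoef c s p)) N.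
Proof.
  intros Hc Hs. induction N as [|N IH]; [simpl; rewrite Cmod_1, ln_1; lra|].
  assert (NZ := pprod_nonzero c s (S N) Hc Hs). cbn [pprod] in *. cbn [psum].
  assert (P0 := proj1 (Cmod_gt_0 _) (pprod_nonzero c s N Hc Hs)).
  destruct (prime.prime N).
  - assert (P1 : 0 < Cmod (1 - dcoef c s N)).
    { apply Cmod_gt_0. intros E. apply NZ. rewrite E. ring. }
    rewrite Cmod_mult, ln_mult by auto.
    assert (L : ln (Cmod (1 - dcoef c s N)) <= Cmod (dcoef c s N)); [|lra].
    assert (T := Cmod_minus_le 1 (dcoef c s N)). rewrite Cmod_1 in T.
    eapply Rle_trans; [apply ln_le; [auto|exact T]|]. apply ln_1p_le.
    assert (Q := Cmod_ge_0 (dcoef c s N)). lra.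
  - rewrite Cmult_1_r. lra.
Qed.

(** * Small logarithms of numbers near 1 *)

Lemma Rabs_atan_le x : Rabs (atan x) <= Rabs x.
Proof.
  destruct (MVT_gen atan 0 x (fun x => / (1 + x ^ 2))) as [z [_ E]].
  - intros y _. apply is_derive_Reals. apply derivable_pt_lim_atan.
  - intros y _. apply derivable_continuous_pt, derivable_pt_atan.
  - rewrite atan_0, !Rminus_0_r in E. rewrite E, Rabs_mult.
    assert (P := Rabs_pos x). assert (Q : 0 <= z ^ 2) by apply pow2_ge_0.
    assert (R1 : 0 < / (1 + z ^ 2) <= 1).
    { split; [apply Rinv_0_lt_compat; lra|]. rewrite <- Rinv_1. apply Rinv_le_contravar; lra. }
    rewrite Rabs_pos_eq by lra. nra.
Qed.

(** The principal logarithm; as [3 / 4 <= Re w], its real part and its argument are each at most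
    [2 * d]. *)
Lemma small_log (w : C) (d : R) : d <= 1 / 4 -> Cmod (w - 1) <= d ->
  exists l, Cexp l = w /\ Cmod l <= 4 * d.
Proof.
  intros Hd Hw. assert (d0 : 0 <= d) by (eapply Rle_trans; [apply Cmod_ge_0|exact Hw]).
  assert (R1 := Re_le_Cmod (w - 1)). assert (I1 := Im_le_Cmod (w - 1)).
  unfold Cminus in R1 at 1. unfold Cminus in I1 at 1.
  rewrite re_plus, re_opp, re_RtoC in R1. rewrite im_plus, im_opp, im_RtoC, Ropp_0, Rplus_0_r in I1.
  assert (R2 : Rabs (Re w + - (1)) <= d) by lra. apply Rabs_le_between in R2.
  assert (Rw : 3 / 4 <= Re w) by lra.
  exists (ln (Cmod w), atan (Im w / Re w)). split; [apply Cexp_surj; lra|].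
  eapply Rle_trans; [apply Cmod_le_abs|].
  change (Rabs (ln (Cmod w)) + Rabs (atan (Im w / Re w)) <= 4 * d).
  assert (A : Rabs (atan (Im w / Re w)) <= 2 * d).
  { eapply Rle_trans; [apply Rabs_atan_le|]. unfold Rdiv. rewrite Rabs_mult, (Rabs_pos_eq (/ Re w)).
    - apply Rle_trans with (d * 2); [|lra]. apply Rmult_le_compat; try apply Rabs_pos; try lra.
      + left; apply Rinv_0_lt_compat; lra.
      + apply Rle_trans with (/ (3 / 4)); [apply Rinv_le_contravar; lra|lra].
    - left; apply Rinv_0_lt_compat; lra. }
  assert (M1 := Cmod_triangle' w 1). rewrite Cmod_1 in M1.
  assert (M2 := Cmod_triangle' 1 w). rewrite Cmod_1, Cmod_minus_sym in M2.
  assert (B : Rabs (ln (Cmod w)) <= 2 * d).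
  { apply Rabs_le. split.
    - assert (H := ln_1p_le (/ Cmod w - 1)).
      assert (I : / Cmod w <= 1 + 2 * d).
      { rewrite <- (Rmult_1_l (/ Cmod w)). apply Rle_div_l; nra. }
      assert (I0 : 0 < / Cmod w) by (apply Rinv_0_lt_compat; lra).
      specialize (H ltac:(lra)). replace (1 + (/ Cmod w - 1)) with (/ Cmod w) in H by ring.
      rewrite ln_Rinv in H by lra. lra.
    - assert (H := ln_1p_le (Cmod w - 1) ltac:(lra)). replace (1 + (Cmod w - 1)) with (Cmod w) in H by ring. lra. }
  lra.
Qed.

(** The quadratic remainder [6 |l|^2] is at most [3/4 |l|] when [|l| <= 1/8], and is absorbed on the
    left. *)
Lemma small_of_Cexp (l : C) : Cmod l <= 1 / 8 -> Cmod l <= 4 * Cmod (Cexp l - 1).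
Proof.
  intros H. assert (B := Cexp_bound2 l ltac:(lra)).
  assert (T := Cmod_triangle' l (- (Cexp l - 1 - l))). rewrite Cmod_opp in T.
  replace (l - - (Cexp l - 1 - l))%C with (Cexp l - 1)%C in T by ring.
  assert (P := Cmod_ge_0 l). simpl in B. nra.
Qed.

(* A branch of log that is small at one point of a vertical half-line on which [exp f] stays
   near 1 stays small: [Cmod f] cannot cross 1/8. *)
Lemma log_branch_small (f : C -> C) (x y0 : R) (d : R) : d <= 1 / 64 ->
  (forall y, 0 < y -> ccont f (x, y) /\ Cmod (Cexp (f (x, y)) - 1) <= d) ->
  0 < y0 -> Cmod (f (x, y0)) < 1 / 8 ->
  forall y, 0 < y -> Cmod (f (x, y)) <= 4 * d.
Proof.
  intros Hd Hf Hy0 H0 y Hy.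
  assert (G : forall y, 0 < y -> Cmod (f (x, y)) <= 1 / 8 -> Cmod (f (x, y)) <= 4 * d).
  { intros z Hz L. apply small_of_Cexp in L. destruct (Hf z Hz). lra. }
  destruct (Rle_lt_dec (Cmod (f (x, y))) (1 / 8)) as [|L]; [now apply G|]. exfalso.
  (* Parametrizing by [y = exp u] extends the half-line to all reals, where the intermediate value
     theorem is applied. *)
  set (h := fun u => Cmod (f (x, exp u))).
  assert (Hc : continuity h).
  { intros u e He. destruct (proj1 (Hf (exp u) (exp_pos u)) e He) as [d1 [Hd1 K]].
    destruct (derivable_continuous_pt exp u (derivable_pt_exp u) d1 Hd1) as [d2 [Hd2 K2]].
    exists d2. split; auto. intros v Hv. specialize (K2 v Hv). simpl in K2. unfold R_dist in K2.
    specialize (K (x, exp v)). simpl. unfold R_dist, h.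
    assert (E : Cmod ((x, exp v) - (x, exp u)) < d1).
    { eapply Rle_lt_trans; [apply Cmod_le_abs|]. unfold Re, Im; simpl. rewrite Rplus_opp_r, Rabs_R0. unfold Rminus in K2. lra. }
    specialize (K E).
    assert (A := Cmod_triangle' (f (x, exp v)) (f (x, exp u))).
    assert (B := Cmod_triangle' (f (x, exp u)) (f (x, exp v))). rewrite Cmod_minus_sym in B.
    apply Rabs_lt_between. lra. }
  destruct (IVT_gen h (ln y0) (ln y) (1 / 8) Hc) as [u [_ Hu]].
  { unfold h. rewrite !exp_ln by auto. split.
    - eapply Rle_trans; [apply Rmin_l|]. lra.
    - eapply Rle_trans; [|apply Rmax_r]. lra. }
  assert (Q := G (exp u) (exp_pos u)). unfold h in Hu. rewrite Hu in Q. lra.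
Qed.


(** Call [LM] the product of L with the removed factors and [b] the tail bound. The remaining
    factors satisfy [|T - 1| <= 2 b] and [LM * T] tends to 1, so [|LM - 1| <= 2 b |LM|], and
    [b <= 1/8] allows [|LM|] to be absorbed. *)
Lemma euler_factor_near_one q chi K2 a M s : (1 < q)%nat -> primitive_character q chi ->
  0 < a -> 0 < K2 -> (0 < M)%nat ->
  (forall M N, (0 < M)%nat ->
    psum (fun p => Rpower (INR p) (- a - 1)) N - psum (fun p => Rpower (INR p) (- a - 1)) (2 ^ M)
    <= K2 * exp (- a * ln 2) ^ M / INR M) ->
  K2 * exp (- a * ln 2) ^ M / INR M <= 1 / 8 -> 1 + a <= Re s ->
  Cmod (L_function chi s * pprod (dcoef (fun n => chi (Z.of_nat n)) s) (2 ^ M) - 1)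
    <= 4 * (K2 * exp (- a * ln 2) ^ M / INR M).
Proof.
  intros Hq HP Ha HK2 HM Htail Hb Hs. set (c := fun n => chi (Z.of_nat n)).
  assert (Hc := proj1 (proj2 (primitive_mean_zero q chi Hq HP)) : forall n, Cmod (c n) <= 1).
  set (b := K2 * exp (- a * ln 2) ^ M / INR M) in *.
  assert (b0 : 0 < b).
  { unfold b. apply Rdiv_lt_0_compat; [|now apply lt_0_INR].
    apply Rmult_lt_0_compat; auto. apply pow_lt, exp_pos. }
  set (LM := (L_function chi s * pprod (dcoef c s) (2 ^ M))%C).
  assert (Eu := euler_dirichlet c s _ (character_ctotally_mult q chi (proj1 HP)) Hc ltac:(lra)
    (L_function_series q chi s Hq HP ltac:(lra))).
  assert (Near : Cmod (LM - 1) <= 2 * b * Cmod LM).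
  { apply le_epsilon. intros e He. destruct (Eu e He) as [N HN].
    set (N1 := max N (2 ^ M)). specialize (HN N1 (Nat.le_max_l _ _)).
    destruct (pprod_tail (dcoef c s) (2 ^ M) N1 (Nat.le_max_r _ _)) as [T [ET BT]].
    rewrite ET in HN. fold c in HN. rewrite Cmult_assoc in HN. fold LM in HN.
    assert (BT2 : Cmod (T - 1) <= 2 * b).
    { eapply Rle_trans; [exact BT|].
      assert (X : psum (fun p => Cmod (dcoef c s p)) N1 - psum (fun p => Cmod (dcoef c s p)) (2 ^ M) <= b).
      { eapply Rle_trans; [apply (psum_dcoef_le c s (1 + a)); auto; apply Nat.le_max_r|].
        replace (- (1 + a)) with (- a - 1) by ring. now apply Htail. }
      apply exp_le in X. assert (Y := exp_bound2 b ltac:(rewrite Rabs_pos_eq; lra)).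
      apply Rabs_le_between in Y. nra. }
    replace (LM - 1)%C with ((LM * T - 1) - LM * (T - 1))%C by ring.
    eapply Rle_trans; [apply Cmod_minus_le|]. rewrite Cmod_mult.
    assert (P := Cmod_ge_0 LM). nra. }
  assert (T := Cmod_triangle' LM 1). rewrite Cmod_1 in T.
  assert (P := Cmod_ge_0 LM). nra.
Qed.

(** With [x = 2^M], the condition [ln t * M <= x^a] puts the logarithmic growth of L below
    [x^a / M], and [M <= ln t] makes a strip of height [ln t] tall enough for the interpolation. *)
Lemma main_estimate (hGRH : GRH) q chi a : (1 < q)%nat -> primitive_character q chi ->
  0 < a < 1 / 2 ->
  exists K M0 t0, 0 <= K /\ forall s M, 1 <= Re s -> t0 <= Im s -> (M0 <= M)%nat ->
    INR M <= ln (Im s) -> ln (Im s) * INR M <= exp (a * ln 2) ^ M ->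
    exp (- (K / INR M)) <= Cmod (L_function chi s * pprod (dcoef (fun n => chi (Z.of_nat n)) s) (2 ^ M)).
Proof.
  intros Hq HP Ha. set (c := fun n => chi (Z.of_nat n)).
  assert (Hc := proj1 (proj2 (primitive_mean_zero q chi Hq HP)) : forall n, Cmod (c n) <= 1).
  destruct (psum_Rpower_le a ltac:(lra)) as [K1 [K10 HK1]].
  destruct (psum_Rpower_tail a ltac:(lra)) as [K2 [K20 HK2]].
  (* [2] pays for the growth of L, [K1] for the Euler factors, and [256 * K2] gives the ratio 16
     between the bounds [A] and [16 * b] asked by [interpolate_center]. *)
  set (K3 := 2 + K1 + 256 * K2). assert (K30 : 0 < K3) by (unfold K3; lra).
  set (C5 := Rabs (ln (K3 / (16 * K2)))). assert (C50 : 0 <= C5) by apply Rabs_pos.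
  (* Ensures [b <= 1 / 256], so that [4 * b] meets the limit [1 / 64] of [log_branch_small]. *)
  destruct (nfloor_ex (256 * K2) ltac:(lra)) as [M0 [_ HM0]]. rewrite <- S_INR in HM0.
  assert (Q1 : 1 <= INR q) by (apply (le_INR 1); lia).
  set (K := Rmax (8 * sqrt (16 * K2 * K3)) (8 * K2)).
  set (r := exp (a * ln 2)). assert (BL := ln2_bounds).
  assert (Hr : 1 < r). { unfold r. assert (H := exp_ineq1_le (a * ln 2)). nra. }
  assert (Hrinv : exp (- a * ln 2) = / r).
  { unfold r. rewrite <- exp_Ropp. f_equal. ring. }
  (* [exp (C5 + 2)] makes [ln t] large enough for the height of the strip, [4] gives
     [ln t <= t / 2], which keeps the strip in the upper half-plane, and [12 * INR q ^ 2] reduces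
     the linear bound on L to [t ^ 2]. *)
  exists K, (S M0), (Rmax (exp (C5 + 2)) (Rmax 4 (12 * INR q ^ 2))).
  split. { eapply Rle_trans; [|apply Rmax_r]. lra. }
  intros s M Hs Ht HM HMt HtM. set (t := Im s) in *.
  assert (t1 : exp (C5 + 2) <= t) by (eapply Rle_trans; [apply Rmax_l|exact Ht]).
  assert (t2 : 4 <= t) by (eapply Rle_trans; [apply Rmax_l|]; eapply Rle_trans; [apply Rmax_r|exact Ht]).
  assert (t3 : 12 * INR q ^ 2 <= t) by (eapply Rle_trans; [apply Rmax_r|]; eapply Rle_trans; [apply Rmax_r|exact Ht]).
  set (T := ln t).
  assert (HT : C5 + 2 <= T).
  { unfold T. rewrite <- (ln_exp (C5 + 2)). apply ln_le; auto. apply exp_pos. }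
  assert (HTt : T <= t / 2).
  { unfold T. replace t with (1 + (t / 4 - 1) + (3 * t / 4)) at 1 by field.
    replace (1 + (t / 4 - 1) + 3 * t / 4) with ((1 + (t / 4 - 1)) * 2 * 2) by field.
    rewrite !ln_mult by lra. assert (H := ln_1p_le (t / 4 - 1) ltac:(lra)). lra. }
  assert (HMp : (0 < M)%nat) by lia.
  assert (IM : 256 * K2 <= INR M) by (apply le_INR in HM; lra).
  assert (IM1 : 1 <= INR M) by (apply (le_INR 1); lia).
  assert (rM : 1 <= r ^ M) by (apply pow_R1_Rle; lra).
  set (b := K2 * exp (- a * ln 2) ^ M / INR M).
  assert (Eb : b = K2 * / (r ^ M) / INR M) by (unfold b; rewrite Hrinv, pow_inv; reflexivity).
  assert (rMi : 0 < / r ^ M <= 1).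
  { split; [apply Rinv_0_lt_compat; lra|]. rewrite <- Rinv_1. apply Rinv_le_contravar; lra. }
  assert (b0 : 0 < b). { rewrite Eb. apply Rdiv_lt_0_compat; [apply Rmult_lt_0_compat|]; lra. }
  assert (b1 : b <= 1 / 256). { rewrite Eb. apply Rle_div_l; nra. }
  assert (bM : b <= K2 / INR M).
  { rewrite Eb. unfold Rdiv. apply Rmult_le_compat_r; [left; apply Rinv_0_lt_compat; lra|]. nra. }
  assert (Right : forall z, 1 + a <= Re z ->
    Cmod (L_function chi z * pprod (dcoef c z) (2 ^ M) - 1) <= 4 * b).
  { intros z Hz. apply (euler_factor_near_one q chi K2 a M z); auto; try lra. unfold b in b1. lra. }
  (* To the right of [1 + a] the Euler product alone suffices. Otherwise [Re s] is bounded, and the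
     strip of half-width [a] ends on the right where the Euler product is under control. *)
  destruct (Rle_lt_dec (1 + a) (Re s)) as [Ls|Ls].
  { specialize (Right s Ls). assert (T1 := Cmod_triangle' 1 (L_function chi s * pprod (dcoef c s) (2 ^ M))).
    rewrite Cmod_1, Cmod_minus_sym in T1. fold c.
    apply Rle_trans with (1 - 4 * b); [|lra].
    apply Rle_trans with (exp (- (8 * b))).
    - apply exp_le. apply Ropp_le_contravar.
      assert (8 * K2 <= K) by apply Rmax_r. apply Rle_trans with (8 * (K2 / INR M)); [lra|].
      unfold Rdiv. rewrite <- Rmult_assoc. apply Rmult_le_compat_r; auto. left; apply Rinv_0_lt_compat; lra.
    - assert (Y := exp_bound2 (- (8 * b)) ltac:(rewrite Rabs_Ropp, Rabs_pos_eq; lra)).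
      apply Rabs_le_between in Y. nra. }
  set (LM := fun z => (L_function chi z * pprod (dcoef c z) (2 ^ M))%C).
  assert (LMh : holo2 (quadrant (1 / 2) 0) LM).
  { apply holo2_mult; [|apply pprod_holo2]. apply holo2_sub with (fun z => 0 < Re z).
    - intros z [Hz _]. lra.
    - now apply L_function_holo2 with q. }
  assert (LM0 : forall z, quadrant (1 / 2) 0 z -> LM z <> RtoC 0).
  { intros z [Z1 Z2]. apply Cmult_neq_0.
    - apply (L_function_nonzero hGRH q); auto. lra.
    - apply pprod_nonzero; auto. lra. }
  set (s1 := (Re s + a, t) : C).
  assert (Hs1 : quadrant (1 / 2) 0 s1) by (split; simpl; lra).
  (* The branch is fixed at the right edge at height [t], where [LM] is near 1, and stays small
     along the whole edge. *)
  destruct (small_log (LM s1) (4 * b)) as [w [Ew Bw]]; [lra|apply Right; simpl; lra|].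
  destruct (holo2_log (1 / 2) 0 LM LMh LM0 s1 w Hs1 Ew) as [f [Hf [Ef1 Ef]]].
  assert (Edge : forall y, 0 < y -> Cmod (f (Re s + a, y)) <= 4 * (4 * b)).
  { apply log_branch_small with t; try lra.
    - intros y Hy. assert (Qy : quadrant (1 / 2) 0 (Re s + a, y)) by (split; simpl; lra). split.
      + destruct Hf as [f1 Hf]. apply cd_cont with (f1 (Re s + a, y)). now apply Hf.
      + rewrite (Ef _ Qy). apply Right. simpl. lra.
    - fold s1. rewrite Ef1. lra. }
  set (A := K3 * r ^ M / INR M).
  assert (LA : ln t <= r ^ M / INR M) by (apply Rle_div_r; [lra|exact HtM]).
  assert (RectQ : forall z, in_rect (Re s - a) (Re s + a) (Im s - T) (Im s + T) z -> quadrant (1 / 2) 0 z).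
  { intros z [Z1 Z2]. fold t in Z2. split; lra. }
  assert (HA : forall z, in_rect (Re s - a) (Re s + a) (Im s - T) (Im s + T) z -> Re (f z) <= A).
  { intros z Hz. assert (Qz := RectQ z Hz). destruct Hz as [Z1 Z2]. fold t in Z2.
    rewrite <- (ln_exp (Re (f z))), <- Cmod_Cexp, (Ef z Qz). unfold LM.
    assert (N1 := LM0 z Qz).
    assert (P1 : 0 < Cmod (L_function chi z)).
    { apply Cmod_gt_0. apply (L_function_nonzero hGRH q); auto; lra. }
    assert (P2 : 0 < Cmod (pprod (dcoef c z) (2 ^ M))) by (apply Cmod_gt_0, pprod_nonzero; auto; lra).
    rewrite Cmod_mult, ln_mult by auto.
    assert (B1 : ln (Cmod (pprod (dcoef c z) (2 ^ M))) <= K1 * r ^ M / INR M).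
    { eapply Rle_trans; [apply ln_Cmod_pprod_le; auto; lra|].
      assert (B := psum_dcoef_le c z (1 - a) 0 (2 ^ M) Hc ltac:(lra) ltac:(lia)). simpl psum at 2 in B. simpl psum at 3 in B.
      rewrite !Rminus_0_r in B. eapply Rle_trans; [exact B|].
      replace (- (1 - a)) with (a - 1) by ring. now apply HK1. }
    assert (B2 : ln (Cmod (L_function chi z)) <= 2 * (r ^ M / INR M)).
    { apply Rle_trans with (2 * ln t); [|lra].
      replace (2 * ln t) with (ln t + ln t) by ring. rewrite <- ln_mult by lra.
      apply ln_le; auto. eapply Rle_trans; [apply (L_function_bound q); auto; lra|].
      assert (Cz : Cmod z <= 2 + 2 * t).
      { eapply Rle_trans; [apply Cmod_le_abs|]. rewrite !Rabs_pos_eq by lra. lra. }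
      assert (P := pow2_ge_0 (INR q)).
      apply Rle_trans with (3 * INR q ^ 2 * (4 * t)); [apply Rmult_le_compat_l; lra|].
      replace (3 * INR q ^ 2 * (4 * t)) with (12 * INR q ^ 2 * t) by ring.
      apply Rmult_le_compat_r; lra. }
    assert (X : 0 < r ^ M / INR M) by (apply Rdiv_lt_0_compat; lra).
    unfold A. replace (K3 * r ^ M / INR M) with (K3 * (r ^ M / INR M)) by (field; lra).
    replace (K1 * r ^ M / INR M) with (K1 * (r ^ M / INR M)) in B1 by (field; lra).
    assert ((2 + K1) * (r ^ M / INR M) <= K3 * (r ^ M / INR M)) by (apply Rmult_le_compat_r; unfold K3; lra).
    lra. }
  assert (Hint : Cmod (f s) <= 8 * sqrt (A * (16 * b))).
  { apply interpolate_center with a T; auto; try lra.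
    - replace (16 * (16 * b)) with (256 * b) by ring. rewrite Eb. unfold A, Rdiv.
      rewrite <- Rmult_assoc. apply Rmult_le_compat_r; [left; apply Rinv_0_lt_compat; lra|]. unfold K3. nra.
    (* The logarithm of the ratio is at most [C5 + 2 M a ln 2 <= C5 + M], hence at most
       [2 T - 2 <= T^2]. *)
    - assert (EAB : A / (16 * b) = K3 / (16 * K2) * (r ^ M * r ^ M)).
      { unfold A. rewrite Eb. field. repeat split; lra. }
      rewrite EAB, ln_mult, ln_mult, ln_pow by (try lra; try (apply Rdiv_lt_0_compat; lra); apply Rmult_lt_0_compat; lra).
      assert (Lr : ln r = a * ln 2) by (unfold r; apply ln_exp). rewrite Lr.
      assert (H1 := Rle_abs (ln (K3 / (16 * K2)))). fold C5 in H1.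
      assert (H2 : INR M * (a * ln 2) <= INR M * (1 / 2)) by (apply Rmult_le_compat_l; nra).
      fold T in HMt. simpl. nra.
    - apply holo2_sub with (quadrant (1 / 2) 0); auto.
    - intros z Hz Er. assert (Qz := RectQ z Hz). destruct Qz as [_ Q2].
      replace z with ((Re s + a, Im z) : C) by (apply C_ext; simpl; auto).
      specialize (Edge (Im z) Q2). lra. }
  assert (Esq : sqrt (A * (16 * b)) = sqrt (16 * K2 * K3) / INR M).
  { replace (A * (16 * b)) with (16 * K2 * K3 / (INR M * INR M)).
    - rewrite sqrt_div by nra. rewrite sqrt_square by lra. reflexivity.
    - unfold A. rewrite Eb. field. split; lra. }
  rewrite Esq in Hint.
  assert (Qs : quadrant (1 / 2) 0 s) by (split; [lra|fold t; lra]).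
  change (exp (- (K / INR M)) <= Cmod (LM s)). rewrite <- (Ef s Qs), Cmod_Cexp. apply exp_le.
  assert (R1 := Re_le_Cmod (f s)). assert (R2 : Rabs (Re (f s)) <= K / INR M).
  { eapply Rle_trans; [exact R1|]. eapply Rle_trans; [exact Hint|].
    unfold Rdiv. rewrite <- Rmult_assoc. apply Rmult_le_compat_r; [left; apply Rinv_0_lt_compat; lra|apply Rmax_l]. }
  apply Rabs_le_between in R2. lra.
Qed.

(** * The size of the Euler product *)

(** [prime_divisors] uses primality in [Z], the sums over primes the boolean test on natural
    numbers. *)
Lemma prime_iff_Zprime n : prime.prime n = true <-> Znumtheory.prime (Z.of_nat n).
Proof.
  rewrite <- prime_alt. split.
  - intros H. assert (H' := ssrbool.elimT prime.primeP H). destruct H' as [H1 H2].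
    apply (ssrbool.elimT ssrnat.leP) in H1. split; [lia|].
    intros d Hd [k Hk]. set (m := Z.to_nat d).
    assert (D : is_true (div.dvdn m n)).
    { apply (ssrbool.introT div.dvdnP). exists (Z.to_nat k).
      change (n = (Z.to_nat k * m)%nat). unfold m. nia. }
    apply H2 in D. apply Bool.orb_prop in D.
    destruct D as [D|D]; apply (ssrbool.elimT eqtype.eqP) in D; unfold m in D; lia.
  - intros [H1 H2]. apply (ssrbool.introT prime.primeP). split.
    + apply (ssrbool.introT ssrnat.leP). lia.
    + intros d D. apply (ssrbool.elimT div.dvdnP) in D. destruct D as [k Hk].
      change (n = (k * d)%nat) in Hk.
      apply Bool.orb_true_intro.
      destruct (Nat.eq_dec d 1) as [->|N1]; [left; apply (ssrbool.introT eqtype.eqP); reflexivity|].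
      destruct (Nat.eq_dec d n) as [->|N2]; [right; apply (ssrbool.introT eqtype.eqP); reflexivity|].
      exfalso. apply (H2 (Z.of_nat d)).
      * destruct k; nia.
      * exists (Z.of_nat k). lia.
Qed.

Definition divides_b (q p : nat) : bool := if Zdivide_dec (Z.of_nat p) (Z.of_nat q) then true else false.

Lemma psum_out (f : nat -> R) q N : (0 < q)%nat -> (S q <= N)%nat ->
  psum (fun p => if divides_b q p then f p else 0) N = psum (fun p => if divides_b q p then f p else 0) (S q).
Proof.
  intros Hq. induction 1 as [|N H IH]; auto. cbn [psum]. cbn [psum] in IH. rewrite IH.
  assert (D : divides_b q N = false).
  { unfold divides_b. destruct (Zdivide_dec _ _) as [Hd|]; auto. apply Z.divide_pos_le in Hd; lia. }
  rewrite D. destruct (prime.prime N); ring.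
Qed.

Lemma prod_prime_divisors_exp q (f : nat -> R) : (forall p, prime.prime p = true -> 0 < f p) ->
  prod_prime_divisors q f = exp (psum (fun p => if divides_b q p then ln (f p) else 0) (S q)).
Proof.
  intros Hf. unfold prod_prime_divisors, Defs.prime_divisors.
  set (P := fun p : nat => if prime_dec (Z.of_nat p) then if Zdivide_dec (Z.of_nat p) (Z.of_nat q) then true else false else false).
  assert (PE : forall p, P p = (prime.prime p && divides_b q p)%bool).
  { intros p. unfold P, divides_b. destruct (prime_dec (Z.of_nat p)) as [H|H].
    - apply prime_iff_Zprime in H. rewrite H. reflexivity.
    - destruct (prime.prime p) eqn:E; auto. exfalso. apply H. now apply prime_iff_Zprime. }
  assert (App : forall l x, fold_right Rmult 1 (l ++ x :: nil) = fold_right Rmult 1 l * x).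
  { induction l; intros; simpl; [ring|]. rewrite IHl. ring. }
  assert (G : forall n, fold_right Rmult 1 (map f (filter P (seq 1 n))) =
    exp (psum (fun p => if divides_b q p then ln (f p) else 0) (S n))).
  { induction n as [|n IH].
    - simpl. rewrite Rplus_0_r. symmetry. apply exp_0.
    - rewrite seq_S, filter_app, map_app. simpl (filter P _).
      rewrite PE. change (psum (fun p => if divides_b q p then ln (f p) else 0) (S (S n))) with
        (psum (fun p => if divides_b q p then ln (f p) else 0) (S n) +
          (if prime.prime (S n) then if divides_b q (S n) then ln (f (S n)) else 0 else 0)).
      rewrite exp_plus, <- IH. destruct (prime.prime (S n)) eqn:E; simpl.
      + destruct (divides_b q (S n)); simpl.
        * rewrite App, exp_ln by auto. reflexivity.
        * rewrite app_nil_r, exp_0. ring.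
      + rewrite app_nil_r, exp_0. ring. }
  apply G.
Qed.

Lemma character_zero_on_divisors q chi p : dirichlet_character q chi -> prime.prime p = true ->
  divides_b q p = true -> chi (Z.of_nat p) = RtoC 0.
Proof.
  intros H Hp Hd. apply NNPP. intros N. apply (character_support _ _ H) in N.
  unfold divides_b in Hd. destruct (Zdivide_dec _ _) as [D|]; [|discriminate].
  apply prime_iff_Zprime in Hp. apply Z.divide_gcd_iff in D; [|lia]. rewrite D in N.
  destruct Hp as [Hp _]. lia.
Qed.

(** The factors at primes dividing [q] are 1; this is where the product over [p | q] in the final
    bound originates. *)
Lemma Cmod_pprod_le q chi s N : dirichlet_character q chi -> 1 <= Re s ->
  Cmod (pprod (dcoef (fun n => chi (Z.of_nat n)) s) N) <=
  exp (psum (fun p => if divides_b q p then 0 else ln (1 + / INR p)) N).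
Proof.
  intros H Hs. set (c := fun n => chi (Z.of_nat n)).
  assert (Hc : forall n, Cmod (c n) <= 1) by (intros; now apply dirichlet_chi_le_1 with q).
  induction N as [|N IH]; [simpl; rewrite Cmod_1, exp_0; lra|].
  cbn [pprod psum]. destruct (prime.prime N) eqn:Hp.
  - rewrite Cmod_mult, exp_plus. apply Rmult_le_compat; auto using Cmod_ge_0.
    assert (p2 := INR_prime_ge_2 N Hp). assert (L := ln_prime_pos N Hp).
    assert (I0 : 0 < / INR N) by (apply Rinv_0_lt_compat; lra).
    destruct (divides_b q N) eqn:D.
    + unfold dcoef, c. rewrite (character_zero_on_divisors q chi N H Hp D), exp_0.
      replace (1 - 0 * phi 0 (ln (INR N)) s)%C with (RtoC 1) by ring. rewrite Cmod_1. lra.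
    + rewrite exp_ln by lra. eapply Rle_trans; [apply Cmod_minus_le|]. rewrite Cmod_1.
      apply Rplus_le_compat_l. eapply Rle_trans; [now apply dcoef_le|].
      replace (/ INR N) with (exp (- ln (INR N))) by (rewrite exp_Ropp, exp_ln; lra).
      apply exp_le. nra.
  - rewrite Cmult_1_r, Rplus_0_r. exact IH.
Qed.

Lemma dcoef_one_real (x : R) p : dcoef (fun _ => RtoC 1) (RtoC x) p = RtoC (Rpower (INR p) (- x)).
Proof.
  unfold dcoef, phi, Rpower. simpl (_ ^ 0).
  replace (- RtoC x * RtoC (ln (INR p)))%C with (RtoC (- x * ln (INR p))) by (rewrite RtoC_mult, RtoC_opp; ring).
  rewrite Cexp_R. ring.
Qed.

Lemma Rpower_prime_range p x : prime.prime p = true -> 0 < x -> 0 < Rpower (INR p) (- x) < 1.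
Proof.
  intros Hp Hx. assert (L := ln_prime_pos p Hp). unfold Rpower. split; [apply exp_pos|].
  rewrite <- exp_0. apply exp_increasing. nra.
Qed.

Lemma Cmod_pprod_one (x : R) N : 0 < x ->
  Cmod (pprod (dcoef (fun _ => RtoC 1) (RtoC x)) N) = exp (psum (fun p => ln (1 - Rpower (INR p) (- x))) N).
Proof.
  intros Hx. induction N as [|N IH]; [simpl; rewrite Cmod_1, exp_0; auto|].
  cbn [pprod psum]. destruct (prime.prime N) eqn:Hp.
  - assert (B := Rpower_prime_range N x Hp Hx).
    rewrite Cmod_mult, IH, exp_plus, exp_ln by lra. f_equal.
    rewrite dcoef_one_real, <- RtoC_minus, Cmod_R. apply Rabs_pos_eq. lra.
  - rewrite Cmult_1_r, Rplus_0_r. exact IH.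
Qed.

Lemma one_le n : Cmod ((fun _ : nat => RtoC 1) n) <= 1.
Proof. cbv beta. rewrite Cmod_1. lra. Qed.

Lemma one_ctotally_mult : ctotally_mult (fun _ => RtoC 1).
Proof. split; [reflexivity|intros; ring]. Qed.

(** [zeta (1 + eta) <= 1 + / eta], and the products of [1 - p^(-1-eta)] decrease to its reciprocal.
    This is the hypothesis of [Mertens_third_upper]. *)
Lemma zeta_product_upper eta N : 0 < eta <= 1 ->
  psum (fun p => - ln (1 - Rpower (INR p) (- (1 + eta)))) N <= ln (1 + / eta).
Proof.
  intros He. set (s := RtoC (1 + eta)).
  assert (I0 : 0 < / eta) by (apply Rinv_0_lt_compat; lra).
  destruct (dseries_cv (fun _ => RtoC 1) s one_le ltac:(simpl; lra)) as [Z HZ].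
  assert (Eu := euler_dirichlet _ s Z one_ctotally_mult one_le ltac:(simpl; lra) HZ).
  assert (BZ : Cmod Z <= 1 + / eta).
  { apply Ccv_le_mod with (csum (dterm (fun _ => RtoC 1) 0 s)); auto. intros n.
    eapply Rle_trans; [apply csum_mod|]. eapply Rle_trans; [|apply (zeta_partial_le eta n); lra].
    apply rsum_le. intros k _. unfold dterm. rewrite Cmod_mult, Cmod_1, Cmod_phi0. simpl (Re s). lra. }
  set (S := psum (fun p => ln (1 - Rpower (INR p) (- (1 + eta)))) N).
  assert (Key : 1 <= (1 + / eta) * exp S).
  { apply le_epsilon. intros e He'. destruct (Eu e He') as [N1 HN1].
    specialize (HN1 (max N1 N) (Nat.le_max_l _ _)).
    assert (T := Cmod_triangle' (RtoC 1) (Z * pprod (dcoef (fun _ => RtoC 1) s) (max N1 N))).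
    rewrite Cmod_1, Cmod_minus_sym, Cmod_mult in T. unfold s in T, HN1. rewrite Cmod_pprod_one in T by lra.
    assert (Mo : exp (psum (fun p => ln (1 - Rpower (INR p) (- (1 + eta)))) (max N1 N)) <= exp S).
    { apply exp_le. unfold S.
      assert (K := psum_incr_le (fun p => ln (1 - Rpower (INR p) (- (1 + eta)))) (fun _ => 0) N (max N1 N) (Nat.le_max_r _ _)).
      rewrite !psum_0 in K. assert (K' : psum (fun p => ln (1 - Rpower (INR p) (- (1 + eta)))) (max N1 N) - psum (fun p => ln (1 - Rpower (INR p) (- (1 + eta)))) N <= 0 - 0); [|lra].
      apply K. intros p Hp _. assert (B := Rpower_prime_range p (1 + eta) Hp ltac:(lra)).
      rewrite <- ln_1. apply ln_le; lra. }
    assert (Cmod Z * exp (psum (fun p => ln (1 - Rpower (INR p) (- (1 + eta)))) (max N1 N)) <= (1 + / eta) * exp S).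
    { apply Rmult_le_compat; auto using Cmod_ge_0. left; apply exp_pos. }
    lra. }
  assert (E : psum (fun p => - ln (1 - Rpower (INR p) (- (1 + eta)))) N = - S).
  { unfold S. replace (- psum (fun p => ln (1 - Rpower (INR p) (- (1 + eta)))) N) with
      (-1 * psum (fun p => ln (1 - Rpower (INR p) (- (1 + eta)))) N) by ring.
    rewrite <- psum_scal. apply psum_ext. intros; ring. }
  rewrite E. rewrite <- (ln_exp (- S)). apply ln_le; [apply exp_pos|].
  rewrite exp_Ropp. apply Rmult_le_reg_r with (exp S); [apply exp_pos|].
  rewrite Rinv_l; auto. apply Rgt_not_eq, exp_pos.
Qed.

(** The Euler product at 2, with the value of the series from [basel]. *)
Lemma zeta_2_product eps : 0 < eps -> exists N0, forall N, (N0 <= N)%nat ->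
  psum (fun p => ln (1 - / INR p * / INR p)) N <= eps - ln (PI ^ 2 / 6).
Proof.
  intros He. set (z := PI ^ 2 / 6). assert (P := PI_RGT_0).
  assert (z0 : 0 < z) by (unfold z; apply Rdiv_lt_0_compat; [apply pow_lt; lra|lra]).
  assert (T : forall k, dterm (fun _ => RtoC 1) 0 (RtoC 2) k = RtoC (/ INR (S k) ^ 2)).
  { intros k. change (dterm (fun _ => RtoC 1) 0 (RtoC 2) k) with (dcoef (fun _ => RtoC 1) (RtoC 2) (S k)).
    rewrite dcoef_one_real. f_equal. assert (0 < INR (S k)) by (apply lt_0_INR; lia).
    rewrite Rpower_Ropp. f_equal. replace 2 with (INR 2) by (simpl; ring). now apply Rpower_pow. }
  assert (HZ : Ccv (csum (dterm (fun _ => RtoC 1) 0 (RtoC 2))) (RtoC z)).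
  { intros e He'. assert (B := basel). apply is_lim_seq_spec in B. destruct (B (mkposreal e He')) as [N HN].
    exists N. intros n Hn. specialize (HN n Hn). simpl in HN.
    rewrite (csum_ext _ (fun k => RtoC (/ INR (S k) ^ 2))) by (intros; apply T).
    assert (G : forall m, csum (fun k => RtoC (/ INR (S k) ^ 2)) m = RtoC (rsum (fun k => / INR (S k) ^ 2) m)).
    { induction m as [|m IH]; [reflexivity|]. cbn [rsum csum]. rewrite RtoC_plus, IH. reflexivity. }
    rewrite G, <- RtoC_minus, Cmod_R. exact HN. }
  assert (Eu := euler_dirichlet _ (RtoC 2) _ one_ctotally_mult one_le ltac:(simpl; lra) HZ).
  destruct (Eu (Rmin eps 1) ltac:(apply Rmin_pos; lra)) as [N0 HN0]. exists N0. intros N HN. specialize (HN0 N HN).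
  assert (T1 := Cmod_triangle' (RtoC z * pprod (dcoef (fun _ => RtoC 1) (RtoC 2)) N) 1).
  rewrite Cmod_1, Cmod_mult, Cmod_R, Rabs_pos_eq, Cmod_pprod_one in T1 by lra.
  assert (M1 := Rmin_l eps 1).
  set (S := psum (fun p => ln (1 - Rpower (INR p) (Ropp 2))) N) in *.
  assert (ES : psum (fun p => ln (1 - / INR p * / INR p)) N = S).
  { apply psum_ext. intros p Hp _. apply INR_prime_ge_2 in Hp. do 2 f_equal.
    rewrite Rpower_Ropp. replace 2 with (INR 2) at 1 by (simpl; ring). rewrite Rpower_pow by lra.
    simpl. field. lra. }
  rewrite ES. assert (L : ln (z * exp S) <= eps).
  { apply Rle_trans with (ln (1 + eps)); [apply ln_le; [apply Rmult_lt_0_compat; auto; apply exp_pos|lra]|].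
    apply ln_1p_le. lra. }
  rewrite ln_mult, ln_exp in L by (auto; apply exp_pos). lra.
Qed.

(** [euler_constant] is defined as the real part of an extended limit; the sequence decreases and is
    bounded below by 0, so the limit is finite. *)
Lemma euler_constant_lim :
  is_lim_seq (fun n => rsum (fun m => / INR (S m)) (S n) - ln (INR (S n))) euler_constant.
Proof.
  set (u := fun n => rsum (fun m => / INR (S m)) (S n) - ln (INR (S n))).
  assert (Step : forall n, 0 < INR (S n) /\ / (INR (S n) + 1) <= ln (INR (S n) + 1) - ln (INR (S n)) <= / INR (S n)).
  { intros n. assert (Hx : 0 < INR (S n)) by (apply lt_0_INR; lia). split; auto. now apply ln_succ_bounds. }
  destruct (ex_finite_lim_seq_decr u 0) as [l Hl].
  - intros n. unfold u. cbn [rsum]. destruct (Step n) as [S0 [S1 _]]. rewrite (S_INR (S n)). lra.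
  - intros n. unfold u.
    assert (H : ln (INR (S (S n))) <= rsum (fun m => / INR (S m)) (S n)).
    { induction n as [|n IH].
      - destruct (Step O) as [S0 [_ S2]]. cbn [rsum]. rewrite (S_INR 1).
        change (INR 1) with 1 in *. rewrite ln_1 in S2. lra.
      - cbn [rsum] in *. destruct (Step (S n)) as [S0 [_ S2]]. rewrite (S_INR (S (S n))). lra. }
    destruct (Step n) as [S0 [S1 _]]. rewrite (S_INR (S n)) in H.
    assert (0 < / (INR (S n) + 1)) by (apply Rinv_0_lt_compat; lra). lra.
  - assert (E : euler_constant = l).
    { unfold euler_constant. rewrite (Lim_seq_ext _ u).
      - now rewrite (is_lim_seq_unique _ _ Hl).
      - intros n. unfold u. f_equal. induction n; [rewrite sum_O; cbn [rsum]; symmetry; apply Rplus_0_l|].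
        rewrite sum_Sn, IHn. reflexivity. }
    rewrite E. exact Hl.
Qed.

(** [1 + 1/p = (1 - 1/p^2) / (1 - 1/p)]: zeta(2) for the numerator, Mertens for the denominator. The
    harmonic number of [M] becomes [ln M] plus Euler's constant, and [ln (ln 2) + ln M] is
    [ln ln (2^M)]. *)
Lemma euler_product_upper eps : 0 < eps -> exists M0, forall M, (M0 <= M)%nat ->
  psum (fun p => ln (1 + / INR p)) (2 ^ M) <= eps - ln (PI ^ 2 / 6) + ln (ln 2) + ln (INR M) + euler_constant.
Proof.
  intros He. destruct (zeta_2_product (eps / 3) ltac:(lra)) as [N0 HN0].
  destruct (Mertens_third_upper (fun eta H N => zeta_product_upper eta N H) (eps / 3) ltac:(lra)) as [M1 HM1].
  assert (Eg := euler_constant_lim). apply is_lim_seq_spec in Eg.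
  destruct (Eg (mkposreal (eps / 3) ltac:(lra))) as [M2 HM2].
  exists (S (N0 + M1 + M2)). intros M HM.
  assert (HN : (N0 <= 2 ^ M)%nat).
  { assert (H := Nat.pow_gt_lin_r 2 M ltac:(lia)). lia. }
  specialize (HN0 _ HN). specialize (HM1 M ltac:(lia)).
  (* The sequence defining Euler's constant has the harmonic number of [n + 1] at index [n]. *)
  specialize (HM2 (pred M) ltac:(lia)).
  change (Rabs (rsum (fun m => / INR (S m)) (S (pred M)) - ln (INR (S (pred M))) - euler_constant) < eps / 3) in HM2.
  replace (S (pred M)) with M in HM2 by lia.
  apply Rabs_lt_between in HM2.
  rewrite (psum_ext _ (fun p => ln (1 - / INR p * / INR p) + mertens_term p)).
  - rewrite psum_plus. lra.
  - intros p Hp _. apply INR_prime_ge_2 in Hp. unfold mertens_term.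
    assert (I : / INR p <= / 2) by (apply Rinv_le_contravar; lra).
    assert (I0 : 0 < / INR p) by (apply Rinv_0_lt_compat; lra).
    replace (1 - / INR p * / INR p) with ((1 + / INR p) * (1 - / INR p)) by ring.
    rewrite ln_mult by lra. ring.
Qed.

Lemma exp_ge_sqr x : 0 <= x -> x ^ 2 / 4 <= exp x.
Proof.
  intros Hx. replace x with (x / 2 + x / 2) at 2 by field. rewrite exp_plus.
  assert (H := exp_ineq1_le (x / 2)). nra.
Qed.

(** Chooses the cut. Four losses of [theta / 4] add up to [theta]: the interpolation error [K / M],
    the Euler product, the rounding of [M], and the excess of [lam] over 2. *)
Lemma L_function_lower_bound (hGRH : GRH) q chi theta : (1 < q)%nat -> primitive_character q chi ->
  0 < theta -> exists T0, forall s, 1 <= Re s -> T0 < Im s ->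
    PI ^ 2 * exp (- euler_constant) / 12 * prod_prime_divisors q (fun p : nat => (INR p + 1) / INR p) * exp (- theta)
      <= Cmod (L_function chi s) * ln (ln (Im s)).
Proof.
  intros Hq HP Hth. assert (BL := ln2_bounds).
  set (lam := 2 * exp (theta / 4)).
  assert (Hlam : 2 < lam).
  { unfold lam. assert (H := exp_ineq1_le (theta / 4)). lra. }
  (* Midway between [/ lam] and [1 / 2]: then [a < 1 / 2], yet [a * lam] exceeds 1 by [ka], and the
     surplus [exp (ka * y)] outgrows [M]. *)
  set (a := (1 / 2 + / lam) / 2).
  assert (Il : / lam < / 2) by (apply Rinv_lt_contravar; lra).
  assert (Il0 : 0 < / lam) by (apply Rinv_0_lt_compat; lra).
  assert (Ha : 0 < a < 1 / 2) by (unfold a; lra).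
  set (ka := a * lam - 1).
  assert (Eka : ka = lam / 4 - 1 / 2) by (unfold ka, a; field; lra).
  assert (Hka : 0 < ka) by lra.
  destruct (main_estimate hGRH q chi a Hq HP Ha) as (K & M0 & t0 & HK & Main).
  destruct (euler_product_upper (theta / 4) ltac:(lra)) as [M1 HM1].
  set (B := 4 * (2 * lam + 1)).
  assert (HB : 0 < B) by (unfold B; lra).
  (* The summands serve in turn: [1 < y], the lower bounds on [M], [M <= ln t], the absorption of
     [M] by [exp (ka * y)], the error [K / M], and the rounding of [M]. *)
  set (Y0 := 1 + INR (M0 + M1 + q) + B + B / ka ^ 2 + 4 * K / theta + / (lam * (theta / 4))).
  exists (Rmax t0 (exp (exp Y0))). intros s Hs Ht.
  assert (Ht0 := Rle_lt_trans _ _ _ (Rmax_l _ _) Ht).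
  assert (Ht1 := Rle_lt_trans _ _ _ (Rmax_r _ _) Ht).
  set (t := Im s) in *. set (y := ln (ln t)).
  assert (L1 : exp Y0 < ln t).
  { rewrite <- (ln_exp (exp Y0)). apply ln_increasing; auto. apply exp_pos. }
  assert (L2 : Y0 < y).
  { unfold y. rewrite <- (ln_exp Y0). apply ln_increasing; auto. apply exp_pos. }
  assert (Ey : ln t = exp y) by (unfold y; rewrite exp_ln; auto; eapply Rlt_trans; [apply exp_pos|exact L1]).
  assert (ka2 : 0 < ka ^ 2) by (apply pow_lt; auto).
  assert (P1 := pos_INR (M0 + M1 + q)).
  assert (P2 : 0 < B / ka ^ 2) by (apply Rdiv_lt_0_compat; lra).
  assert (P3 : 0 <= 4 * K / theta) by (apply Rdiv_le_0_compat; lra).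
  assert (lt0 : 0 < lam * (theta / 4)) by (apply Rmult_lt_0_compat; lra).
  assert (P4 : 0 < / (lam * (theta / 4))) by (apply Rinv_0_lt_compat; auto).
  assert (C1 : 1 < y) by (unfold Y0 in L2; lra).
  assert (C2 : INR (M0 + M1 + q) < y) by (unfold Y0 in L2; lra).
  assert (C3 : B < y) by (unfold Y0 in L2; lra).
  assert (C4 : B / ka ^ 2 < y) by (unfold Y0 in L2; lra).
  assert (C5 : 4 * K / theta < y) by (unfold Y0 in L2; lra).
  assert (C6 : / (lam * (theta / 4)) < y) by (unfold Y0 in L2; lra).
  clear L2. clearbody Y0.
  (* [2^M] is the first power of 2 above [(ln t)^lam]. *)
  destruct (nfloor_ex (lam * y / ln 2)) as [m [Hm1 Hm2]].
  { apply Rdiv_le_0_compat; nra. }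
  set (M := S m). assert (EM : INR M = INR m + 1) by apply S_INR.
  assert (My : lam * y < INR M * ln 2).
  { rewrite EM. apply Rlt_div_l in Hm2; lra. }
  assert (My2 : INR M * ln 2 <= lam * y + 1).
  { rewrite EM. apply Rle_div_r in Hm1; lra. }
  assert (yM : y < INR M) by nra.
  assert (Mle : INR M <= (2 * lam + 1) * y).
  { rewrite EM. apply Rle_trans with (2 * lam * y + 1); [|nra].
    apply Rplus_le_compat_r. eapply Rle_trans; [exact Hm1|]. apply Rle_div_l; [lra|].
    assert (0 <= lam * y * (2 * ln 2 - 1)) by (apply Rmult_le_pos; nra). lra. }
  assert (MM : (M0 + M1 + q < M)%nat) by (apply INR_lt; lra).
  assert (A1 : INR M <= ln t).
  { rewrite Ey. eapply Rle_trans; [exact Mle|]. eapply Rle_trans; [|apply exp_ge_sqr; lra].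
    unfold B in C3. nra. }
  assert (A2 : ln t * INR M <= exp (a * ln 2) ^ M).
  { rewrite <- exp_INR_pow, Ey. apply Rle_trans with (exp (y + ka * y)).
    - rewrite exp_plus. apply Rmult_le_compat_l; [left; apply exp_pos|].
      eapply Rle_trans; [exact Mle|]. eapply Rle_trans; [|apply exp_ge_sqr; nra].
      apply Rlt_div_l in C4; auto. rewrite Rpow_mult_distr. unfold B in C4. nra.
    - apply exp_le. replace (y + ka * y) with (a * (lam * y)) by (unfold ka; ring).
      apply Rmult_le_compat_l; lra. }
  specialize (Main s M Hs ltac:(fold t; lra) ltac:(lia) A1 A2).
  rewrite Cmod_mult in Main.
  assert (PB := Cmod_pprod_le q chi s (2 ^ M) (proj1 HP) Hs).
  set (Q := psum (fun p => if divides_b q p then ln ((INR p + 1) / INR p) else 0) (S q)).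
  assert (EQ : prod_prime_divisors q (fun p : nat => (INR p + 1) / INR p) = exp Q).
  { apply prod_prime_divisors_exp. intros p Hp. apply INR_prime_ge_2 in Hp. apply Rdiv_lt_0_compat; lra. }
  assert (Eg : psum (fun p => if divides_b q p then 0 else ln (1 + / INR p)) (2 ^ M) =
    psum (fun p => ln (1 + / INR p)) (2 ^ M) - Q).
  { assert (H2 : (S q <= 2 ^ M)%nat).
    { assert (H := Nat.pow_gt_lin_r 2 M ltac:(lia)). lia. }
    unfold Q. rewrite <- (psum_out _ q (2 ^ M)) by (auto; lia).
    assert (E : psum (fun p => ln (1 + / INR p)) (2 ^ M) =
      psum (fun p => if divides_b q p then 0 else ln (1 + / INR p)) (2 ^ M) +
      psum (fun p => if divides_b q p then ln ((INR p + 1) / INR p) else 0) (2 ^ M)).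
    { rewrite <- psum_plus. apply psum_ext. intros p Hp _. apply INR_prime_ge_2 in Hp.
      destruct (divides_b q p); [|ring].
      rewrite Rplus_0_l. f_equal. field. lra. }
    lra. }
  specialize (HM1 M ltac:(lia)).
  set (z := PI ^ 2 / 6) in *. assert (PP := PI_RGT_0).
  assert (z0 : 0 < z) by (unfold z; apply Rdiv_lt_0_compat; [apply pow_lt; lra|lra]).
  set (W := psum (fun p => if divides_b q p then 0 else ln (1 + / INR p)) (2 ^ M)) in *.
  assert (LB : exp (- (K / INR M) - W) <= Cmod (L_function chi s)).
  { unfold Rminus. rewrite exp_plus, exp_Ropp with (x := W).
    apply Rle_div_l; [apply exp_pos|]. eapply Rle_trans; [exact Main|].
    apply Rmult_le_compat_l; [apply Cmod_ge_0|exact PB]. }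
  apply Rle_trans with (exp (- (K / INR M) - W) * exp (ln y)).
  2:{ rewrite exp_ln by lra. apply Rmult_le_compat_r; lra. }
  rewrite EQ, <- exp_plus.
  replace (PI ^ 2 * exp (- euler_constant) / 12 * exp Q * exp (- theta)) with
    (exp (ln (z / 2) + - euler_constant + Q + - theta)).
  2:{ rewrite !exp_plus, exp_ln by lra. unfold z. field. }
  apply exp_le. rewrite ln_div by lra.
  assert (KM : K / INR M <= theta / 4).
  { apply Rle_div_l; [lra|]. apply Rlt_div_l in C5; [|lra]. nra. }
  assert (LM : ln (INR M) + ln (ln 2) <= ln lam + theta / 4 + ln y).
  { assert (e0 := exp_pos (theta / 4)).
    rewrite <- ln_mult by lra. rewrite <- (ln_exp (theta / 4)), <- !ln_mult by (repeat apply Rmult_lt_0_compat; lra).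
    apply ln_le; [nra|]. eapply Rle_trans; [exact My2|].
    assert (H := exp_ineq1_le (theta / 4)).
    assert (G : 1 <= lam * (theta / 4) * y).
    { apply Rmult_lt_compat_l with (r := lam * (theta / 4)) in C6; auto. rewrite Rinv_r in C6; lra. }
    assert (lam * (1 + theta / 4) * y <= lam * exp (theta / 4) * y).
    { apply Rmult_le_compat_r; [lra|]. apply Rmult_le_compat_l; lra. }
    lra. }
  assert (Ll : ln lam = ln 2 + theta / 4).
  { unfold lam. rewrite ln_mult by (try lra; apply exp_pos). now rewrite ln_exp. }
  lra.
Qed.

(** As [exp (- theta)] is arbitrarily close to 1, every real below the constant is an eventual lower
    bound, hence belongs to the set whose supremum is the limit inferior. *)
Theorem theorem3 (hGRH : GRH) (q : nat) (hq : (2 < q)%nat)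
    (chi : Z -> C) (hchi : primitive_character q chi) :
  Rbar_le
    (Finite (PI ^ 2 * exp (- euler_constant) / 12 *
             prod_prime_divisors q (fun p : nat => (INR p + 1) / INR p)))
    (LimInf_filter
       (within (fun rho : C => critical_point riemann_zeta rho /\ 1 <= Re rho)
          Im_p_infty)
       (fun rho : C => Cmod (L_function chi rho) * ln (ln (Im rho)))).
Proof.
  set (c := PI ^ 2 * exp (- euler_constant) / 12 *
    prod_prime_divisors q (fun p : nat => (INR p + 1) / INR p)).
  assert (c0 : 0 < c).
  { unfold c. apply Rmult_lt_0_compat.
    - assert (P := PI_RGT_0). apply Rdiv_lt_0_compat; [|lra].
      apply Rmult_lt_0_compat; [apply pow_lt; lra|apply exp_pos].
    - rewrite prod_prime_divisors_exp; [apply exp_pos|].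
      intros p Hp. apply INR_prime_ge_2 in Hp. apply Rdiv_lt_0_compat; lra. }
  set (E := fun x : R => within (fun rho : C => critical_point riemann_zeta rho /\ 1 <= Re rho)
    Im_p_infty (fun rho => x <= Cmod (L_function chi rho) * ln (ln (Im rho)))).
  assert (HE : forall x, x < c -> E x).
  { intros x Hx.
    (* The constant [c] is positive, so for [x <= 0] any [theta] serves; otherwise
       [theta = ln (c / x)] gives equality. *)
    assert (Hth : exists theta, 0 < theta /\ x <= c * exp (- theta)).
    { destruct (Rle_lt_dec x 0) as [L|L].
      - exists 1. split; [lra|]. assert (P := exp_pos (- (1))). nra.
      - exists (ln (c / x)). split.
        + rewrite <- ln_1. apply ln_increasing; [lra|]. apply Rlt_div_r; lra.
        + rewrite exp_Ropp, exp_ln by (apply Rdiv_lt_0_compat; lra). right. field. lra. }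
    destruct Hth as [theta [Hth Hxt]].
    destruct (L_function_lower_bound hGRH q chi theta ltac:(lia) hchi Hth) as [T0 HT].
    exists T0. intros s Hs [_ Hre]. eapply Rle_trans; [exact Hxt|]. now apply HT. }
  change (Rbar_le (Finite c) (Lub_Rbar E)).
  destruct (Lub_Rbar_correct E) as [Hub _].
  destruct (Lub_Rbar E) as [l| |]; simpl; auto.
  - destruct (Rle_lt_dec c l) as [|L]; auto. exfalso.
    specialize (Hub _ (HE ((c + l) / 2) ltac:(lra))). simpl in Hub. lra.
  (* The value minus infinity is excluded by the member [c / 2] of the set. *)
  - apply (Hub (c / 2)). apply HE. lra.
Qed.
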